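(* Let $N > 30$ and $D > 3$ be real numbers with $(\log N)^{1/4} > \log D$, and let $r$ be a positive integer with \[\left| r - \log\left(\frac{\log N}{\log D}\right)\right| \le \left(\log\left(\frac{\log N}{\log D}\right)\right)^{2/3}.\] Choose $n$ uniformly at random from $S_r(N, D)$. Then: (1) For $D_1 > 3$, the probability that $n$ is not comfortably spaced above $D_1$ is $O((\log D_1)^{-1}) + O((\log N)^{-1/2})$. (2) There is a constant $c>0$ such that for $C_0 > 0$, the probability that $n$ is not $C_0$-regular is $O(\exp(-c C_0)) + O(\exp(-c(\log \log N)^{1/3}))$. (3) There is a constant $c>0$ such that the probability that $n$ is not extravagantly spaced is $O(\exp(-c (\log \log \log N)^{1/2}))$. All implicit constants are absolute.
   Context: $S_r(N,D)$ is the set of squarefree positive integers less than $N$ with exactly $r$ prime factors and no prime factor less than $D$. For $n\in S_r(N,D)$ let $p_1<\dots<p_r$ be its prime factors. $n$ is comfortably spaced above $D_1$ if for every $i<r$ with $p_i>D_1$ we have $4D_1<2p_i<p_{i+1}$. $n$ is $C_0$-regular if for all $i\le r/3$, $|\log\log p_i-\log\log D-i|<C_0^{1/5}\max(i,C_0)^{4/5}$. $n$ is extravagantly spaced if for some integer $m$ with $0.5r^{1/2}<m<0.5r$ we have $\log p_m\ge \log\!\left(\frac{\log p_m}{\log D}\right)\cdot(\log\log\log N)^{1/2}\cdot\sum_{i=1}^{m-1}\log p_i$. *)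

(* Defs.v *)
From Stdlib Require Import Reals ZArith ClassicalEpsilon.
From mathcomp Require Import all_boot.

Set Implicit Arguments. Unset Strict Implicit.

Open Scope R_scope.

Definition dec (P : Prop) : bool :=
  if excluded_middle_informative P then true else false.

Definition squarefree (n : nat) : Prop :=
  forall p : nat, prime p -> ~ (p * p %| n)%N.

(* the i-th smallest prime factor p_i of n (1-indexed); primes n is sorted *)
Definition pf (n i : nat) : nat := nth 0%N (primes n) (i - 1)%N.

Definition in_S (r : nat) (N D : R) (n : nat) : Prop :=
  (0 < n)%N /\ INR n < N /\ squarefree n /\ size (primes n) = r /\
  (forall p : nat, p \in primes n -> D <= INR p).

(* every element of S_r(N,D) is < up N, so this list contains all of them *)
Definition cands (N : R) : seq nat := iota 0 (Z.to_nat (up N)).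

Definition card_S (r : nat) (N D : R) : nat :=
  size (filter (fun n => dec (in_S r N D n)) (cands N)).

(* probability that a uniformly random n ∈ S_r(N,D) satisfies P
   (convention: 0 if S_r(N,D) is empty, since x / 0 = 0) *)
Definition prob_S (r : nat) (N D : R) (P : nat -> Prop) : R :=
  INR (size (filter (fun n => dec (in_S r N D n /\ P n)) (cands N)))
  / INR (card_S r N D).

Definition comfortably_spaced (r : nat) (D1 : R) (n : nat) : Prop :=
  forall i : nat, (1 <= i)%N -> (i < r)%N -> D1 < INR (pf n i) ->
    4 * D1 < 2 * INR (pf n i) /\ 2 * INR (pf n i) < INR (pf n i.+1).

Definition regular (r : nat) (D C0 : R) (n : nat) : Prop :=
  forall i : nat, (1 <= i)%N -> INR i <= INR r / 3 ->
    Rabs (ln (ln (INR (pf n i))) - ln (ln D) - INR i)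
      < Rpower C0 (1/5) * Rpower (Rmax (INR i) C0) (4/5).

Definition sum_logs (n m : nat) : R :=
  foldr Rplus 0 (map (fun i => ln (INR (pf n i))) (iota 1 (m - 1))).

Definition extravagantly_spaced (r : nat) (N D : R) (n : nat) : Prop :=
  exists m : nat, 0.5 * sqrt (INR r) < INR m /\ INR m < 0.5 * INR r /\
    ln (INR (pf n m)) >=
      ln (ln (INR (pf n m)) / ln D) * sqrt (ln (ln (ln N))) * sum_logs n m.

Definition hyps (N D : R) (r : nat) : Prop :=
  N > 30 /\ D > 3 /\ Rpower (ln N) (1/4) > ln D /\ (0 < r)%N /\
  Rabs (INR r - ln (ln N / ln D)) <= Rpower (ln (ln N / ln D)) (2/3).

(* Main.v *)
(* If most of [ln n] is carried by prime factors [p] for which [n / p] has a property [B], then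
   writing [n = p * m] and applying Chebyshev's bound to [p < N / m] shows that the number of
   such [n < N] is at most a constant times [N / ln N] times the sum of [1 / m] over the products
   [m] of [r - 1] primes of [D, N) with property [B]. Conversely, choosing the largest prime just
   below [N / m] gives [card_S >> N / ln N * P ^ (r - 1) / (r - 1)!], where [P] is the sum of [1
   / p] over the primes of [D, N). So up to constants one works in the model in which the primes
   are chosen independently with weights [1 / p], conditioned to be [r - 1] in number.

   (1) is a union bound over close pairs of primes; pairs of primes exceeding a power of [N] are
   counted trivially. (2) is a Chernoff bound for the number of primes up to each height of [ln
   ln p]. For (3), tilting the weights by [(r - 1) / P] removes the conditioning at the cost of a
   constant factor (Stirling). With [u = ln ln p - ln ln D], the dyadic blocks [U <= u < 2 * U]
   are then independent, and each contains a suitable gap after a prime [p] that dominates the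
   sum of the logarithms of the smaller primes of the block with probability at least [c / W],
   where [W = sqrt (ln (ln (ln N)))]: the expected number of primes starting a gap of ratio [20 *
   U * W] in [ln p] is about [1 / W]. There are about [W ^ 2] blocks. *)
Require Import Defs.
From Stdlib Require Import Reals ZArith Lra Lia Psatz ClassicalEpsilon Classical.
From HB Require Import structures.
From mathcomp Require Import all_boot.
From mathcomp Require Import zify.
Set Implicit Arguments. Unset Strict Implicit. Unset Printing Implicit Defensive.
Open Scope R_scope.

(** Put [x ^ 3 = ln (ln N / ln D)]. The condition on [r] places [(r - 1) / P] within [2 / x] of 1,
    and for large [N] it makes [P ^ (r - 1) / (r - 1)!] at least [sqrt (ln N)]. So [O(N / ln N)]
    exceptions have probability [O((ln N) ^ (- 1 / 2))], the second error term of (1). Bounded [N]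
    is absorbed by the constants. The obstacle in the transfer is that deleting [p] must not destroy
    the property under study. In (1) only the two close primes may not be deleted, so they must be
    small powers of [N]; in (2) a deletion changes a count by at most one; in (3) the property
    concerns only primes of small level, which carry little of [ln n]. In (3) the ratio [20 * U * W]
    is the product of [W], of [2 * U] for [ln (ln p_m / ln D)], and of 10 for the sum of the smaller
    logarithms relative to the largest of them. The bounds on [m] confine the blocks to levels from
    [x ^ 2] to [x ^ 3 / 5], so their number is of order [ln x], while [W ^ 2] is about [3 * ln x].
    Failure of all of them is exponentially small in [W]. *)

HB.instance Definition _ := Monoid.isComLaw.Build R 0 Rplus
  (fun x y z => esym (Rplus_assoc x y z)) Rplus_comm Rplus_0_l.
HB.instance Definition _ := Monoid.isComLaw.Build R 1 Rmult
  (fun x y z => esym (Rmult_assoc x y z)) Rmult_comm Rmult_1_l.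
HB.instance Definition _ := Monoid.isMulLaw.Build R 0 Rmult Rmult_0_l Rmult_0_r.
HB.instance Definition _ := Monoid.isAddLaw.Build R Rmult Rplus
  Rmult_plus_distr_r Rmult_plus_distr_l.

(** * Finite real sums and elementary inequalities *)

Notation "\rsum_ ( i <- r ) F" := (\big[Rplus/0]_(i <- r) F)
  (at level 41, F at level 41, i, r at level 50).

Lemma rsum_nil (I : Type) (f : I -> R) : \rsum_(i <- [::]) f i = 0.
Proof. exact: big_nil. Qed.
Lemma rsum_cons (I : Type) a (s : seq I) (f : I -> R) :
  \rsum_(i <- a :: s) f i = f a + \rsum_(i <- s) f i.
Proof. exact: big_cons. Qed.
Lemma rsum_cat (I : Type) (s t : seq I) (f : I -> R) :
  \rsum_(i <- s ++ t) f i = \rsum_(i <- s) f i + \rsum_(i <- t) f i.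
Proof. exact: big_cat. Qed.
Lemma rsum_map (I J : Type) (h : I -> J) (s : seq I) (f : J -> R) :
  \rsum_(i <- map h s) f i = \rsum_(i <- s) f (h i).
Proof. exact: big_map. Qed.
Lemma rsum_perm (I : eqType) (s t : seq I) (f : I -> R) :
  perm_eq s t -> \rsum_(i <- s) f i = \rsum_(i <- t) f i.
Proof. exact: perm_big. Qed.
Lemma rsum_exchange (I J : Type) (s : seq I) (t : seq J) (f : I -> J -> R) :
  \rsum_(i <- s) \rsum_(j <- t) f i j = \rsum_(j <- t) \rsum_(i <- s) f i j.
Proof. exact: exchange_big. Qed.
Lemma rsum_filter (I : Type) (P : pred I) (s : seq I) (f : I -> R) :
  \rsum_(i <- filter P s) f i = \rsum_(i <- s) (if P i then f i else 0).
Proof. by rewrite big_filter big_mkcond. Qed.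
Lemma rsum_eq (I : eqType) (s : seq I) (f g : I -> R) :
  (forall i, i \in s -> f i = g i) -> \rsum_(i <- s) f i = \rsum_(i <- s) g i.
Proof. exact: eq_big_seq. Qed.
Lemma rsum0 (I : Type) (s : seq I) : \rsum_(i <- s) 0 = 0.
Proof. exact: big1_eq. Qed.

Lemma rsum_le (I : eqType) (s : seq I) (f g : I -> R) :
  (forall i, i \in s -> f i <= g i) -> \rsum_(i <- s) f i <= \rsum_(i <- s) g i.
Proof.
elim: s => [|a s IH] H; first by rewrite !rsum_nil; lra.
rewrite !rsum_cons; apply: Rplus_le_compat; first by apply: H; rewrite mem_head.
by apply: IH => i Hi; apply: H; rewrite in_cons Hi orbT.
Qed.

Lemma rsum_ge0 (I : eqType) (s : seq I) (f : I -> R) :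
  (forall i, i \in s -> 0 <= f i) -> 0 <= \rsum_(i <- s) f i.
Proof.
elim: s => [|a s IH] H; first by rewrite rsum_nil; lra.
rewrite rsum_cons; apply: Rplus_le_le_0_compat; first by apply: H; rewrite mem_head.
by apply: IH => i Hi; apply: H; rewrite in_cons Hi orbT.
Qed.

Lemma rsum_mull (I : Type) (s : seq I) (f : I -> R) c :
  \rsum_(i <- s) (c * f i) = c * \rsum_(i <- s) f i.
Proof. by rewrite big_distrr. Qed.

Lemma rsum_add (I : Type) (s : seq I) (f g : I -> R) :
  \rsum_(i <- s) (f i + g i) = \rsum_(i <- s) f i + \rsum_(i <- s) g i.
Proof. by rewrite big_split. Qed.

Lemma rsum_sub (I : Type) (s : seq I) (f g : I -> R) :
  \rsum_(i <- s) (f i - g i) = \rsum_(i <- s) f i - \rsum_(i <- s) g i.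
Proof.
elim: s => [|a s IH]; first by rewrite !rsum_nil; lra.
by rewrite !rsum_cons IH; lra.
Qed.

Lemma rsum_const (I : Type) (s : seq I) c : \rsum_(i <- s) c = INR (size s) * c.
Proof.
elim: s => [|a s IH]; first by rewrite rsum_nil /=; lra.
rewrite rsum_cons IH -[size (a :: s)]/((size s).+1) S_INR; lra.
Qed.

Lemma rsum_count (I : Type) (s : seq I) (P : pred I) :
  INR (count P s) = \rsum_(i <- s) (if P i then 1 else 0).
Proof.
elim: s => [|a s IH]; first by rewrite rsum_nil.
rewrite rsum_cons -IH -[count P (a :: s)]/(P a + count P s)%N plus_INR; case: (P a) => /=; lra.
Qed.

Lemma rsum_le_inj (I J : eqType) (h : I -> J) (s : seq I) (t : seq J) (g : J -> R) :
  uniq s -> {in s &, injective h} -> (forall i, i \in s -> h i \in t) ->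
  (forall j, j \in t -> 0 <= g j) ->
  \rsum_(i <- s) g (h i) <= \rsum_(j <- t) g j.
Proof.
elim: s t => [|a s IH] t; first by move=> _ _ _ H; rewrite rsum_nil; apply: rsum_ge0.
rewrite cons_uniq => /andP[na us] hI hS g0.
have Ha : h a \in t by apply: hS; rewrite mem_head.
rewrite rsum_cons (rsum_perm _ (perm_to_rem Ha)) rsum_cons.
apply: Rplus_le_compat_l; apply: IH => //.
- by move=> i j Hi Hj; apply: hI; rewrite in_cons ?Hi ?Hj orbT.
- move=> i Hi; have Hit : h i \in t by apply: hS; rewrite in_cons Hi orbT.
  have : h i != h a.
    apply/negP => /eqP E; case/negP: na.
    by rewrite -(hI i a) // ?in_cons ?Hi ?eqxx ?orbT.
  move=> ne; move: Hit; rewrite (perm_mem (perm_to_rem Ha)) in_cons.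
  by rewrite (negbTE ne).
- by move=> j /mem_rem; apply: g0.
Qed.

Lemma rsum_le_sub (I : eqType) (s t : seq I) (g : I -> R) :
  uniq s -> {subset s <= t} -> (forall j, j \in t -> 0 <= g j) ->
  \rsum_(i <- s) g i <= \rsum_(j <- t) g j.
Proof. by move=> us st g0; apply: (rsum_le_inj (h := id)) => //. Qed.

Lemma rsum_mem_le (I : eqType) (s : seq I) (g : I -> R) a :
  a \in s -> (forall j, j \in s -> 0 <= g j) -> g a <= \rsum_(j <- s) g j.
Proof.
move=> Ha g0; rewrite (rsum_perm _ (perm_to_rem Ha)) rsum_cons.
have H : 0 <= \rsum_(j <- rem a s) g j by apply: rsum_ge0 => j /mem_rem; apply: g0.
lra.
Qed.

Lemma decP (P : Prop) : reflect P (dec P).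
Proof. by rewrite /dec; case: excluded_middle_informative => H; constructor. Qed.

Lemma ge1_INR n : (0 < n)%N -> 1 <= INR n.
Proof. by move=> H; rewrite -[1]/(INR 1); apply: le_INR; lia. Qed.
Lemma leq_INR m n : (m <= n)%N -> INR m <= INR n.
Proof. by move=> H; apply: le_INR; lia. Qed.
Lemma ltn_INR m n : (m < n)%N -> INR m < INR n.
Proof. by move=> H; apply: lt_INR; lia. Qed.
Lemma INR_leq m n : INR m <= INR n -> (m <= n)%N.
Proof. by move/INR_le; lia. Qed.
Lemma INR_ltn m n : INR m < INR n -> (m < n)%N.
Proof. by move/INR_lt; lia. Qed.
Lemma mulnE_INR m n : INR (m * n)%N = INR m * INR n.
Proof. exact: mult_INR. Qed.
Lemma addnE_INR m n : INR (m + n)%N = INR m + INR n.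
Proof. exact: plus_INR. Qed.

Lemma exp_ge1 x : 1 + x <= exp x.
Proof.
case: (Req_dec x 0) => [->|H]; first by rewrite exp_0; lra.
by have := exp_ineq1 x H; lra.
Qed.
Lemma exp_le x y : x <= y -> exp x <= exp y.
Proof. by case=> [H|->]; [left; apply: exp_increasing | lra]. Qed.
Lemma ln_le_mono x y : 0 < x -> x <= y -> ln x <= ln y.
Proof. by move=> x0 [H|->]; [left; apply: ln_increasing | lra]. Qed.
Lemma ln_ge0 x : 1 <= x -> 0 <= ln x.
Proof. by move=> H; rewrite -ln_1; apply: ln_le_mono; lra. Qed.
Lemma ln_sub1 x : 0 < x -> ln x <= x - 1.
Proof. by move=> H; have := exp_ge1 (ln x); rewrite exp_ln //; lra. Qed.
Lemma ln_gt1sub x : 0 < x -> 1 - / x <= ln x.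
Proof.
move=> H; have H' := Rinv_0_lt_compat _ H.
by have := ln_sub1 H'; rewrite ln_Rinv //; lra.
Qed.
Lemma ln_le_exp x y : 0 < x -> ln x <= y -> x <= exp y.
Proof. by move=> H1 H2; rewrite -(exp_ln x) //; apply: exp_le. Qed.
Lemma exp_le_ln x y : exp x <= y -> x <= ln y.
Proof. by move=> H; rewrite -(ln_exp x); apply: ln_le_mono => //; apply: exp_pos. Qed.
Lemma ln_div x y : 0 < x -> 0 < y -> ln (x / y) = ln x - ln y.
Proof.
move=> x0 y0; rewrite /Rdiv ln_mult // ?ln_Rinv //; exact: Rinv_0_lt_compat.
Qed.
Lemma rsum_iotaS m d (f : nat -> R) :
  \rsum_(k <- iota m d.+1) f k = \rsum_(k <- iota m d) f k + f (m + d)%N.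
Proof. by rewrite -[X in iota _ X]addn1 iotaD rsum_cat rsum_cons rsum_nil Rplus_0_r. Qed.

(** * Chebyshev and Mertens bounds *)

Definition primes_upto n := [seq p <- iota 1 n | prime p].
Arguments primes_upto : simpl never.

Lemma mem_primes_upto n p : (p \in primes_upto n) = prime p && (p <= n)%N.
Proof.
rewrite mem_filter mem_iota; case pp: (prime p) => //=.
by have := prime_gt0 pp; lia.
Qed.
Lemma primes_upto_uniq n : uniq (primes_upto n).
Proof. by rewrite filter_uniq // iota_uniq. Qed.

Lemma primes_uptoS n : primes_upto n.+1 = primes_upto n ++ (if prime n.+1 then [:: n.+1] else [::]).
Proof. rewrite /primes_upto -[X in iota _ X]addn1 iotaD filter_cat /= add1n; by case: (prime _).
  Qed.

Lemma rsum_primes_uptoS n f : \rsum_(p <- primes_upto n.+1) f p =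
  \rsum_(p <- primes_upto n) f p + (if prime n.+1 then f n.+1 else 0).
Proof.
by rewrite primes_uptoS rsum_cat; case: (prime _); rewrite ?rsum_cons ?rsum_nil ?Rplus_0_r.
Qed.

Lemma prod_primes_dvd (s : seq nat) X :
  uniq s -> (forall p : nat, p \in s -> prime p && (p %| X)%N) -> (\prod_(p <- s) p %| X)%N.
Proof.
elim: s => [|a s IH]; first by rewrite big_nil dvd1n.
rewrite cons_uniq => /andP[na us] H; rewrite big_cons.
have /andP[pa da] := H a (mem_head _ _).
rewrite Gauss_dvd.
  by rewrite da IH // => p Hp; apply: H; rewrite in_cons Hp orbT.
rewrite prime_coprime // Euclid_dvd_prod //; apply/negP.
rewrite big_has => /hasP[q Hq].
have /andP[pq _] : prime q && (q %| X)%N by apply: H; rewrite in_cons Hq orbT.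
rewrite dvdn_prime2 // => /eqP E; by rewrite E Hq in na.
Qed.

(** The two middle coefficients of row [2 * m + 1] are equal, and both occur in the row sum
    [2 ^ (2 * m + 1) = 2 * 4 ^ m]. *)
Lemma bin_odd_le m : ('C((m.*2).+1, m) <= 4 ^ m)%N.
Proof.
have E : 'C((m.*2).+1, m) = 'C((m.*2).+1, m.+1).
  by rewrite -bin_sub; [congr ('C(_, _)); lia | lia].
have S : ('C((m.*2).+1, m) + 'C((m.*2).+1, m.+1) <= 2 ^ (m.*2).+1)%N.
  have -> : (2 ^ (m.*2).+1 = \sum_(i < (m.*2).+2) 'C((m.*2).+1,
    i) * (1 ^ ((m.*2).+1 - i) * 1 ^ i))%N.
    exact: (expnDn 1 1).
  rewrite (bigD1 (inord m)) //= (bigD1 (inord m.+1)) /=; last first.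
    by apply/eqP => /(congr1 val); rewrite /= !inordK; lia.
  rewrite !inordK; [|lia|lia].
  by rewrite !exp1n !muln1; lia.
have E2 : (2 ^ (m.*2).+1 = 2 * 4 ^ m)%N by rewrite expnS -mul2n expnM.
by move: S; rewrite -E E2; lia.
Qed.

(** Erdős's argument. An even [n > 2] adds no prime. For [n = 2 * m + 1] the primes in
    [(m + 1, 2 * m + 1]] divide ['C(2 * m + 1, m)], so their product is at most [4 ^ m], and
    induction gives [4 ^ (m + 1)] for the others. *)
Lemma primorial_le n : (\prod_(p <- primes_upto n) p <= 4 ^ n)%N.
Proof.
elim/ltn_ind: n => n IH.
case: n IH => [|[|[|n]]] IH; try by rewrite /primes_upto /= ?big_cons ?big_nil.
case O : (odd n.+3); last first.
  rewrite primes_uptoS; have -> : prime n.+3 = false.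
    by apply/negP => pn; case: (even_prime pn) => //; rewrite O.
  rewrite cats0; apply: leq_trans (IH n.+2 _) _ => //.
  by rewrite leq_exp2l.
pose m := n./2.+1.
have Em : n.+3 = (m.*2).+1 by move: O; rewrite /m /=; lia.
have m0 : (0 < m)%N by [].
clearbody m; rewrite Em; rewrite {}Em in IH O.
have P : perm_eq (primes_upto (m.*2).+1) (primes_upto m.+1 ++
  [seq p <- primes_upto (m.*2).+1 | (m.+1 < p)%N]).
  rewrite perm_sym; apply: uniq_perm; rewrite ?primes_upto_uniq //.
    rewrite cat_uniq primes_upto_uniq (filter_uniq _ (primes_upto_uniq _)) andbT andTb.
    apply/hasPn => p; rewrite mem_filter => /andP[H _].
    by rewrite /= mem_primes_upto; apply/negP => /andP[_ ?]; lia.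
  move=> p; rewrite mem_cat [p \in filter _ (primes_upto _)]mem_filter !mem_primes_upto.
  case: (prime p); rewrite ?andbF //= -?mul2n; lia.
rewrite (perm_big _ P) big_cat /=.
have H1 : (\prod_(p <- primes_upto m.+1) p <= 4 ^ m.+1)%N by apply: IH; lia.
have H2 : (\prod_(p <- [seq p <- primes_upto (m.*2).+1 | (m.+1 < p)%N]) p <= 4 ^ m)%N.
  apply: leq_trans (bin_odd_le m); apply: dvdn_leq; first by rewrite bin_gt0; lia.
  apply: prod_primes_dvd; first by rewrite filter_uniq ?primes_upto_uniq.
  move=> p; rewrite mem_filter mem_primes_upto => /andP[lp /andP[pp up]]; rewrite pp /=.
  have : (p %| ((m.*2).+1)`!)%N by rewrite dvdn_fact // (prime_gt0 pp) up.
  rewrite -(@bin_fact _ m); last by lia.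
  have nf : forall k, (k < p)%N -> ~~ (p %| k`!)%N.
    move=> k; elim: k => [|k IHk] Hk; first by rewrite fact0 dvdn1; case: eqP pp => // ->.
    rewrite factS Euclid_dvdM // negb_or IHk 1?andbT; last by lia.
    by apply/negP => /dvdn_leq; lia.
  rewrite !Euclid_dvdM // => /orP[//|/orP[]] H; first last.
    by have := nf ((m.*2).+1 - m)%N ltac:(lia); rewrite H.
  by have := nf m ltac:(lia); rewrite H.
have -> : ((4 ^ (m.*2).+1) = 4 ^ m.+1 * 4 ^ m)%N by rewrite -expnD; congr (_ ^ _)%N; lia.
exact: leq_mul.
Qed.

Lemma ln_prodn (s : seq nat) : (forall p : nat, p \in s -> (0 < p)%N) ->
  ln (INR (\prod_(p <- s) p)) = \rsum_(p <- s) ln (INR p).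
Proof.
elim: s => [|a s IH] H; first by rewrite big_nil rsum_nil /= ln_1.
rewrite big_cons rsum_cons mulnE_INR -IH; last by move=> p Hp; apply: H; rewrite in_cons Hp orbT.
have Ha := H a (mem_head _ _).
have Hs : (0 < \prod_(p <- s) p)%N.
  rewrite big_seq; apply: prodn_cond_gt0 => p Hp; apply: H; by rewrite in_cons Hp orbT.
by apply: ln_mult; apply: Rlt_le_trans (ge1_INR _) => //; lra.
Qed.

Lemma INR_expn a n : INR (a ^ n)%N = INR a ^ n.
Proof. by elim: n => [|n IH]; rewrite ?expn0 // expnS mulnE_INR IH. Qed.

Lemma ln2_bounds : 1 / 2 < ln 2 < 3 / 4.
Proof.
split; first by have := ln_lt_2; lra.
have H : 2 < exp (3/4).
  have -> : 3/4 = (3/32 + 3/32 + (3/32 + 3/32)) + (3/32 + 3/32 + (3/32 + 3/32)) by lra.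
  rewrite !exp_plus; have := exp_ge1 (3/32); set e := exp _ => H.
  have H2 : 1.19 < e * e by nra.
  have H4 : 1.416 < e * e * (e * e) by nra.
  nra.
by rewrite -(ln_exp (3/4)); apply: ln_increasing; lra.
Qed.

Lemma INR_gt0 n : (0 < n)%N -> 0 < INR n.
Proof. by move/ge1_INR; lra. Qed.

Lemma theta_le n : \rsum_(p <- primes_upto n) ln (INR p) <= 1.5 * INR n.
Proof.
rewrite -ln_prodn; last by move=> p; rewrite mem_primes_upto => /andP[/prime_gt0].
have P0 : (0 < \prod_(p <- primes_upto n) p)%N.
  rewrite big_seq; apply: prodn_cond_gt0 => p; rewrite mem_primes_upto => /andP[/prime_gt0] //.
apply: Rle_trans (ln_le_mono (INR_gt0 P0) (leq_INR (primorial_le n))) _.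
rewrite INR_expn ln_pow; last by rewrite /=; lra.
have -> : INR 4 = 2 * 2 by rewrite /=; lra.
rewrite ln_mult; try lra.
have := ln2_bounds; have := pos_INR n; nra.
Qed.

Lemma ln_fact_ge n : (0 < n)%N -> INR n * ln (INR n) - INR n <= ln (INR (n`!)).
Proof.
elim: n => [//|[|n] IH] _; first by rewrite /= ln_1; lra.
have {}IH := IH isT.
rewrite factS mulnE_INR ln_mult; try by apply: INR_gt0; rewrite ?fact_gt0.
have n0 : 0 < INR n.+1 by apply: INR_gt0.
have := @ln_sub1 (INR n.+2 / INR n.+1).
have E : INR n.+2 = INR n.+1 + 1 by rewrite S_INR.
rewrite ln_div; try lra.
have -> : INR n.+2 / INR n.+1 - 1 = / INR n.+1 by rewrite E; field; lra.
move=> H.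
have : ln (INR n.+2) - ln (INR n.+1) <= / INR n.+1.
  by apply: H; apply: Rdiv_lt_0_compat; lra.
move=> /(Rmult_le_compat_l (INR n.+1)) -/(_ (Rlt_le _ _ n0)).
rewrite Rinv_r; last lra.
by rewrite E; nra.
Qed.

Lemma ln_fact_le n : ln (INR (n`!)) <= INR n * ln (INR n).
Proof.
case: n => [|n]; first by rewrite /= ln_1; lra.
elim: n => [|n IH]; first by rewrite /= ln_1; lra.
rewrite factS mulnE_INR ln_mult; try by apply: INR_gt0; rewrite ?fact_gt0.
have n0 : 0 < INR n.+1 by apply: INR_gt0.
have H : ln (INR n.+1) <= ln (INR n.+2) by apply: ln_le_mono => //; apply: leq_INR.
have := S_INR n.+1; nra.
Qed.

Lemma ln_fact_decomp n :
  ln (INR (n`!)) = \rsum_(p <- primes_upto n) (INR (logn p n`!) * ln (INR p)).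
Proof.
(* Stated for every [m] whose prime factors are at most [n], a class closed under division by the
   least prime factor. *)
have G m : (0 < m)%N -> (forall p, prime p -> p %| m -> p <= n)%N ->
   ln (INR m) = \rsum_(p <- primes_upto n) (INR (logn p m) * ln (INR p)).
  elim/ltn_ind: m => m IH m0 Hm.
  case: (ltnP 1 m) => m1; last first.
    have -> : m = 1%N by lia.
    rewrite /= ln_1 (rsum_eq (g := fun=> 0)) ?rsum0 // => p _.
    by rewrite logn1 /=; lra.
  have pq := pdiv_prime m1; have dq := pdiv_dvd m; set q := pdiv m in pq dq.
  have [k Ek] := dvdnP dq.
  have k0 : (0 < k)%N by case: k Ek => // E; rewrite E in m0.
  have q1 := prime_gt1 pq.
  have km : (k < m)%N by rewrite Ek; nia.
  rewrite Ek mulnE_INR ln_mult; try (apply: INR_gt0; lia).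
  rewrite (IH k) //; last by move=> p pp dp; apply: Hm => //; rewrite Ek dvdn_mulr.
  have -> : ln (INR q) = \rsum_(p <- primes_upto n) (if p == q then ln (INR p) else 0).
    rewrite -rsum_filter.
    have -> : [seq p <- primes_upto n | p == q] = [:: q].
      rewrite filter_pred1_uniq ?primes_upto_uniq // mem_primes_upto pq /=; exact: Hm.
    by rewrite rsum_cons rsum_nil Rplus_0_r.
  rewrite -rsum_add; apply: rsum_eq => p; rewrite mem_primes_upto => /andP[pp _].
  rewrite lognM //; last by lia.
  rewrite addnE_INR (logn_prime p pq) eq_sym.
  have K : forall (b : bool) a l, a * l + (if b then l else 0) = (a + INR b) * l.
    by move=> [] a l /=; ring.
  exact: K.
apply: G; first exact: fact_gt0.
move=> p pp; elim: n => [|n IH]; first by rewrite fact0 dvdn1 => /eqP E; rewrite E in pp.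
rewrite factS Euclid_dvdM // => /orP[/dvdn_leq|/IH]; lia.
Qed.

Definition mertens_sum n := \rsum_(p <- primes_upto n) (ln (INR p) / INR p).

Lemma divn_ge_real n p : (0 < p)%N -> INR n / INR p - 1 <= INR (n %/ p).
Proof.
move=> p0; have q0 := INR_gt0 p0.
have H : INR n <= INR p * (INR (n %/ p) + 1).
  rewrite -[1]/(INR 1) -addnE_INR -mulnE_INR; apply: leq_INR.
  by have := ltn_ceil n p0; rewrite addn1 mulnC; lia.
apply: (Rmult_le_reg_l (INR p)) => //.
have -> : INR p * (INR n / INR p - 1) = INR n - INR p by field; lra.
lra.
Qed.
Lemma divn_le_real n p : (0 < p)%N -> INR (n %/ p) <= INR n / INR p.
Proof.
move=> p0; have q0 := INR_gt0 p0.
have H : INR p * (INR (n %/ p)) <= INR n.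
  by rewrite -mulnE_INR; apply: leq_INR; rewrite mulnC leq_trunc_div.
apply: (Rmult_le_reg_l (INR p)) => //.
have -> : INR p * (INR n / INR p) = INR n by field; lra.
lra.
Qed.

(** Compare [ln (n!) <= n * ln n] with [logn p n! >= n / p - 1]. The rounding loses at most the sum
    of [ln p], which Chebyshev bounds by [1.5 * n]. *)
Lemma mertens_sum_le n : (0 < n)%N -> mertens_sum n <= ln (INR n) + 2.
Proof.
move=> n0; have N0 := INR_gt0 n0.
have H := ln_fact_le n; rewrite ln_fact_decomp in H.
have T := theta_le n.
have : INR n * mertens_sum n - \rsum_(p <- primes_upto n) ln (INR p) <= INR n * ln (INR n).
  apply: Rle_trans H; rewrite /mertens_sum -rsum_mull -rsum_sub.
  apply: rsum_le => p; rewrite mem_primes_upto => /andP[pp pn].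
  have p0 := prime_gt0 pp.
  have l0 : 0 <= ln (INR p) by apply: ln_ge0; apply: ge1_INR.
  have D : INR n / INR p - 1 <= INR (logn p n`!).
    apply: Rle_trans (divn_ge_real _ p0) _; apply: leq_INR.
    rewrite logn_fact // big_ltn 1?ltnS // expn1; exact: leq_addr.
  have P0 := INR_gt0 p0.
  have -> : INR n * (ln (INR p) / INR p) - ln (INR p) = (INR n / INR p - 1) * ln (INR p).
    by field; lra.
  exact: Rmult_le_compat_r.
nra.
Qed.

(** Legendre's formula without the floors is a geometric series of ratio [/ p]. *)
Lemma logn_fact_le n p : prime p -> INR (logn p n`!) <= INR n / (INR p - 1).
Proof.
move=> pp; have p1 := prime_gt1 pp; have P2 : 2 <= INR p by have := leq_INR p1; rewrite /=; lra.
rewrite logn_fact //.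
have G m : INR (\sum_(1 <= k < m.+1) n %/ p ^ k) <= INR n / (INR p - 1) * (1 - / INR p ^ m).
  elim: m => [|m IH].
    by rewrite big_geq //=; have := pos_INR n => ?; right; field; lra.
  rewrite big_nat_recr //= addnE_INR.
  have Pm : 0 < INR p ^ m by apply: pow_lt; lra.
  have E : INR (n %/ p ^ m.+1) <= INR n / INR p ^ m.+1.
    rewrite -INR_expn; apply: divn_le_real; rewrite expn_gt0; lia.
  apply: Rle_trans (Rplus_le_compat _ _ _ _ IH E) _; right.
  by rewrite -[INR p ^ m.+1]/(INR p * INR p ^ m); field; lra.
apply: Rle_trans (G n) _.
have Pm : 0 < / INR p ^ n by apply: Rinv_0_lt_compat; apply: pow_lt; lra.
have F : 0 <= INR n / (INR p - 1).
  by apply: Rle_mult_inv_pos; [apply: pos_INR | lra].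
nra.
Qed.

(** The contribution of higher prime powers to [ln (n!)]. The bound is chosen to telescope: its
    increment from [n] to [n + 1] is at least [ln (n + 1) / (n * (n + 1))], the term at [n + 1] if
    this is a prime. *)
Lemma sum_ln_conv n : (0 < n)%N ->
  \rsum_(p <- primes_upto n) (ln (INR p) / (INR p * (INR p - 1))) <= 2 - (ln (INR n) + 2) / INR n.
Proof.
elim: n => [//|[|n] IH] _; first by rewrite rsum_nil /= ln_1; lra.
rewrite rsum_primes_uptoS.
have {}IH := IH isT.
set x := INR n.+1 in IH.
have x1 : 1 <= x by apply: ge1_INR.
have E : INR n.+2 = x + 1 by rewrite S_INR.
have l0 : 0 <= ln (x + 1) by apply: ln_ge0; lra.
have K : (if prime n.+2 then ln (INR n.+2) / (INR n.+2 * (INR n.+2 - 1)) else 0)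
   <= ln (x + 1) / ((x + 1) * x).
  rewrite E; have -> : x + 1 - 1 = x by lra.
  case: (prime _); first lra.
  by apply: Rle_mult_inv_pos => //; nra.
move: K; set y := (if prime _ then _ else _) => K; rewrite E.
have H := @ln_sub1 ((x + 1) / x).
rewrite ln_div in H; try lra.
have H' : ln (x + 1) - ln x <= / x.
  have -> : / x = (x + 1) / x - 1 by field; lra.
  by apply: H; apply: Rdiv_lt_0_compat; lra.
have I : ln (x + 1) / ((x + 1) * x) <= (ln x + 2) / x - (ln (x + 1) + 2) / (x + 1).
  apply: (Rmult_le_reg_r ((x + 1) * x)); first nra.
  have -> : ln (x + 1) / ((x + 1) * x) * ((x + 1) * x) = ln (x + 1) by field; lra.
  have -> : ((ln x + 2) / x - (ln (x + 1) + 2) / (x + 1)) * ((x + 1) * x)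
    = (ln x + 2) * (x + 1) - (ln (x + 1) + 2) * x by field; lra.
  have H2 : (ln (x + 1) - ln x) * (x + 1) <= / x * (x + 1) by apply: Rmult_le_compat_r; lra.
  have H3 : / x * (x + 1) = 1 + / x by field; lra.
  have H4 : / x <= 1 by rewrite -Rinv_1; apply: Rinv_le_contravar; lra.
  nra.
lra.
Qed.

(** Here [ln (n!) >= n * ln n - n] meets [logn p n! <= n / (p - 1)], and
    [1 / (p - 1) = 1 / p + 1 / (p * (p - 1))], whose second part sums to at most 2 against
    [ln p]. *)
Lemma mertens_sum_ge n : (0 < n)%N -> ln (INR n) - 3 <= mertens_sum n.
Proof.
move=> n0; have N0 := INR_gt0 n0.
have H := ln_fact_ge n0; rewrite ln_fact_decomp in H.
have S := sum_ln_conv n0.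
have : \rsum_(p <- primes_upto n) (INR (logn p n`!) * ln (INR p)) <=
   INR n * (mertens_sum n + \rsum_(p <- primes_upto n) (ln (INR p) / (INR p * (INR p - 1)))).
  rewrite /mertens_sum -rsum_add -rsum_mull; apply: rsum_le => p; rewrite mem_primes_upto =>
    /andP[pp pn].
  have p1 := prime_gt1 pp; have P2 : 2 <= INR p by have := leq_INR p1; rewrite /=; lra.
  have l0 : 0 <= ln (INR p) by apply: ln_ge0; lra.
  apply: Rle_trans (Rmult_le_compat_r _ _ _ l0 (logn_fact_le n pp)) _.
  by right; field; lra.
move=> K.
have l0 : 0 <= ln (INR n) by apply: ln_ge0; apply: ge1_INR.
have Q : 0 <= (ln (INR n) + 2) / INR n by apply: Rle_mult_inv_pos => //; lra.
nra.
Qed.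

(** * Primes in real intervals and Mertens' second theorem *)

Lemma ceil_nat y : 0 < y -> exists n : nat, INR n < y /\ y <= INR n + 1.
Proof.
move=> y0.
have ex : exists n, dec (y <= INR n + 1).
  exists (Z.to_nat (up y)).
  apply/decP; rewrite INR_IZR_INZ Z2Nat.id; first by have := archimed y; lra.
  by apply: le_IZR; have := archimed y; lra.
case: (ex_minnP ex) => n /decP H Hm; exists n; split => //.
case: n H Hm => [|n] H Hm //; apply: Rnot_le_lt => K.
have := Hm n; have -> : dec (y <= INR n + 1) by apply/decP; rewrite -S_INR.
by move=> /(_ isT); rewrite ltnn.
Qed.

(** The interval is half-open, so that adjacent intervals concatenate without overlap. *)
Definition primes_in (x y : R) : seq nat :=
  [seq p <- iota 0 (Z.to_nat (up y)) | prime p && dec (x <= INR p /\ INR p < y)].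

Lemma lt_up_nat p y : INR p < y -> (p < Z.to_nat (up y))%N.
Proof.
move=> H; have [Hu _] := archimed y.
rewrite INR_IZR_INZ in H.
have : (Z.of_nat p < up y)%Z by apply: lt_IZR; lra.
lia.
Qed.

Lemma mem_primes_in x y p : (p \in primes_in x y) = prime p && dec (x <= INR p /\ INR p < y).
Proof.
rewrite mem_filter mem_iota add0n /=.
case: (prime p) => //=; case: decP => //= -[_ H].
exact: lt_up_nat.
Qed.
Lemma primes_inP x y p : reflect (prime p /\ x <= INR p /\ INR p < y) (p \in primes_in x y).
Proof.
rewrite mem_primes_in; apply: (iffP andP) => [[pp /decP]|[pp H]] //; split => //.
exact/decP.
Qed.
Lemma primes_in_sorted x y : sorted ltn (primes_in x y).
Proof. by apply: (sorted_filter ltn_trans); exact: iota_ltn_sorted. Qed.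
Lemma primes_in_uniq x y : uniq (primes_in x y).
Proof. by rewrite filter_uniq // iota_uniq. Qed.
Lemma primes_in_prime x y p : p \in primes_in x y -> prime p.
Proof. by case/primes_inP. Qed.
Lemma primes_in_gt0 x y p : p \in primes_in x y -> 0 < INR p.
Proof. by case/primes_inP => /prime_gt0 /INR_gt0. Qed.
Lemma primes_in_ge1 x y p : p \in primes_in x y -> 1 <= INR p.
Proof. by case/primes_inP => /prime_gt0 /ge1_INR. Qed.

Lemma sorted_ltn_eq (s t : seq nat) : sorted ltn s -> sorted ltn t -> s =i t -> s = t.
Proof. exact: (irr_sorted_eq ltn_trans ltnn). Qed.

Lemma sorted_ltn_cat (s t : seq nat) : sorted ltn s -> sorted ltn t ->
  (forall p q : nat, p \in s -> q \in t -> (p < q)%N) -> sorted ltn (s ++ t).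
Proof.
move=> ss st H; rewrite sorted_pairwise; last exact: ltn_trans.
rewrite pairwise_cat -!sorted_pairwise ?ss ?st ?andbT; try exact: ltn_trans.
by apply/allrelP => p q; apply: H.
Qed.

Lemma primes_in_cat x y z : x <= y -> y <= z -> primes_in x z = primes_in x y ++ primes_in y z.
Proof.
move=> xy yz; apply: sorted_ltn_eq; first exact: primes_in_sorted.
  apply: sorted_ltn_cat; try exact: primes_in_sorted.
  by move=> p q /primes_inP[_ [_ H1]] /primes_inP[_ [H2 _]]; apply: INR_ltn; lra.
move=> p; rewrite mem_cat !mem_primes_in; case: (prime p) => //=.
apply/idP/idP.
  move/decP => H; apply/orP; case: (Rlt_le_dec (INR p) y) => K; [left|right]; apply/decP; lra.
case/orP => /decP H; apply/decP; lra.
Qed.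

Lemma primes_in_cons p y : prime p -> INR p < y ->
  primes_in (INR p) y = p :: primes_in (INR p + 1) y.
Proof.
move=> pp py; apply: sorted_ltn_eq; first exact: primes_in_sorted.
  apply: (@sorted_ltn_cat [:: p]) => //; first exact: primes_in_sorted.
  by move=> a q; rewrite mem_seq1 => /eqP -> /primes_inP[_ [H2 _]]; apply: INR_ltn; lra.
move=> q; rewrite in_cons; apply/primes_inP/orP.
  move=> [pq [H1 H2]]; case: (eqVneq q p) => [|ne]; [by left | right; apply/primes_inP].
  split=> //; split=> //; rewrite -S_INR; apply: leq_INR; have := INR_leq H1; lia.
case=> [/eqP -> | /primes_inP[pq H]]; [split => //; lra | split => //; lra].
Qed.

Lemma primes_in_sum_sub x y x' y' f : x' <= x -> y <= y' ->
  (forall p : nat, p \in primes_in x' y' -> 0 <= f p) ->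
  \rsum_(p <- primes_in x y) f p <= \rsum_(p <- primes_in x' y') f p.
Proof.
move=> xx yy f0; apply: rsum_le_sub => //; first exact: primes_in_uniq.
by move=> p /primes_inP[pp H]; apply/primes_inP; split => //; lra.
Qed.

Lemma primes_in_primes_upto x y (m n : nat) f : INR m < x <= INR m + 1 -> INR n < y <= INR n + 1 ->
  \rsum_(p <- primes_in x y) f p = \rsum_(p <- [seq p <- primes_upto n | (m < p)%N]) f p.
Proof.
move=> Hm Hn; apply: rsum_perm; apply: uniq_perm; first exact: primes_in_uniq.
  by rewrite filter_uniq ?primes_upto_uniq.
move=> p; rewrite mem_primes_in mem_filter mem_primes_upto [RHS]andbCA; case: (prime p) => //=.
apply/decP/andP => [[H1 H2]|[H1 H2]].
  split; first by apply: INR_ltn; lra.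
  have : (p < n.+1)%N by apply: INR_ltn; rewrite S_INR; lra.
  lia.
have := leq_INR H1; have := leq_INR H2; rewrite S_INR; lra.
Qed.

Lemma primes_in0_primes_upto y n f : INR n < y <= INR n + 1 ->
  \rsum_(p <- primes_in 0 y) f p = \rsum_(p <- primes_upto n) f p.
Proof.
move=> Hn; apply: rsum_perm; apply: uniq_perm; [exact: primes_in_uniq|exact: primes_upto_uniq|].
move=> p; rewrite mem_primes_upto mem_primes_in; case: (prime p) => //=.
apply/decP/idP => [[H1 H2]|H2].
  have : (p < n.+1)%N by apply: INR_ltn; rewrite S_INR; lra.
  lia.
have := leq_INR H2; have := pos_INR p; lra.
Qed.

Lemma theta_primes_in y : 0 <= y -> \rsum_(p <- primes_in 0 y) ln (INR p) <= 1.5 * y.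
Proof.
case=> [y0|<-]; last first.
  rewrite (rsum_eq (g := fun=> 0)) ?rsum0; first lra.
  by move=> p /primes_inP[_ [H1 H2]]; lra.
have [n Hn] := ceil_nat y0; rewrite (primes_in0_primes_upto _ Hn).
have := theta_le n; lra.
Qed.

Lemma mertens1_le x y : 1 < y -> \rsum_(p <- primes_in x y) (ln (INR p) / INR p) <= ln y + 2.
Proof.
move=> y0; have [n Hn] : exists n, INR n < y /\ y <= INR n + 1 by apply: ceil_nat; lra.
have n0 : (0 < n)%N by case: n Hn => //= Hn; lra.
apply: (Rle_trans _ (\rsum_(p <- primes_in 0 y) (ln (INR p) / INR p))).
  apply: rsum_le_sub; first exact: primes_in_uniq.
    move=> p /primes_inP[pp H]; apply/primes_inP; split => //; have := pos_INR p; lra.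
  move=> p H; have := primes_in_gt0 H; have := ln_ge0 (primes_in_ge1 H) => ? ?.
  exact: Rle_mult_inv_pos.
rewrite (primes_in0_primes_upto _ Hn); apply: Rle_trans (mertens_sum_le n0) _.
by apply: Rplus_le_compat_r; apply: ln_le_mono; [apply: INR_gt0 | lra].
Qed.

Lemma mertens1_ge y : 2 <= y -> ln y - 4 <= \rsum_(p <- primes_in 0 y) (ln (INR p) / INR p).
Proof.
move=> y0; have [n Hn] : exists n, INR n < y /\ y <= INR n + 1 by apply: ceil_nat; lra.
have n0 : (0 < n)%N by case: n Hn => //= Hn; lra.
rewrite (primes_in0_primes_upto _ Hn); apply: Rle_trans (mertens_sum_ge n0).
have : ln (y / 2) <= ln (INR n) by apply: ln_le_mono; have := ge1_INR n0; lra.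
rewrite ln_div; have := ln2_bounds; lra.
Qed.

(** Mertens' first theorem with errors 4 and 2 leaves [7 - 4 - 2 = 1] for the sum of [ln p / p] over
    the interval, and each term is at most [ln x / (x / exp 7)]. *)
Lemma cheb_lower x : exp 8 <= x ->
  x / exp 7 / ln x <= INR (size (primes_in (x / exp 7) x)).
Proof.
move=> Hx.
have e7 : 1 + 7 <= exp 7 by exact: exp_ge1.
have x0 : 0 < x by have := exp_pos 8; lra.
have K2 : 2 <= x / exp 7.
  apply: Rle_trans (_ : exp 8 / exp 7 <= _).
    by rewrite /Rdiv -exp_Ropp -exp_plus; have := exp_ge1 (8 + - (7)); lra.
  apply: Rmult_le_compat_r => //; left; apply: Rinv_0_lt_compat; lra.
set z := x / exp 7 in K2 *.
have zx : z <= x.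
  by rewrite /z; apply: (Rmult_le_reg_r (exp 7)); [lra|]; rewrite /Rdiv Rmult_assoc Rinv_l; nra.
have lx : 8 <= ln x by apply: exp_le_ln.
have H1 := @mertens1_ge x ltac:(lra).
have H2 := @mertens1_le 0 z ltac:(lra).
rewrite (@primes_in_cat 0 z x) // ?rsum_cat in H1; last lra.
have lz : ln z = ln x - 7 by rewrite /z ln_div ?ln_exp //; lra.
have H3 : \rsum_(p <- primes_in z x) (ln (INR p) / INR p) <=
  INR (size (primes_in z x)) * (ln x / z).
  rewrite -rsum_const; apply: rsum_le => p /primes_inP[pp [P1 P2]].
  apply: Rmult_le_compat; [by apply: ln_ge0; lra | by left; apply: Rinv_0_lt_compat; lra | |].
    apply: ln_le_mono; lra.
  apply: Rinv_le_contravar; lra.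
have H4 : 1 <= INR (size (primes_in z x)) * (ln x / z) by lra.
apply: (Rmult_le_reg_r (ln x / z)); first by apply: Rdiv_lt_0_compat; lra.
have -> : z / ln x * (ln x / z) = 1 by field; lra.
lra.
Qed.

(** Each [/ p] is at most [ln p / (x * ln x)], and Chebyshev bounds the sum of [ln p] up to [4 * x]
    by [6 * x]. *)
Lemma short_primes_in x : 1 < x -> \rsum_(p <- primes_in x (4 * x)) (/ INR p) <= 6 / ln x.
Proof.
move=> x1; have l0 : 0 < ln x by rewrite -ln_1; apply: ln_increasing; lra.
have T := @theta_primes_in (4 * x) ltac:(lra).
have H : \rsum_(p <- primes_in x (4 * x)) (x * ln x * / INR p) <=
  \rsum_(p <- primes_in 0 (4 * x)) ln (INR p).
  apply: (Rle_trans _ (\rsum_(p <- primes_in x (4 * x)) ln (INR p))).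
    apply: rsum_le => p /primes_inP[pp [P1 P2]].
    have L : ln x <= ln (INR p) by apply: ln_le_mono; lra.
    apply: (Rmult_le_reg_r (INR p)); first lra.
    rewrite Rmult_assoc Rinv_l; nra.
  apply: primes_in_sum_sub; try lra.
  by move=> p /primes_in_ge1 /ln_ge0.
rewrite rsum_mull in H.
apply: (Rmult_le_reg_l (x * ln x)); first nra.
have -> : x * ln x * (6 / ln x) = 6 * x by field; lra.
lra.
Qed.

Definition mertens_err n := mertens_sum n - ln (INR n).
Lemma mertens_err_bd n : (0 < n)%N -> -3 <= mertens_err n <= 3.
Proof. by move=> n0; have := mertens_sum_le n0; have := mertens_sum_ge n0; rewrite /mertens_err;
  lra. Qed.

Lemma rsum_filtS m n f : (m <= n)%N ->
  \rsum_(p <- [seq p <- primes_upto n.+1 | (m < p)%N]) f p =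
  \rsum_(p <- [seq p <- primes_upto n | (m < p)%N]) f p + (if prime n.+1 then f n.+1 else 0).
Proof.
move=> mn; rewrite primes_uptoS filter_cat rsum_cat; case: (prime _) => /=.
  by rewrite ltnS mn rsum_cons rsum_nil Rplus_0_r.
by rewrite rsum_nil.
Qed.

(* Abel summation against the bounded error of Mertens' first theorem. *)
Lemma abel_mertens (g : nat -> R) m d : (0 < m)%N -> (forall k, (m <= k)%N -> 0 <= g k.+1 <= g k) ->
  Rabs (\rsum_(p <- [seq p <- primes_upto (m + d)%N | (m < p)%N]) (ln (INR p) / INR p * g p)
     - \rsum_(k <- iota m d) ((ln (INR k.+1) - ln (INR k)) * g k.+1)
     - mertens_err (m + d)%N * g (m + d)%N) <= 3 * (2 * g m - g (m + d)%N).
Proof.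
move=> m0 Hg; elim: d => [|d IH].
  rewrite addn0 /= rsum_nil (rsum_eq (g := fun=> 0)) ?rsum0; last first.
    by move=> p; rewrite mem_filter mem_primes_upto => /andP[H1 /andP[_ H2]]; lia.
  have := mertens_err_bd m0; have := Hg m (leqnn _) => ? ?.
  by rewrite /Rabs; case: Rcase_abs => ?; nra.
rewrite addnS rsum_filtS ?leq_addr // rsum_iotaS.
move: IH; set n := (m + d)%N; set S := bigop _ _ _; set T := bigop _ _ _ => IH.
have n0 : (0 < n)%N by rewrite /n; lia.
have Hgn := Hg n ltac:(rewrite /n; lia).
have E : mertens_err n.+1 * g n.+1 = mertens_err n * g n.+1 +
   (if prime n.+1 then ln (INR n.+1) / INR n.+1 * g n.+1 else 0)
   - (ln (INR n.+1) - ln (INR n)) * g n.+1.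
  by rewrite /mertens_err /mertens_sum rsum_primes_uptoS; case: (prime _); ring.
rewrite E; set a := (if _ then _ else _); set b := _ * g n.+1.
have B := mertens_err_bd n0.
move: IH; rewrite /Rabs; case: Rcase_abs => ? ?; case: Rcase_abs => ?; nra.
Qed.

(** The boundary term is at most [3 * g (m + d)], exactly what the bound in [abel_mertens] leaves
    room for. *)
Lemma abel_mertens_bd (g : nat -> R) m d : (0 < m)%N ->
  (forall k, (m <= k)%N -> 0 <= g k.+1 <= g k) ->
  Rabs (\rsum_(p <- [seq p <- primes_upto (m + d)%N | (m < p)%N]) (ln (INR p) / INR p * g p)
     - \rsum_(k <- iota m d) ((ln (INR k.+1) - ln (INR k)) * g k.+1)) <= 6 * g m.
Proof.
move=> m0 Hg; have H := abel_mertens d m0 Hg.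
have B := @mertens_err_bd (m + d)%N ltac:(lia).
have G0 : 0 <= g (m + d)%N.
  case: d H B => [|d] H B; first by have := Hg m (leqnn _); rewrite addn0; lra.
  by have := Hg (m + d)%N ltac:(lia); rewrite addnS; lra.
move: H; rewrite /Rabs; case: Rcase_abs => ? ?; case: Rcase_abs => ?; nra.
Qed.

Lemma ln_gt0 x : 1 < x -> 0 < ln x.
Proof. by move=> H; rewrite -ln_1; apply: ln_increasing; lra. Qed.

Lemma lnS_diff k : (0 < k)%N -> 0 <= ln (INR k.+1) - ln (INR k) <= / INR k.
Proof.
move=> k0; have K := INR_gt0 k0; have E := S_INR k.
have H := @ln_sub1 (INR k.+1 / INR k); rewrite ln_div in H; try lra.
split; first by have := @ln_le_mono (INR k) (INR k.+1) K; lra.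
apply: Rle_trans (H _) _; first by apply: Rdiv_lt_0_compat; lra.
by right; rewrite E; field; lra.
Qed.

(** The sum is a lower Riemann sum of the integral of [1 / t] over [t = ln k]. With [a = ln k] and
    [b = ln (k + 1)] the error of a step is at most [(b - a) ^ 2 / (a * b)]. As [b - a <= 1], it is
    at most [/ a - / b], which telescopes. *)
Lemma loglog_tele m d : (2 <= m)%N ->
  ln (ln (INR (m + d))) - ln (ln (INR m)) - (/ ln (INR m) - / ln (INR (m + d)))
  <= \rsum_(k <- iota m d) ((ln (INR k.+1) - ln (INR k)) * / ln (INR k.+1))
  <= ln (ln (INR (m + d))) - ln (ln (INR m)).
Proof.
move=> m2; elim: d => [|d IH]; first by rewrite addn0 rsum_nil; lra.
rewrite addnS rsum_iotaS.
move: IH; set n := (m + d)%N; set T := bigop _ _ _ => IH.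
have n2 : (2 <= n)%N by rewrite /n; lia.
have N2 : 2 <= INR n by have := leq_INR n2; rewrite /=; lra.
have [d0 d1] := @lnS_diff n ltac:(lia).
have La : 0 < ln (INR n) by apply: ln_gt0; lra.
set a := ln (INR n) in IH d0 d1 La *; set b := ln (INR n.+1) in d0 d1 *.
have H1 := @ln_sub1 (b / a); have H2 := @ln_gt1sub (b / a).
rewrite !ln_div in H1 H2; try lra.
have ba : 0 < b / a by apply: Rdiv_lt_0_compat; lra.
have {}H1 := H1 ba; have {}H2 := H2 ba.
have E1 : (b - a) * / b = 1 - / (b / a) by field; lra.
have E2 : b / a - 1 - (/ a - / b) <= (b - a) * / b.
  have -> : b / a - 1 - (/ a - / b) = (b - a) * / b - (1 - (b - a)) * (b - a) * / a * / b by field;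
    lra.
  have P : 0 <= (1 - (b - a)) * (b - a) * / a * / b.
    have Ia : 0 < / a by apply: Rinv_0_lt_compat.
    have Ib : 0 < / b by apply: Rinv_0_lt_compat; lra.
    have : / INR n <= 1 by rewrite -Rinv_1; apply: Rinv_le_contravar; lra.
    move=> ?; apply: Rmult_le_pos; last lra; apply: Rmult_le_pos; last lra.
    apply: Rmult_le_pos; lra.
  lra.
lra.
Qed.

Lemma ln2nat_gt m : (2 <= m)%N -> 1 / 2 < ln (INR m).
Proof.
move=> m2; have [H _] := ln2_bounds; apply: Rlt_le_trans H _.
by apply: ln_le_mono; [lra | have := leq_INR m2; rewrite /=; lra].
Qed.

Lemma inv_ln_dec m : (2 <= m)%N -> forall k, (m <= k)%N ->
  0 <= / ln (INR k.+1) <= / ln (INR k).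
Proof.
move=> m2 k mk; have H : 1 / 2 < ln (INR k) by apply: ln2nat_gt; lia.
have H' : ln (INR k) <= ln (INR k.+1).
  by apply: ln_le_mono; [apply: INR_gt0; lia | apply: leq_INR].
split; first by left; apply: Rinv_0_lt_compat; lra.
by apply: Rinv_le_contravar; lra.
Qed.

Lemma ceil_pair x y : 3 <= x -> x <= y -> exists m d : nat,
  [/\ (2 <= m)%N, INR m < x <= INR m + 1 & INR (m + d) < y <= INR (m + d) + 1].
Proof.
move=> x3 xy.
have [m Hm] : exists m, INR m < x /\ x <= INR m + 1 by apply: ceil_nat; lra.
have [n Hn] : exists n, INR n < y /\ y <= INR n + 1 by apply: ceil_nat; lra.
have mn : (m <= n)%N.
  have : (m < n.+1)%N by apply: INR_ltn; rewrite S_INR; lra.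
  lia.
exists m, (n - m)%N; rewrite subnKC //; split => //.
have : (3 <= m.+1)%N by apply: INR_leq; rewrite (S_INR m) /=; lra.
lia.
Qed.

Lemma lnln_pred x m : 3 <= x -> INR m < x <= INR m + 1 -> (2 <= m)%N ->
  ln (ln (INR m)) <= ln (ln x) <= ln (ln (INR m)) + 1.
Proof.
move=> x3 Hm m2.
have M2 : 2 <= INR m by have := leq_INR m2; rewrite /=; lra.
have La := ln2nat_gt m2.
have lx : ln (INR m) <= ln x by apply: ln_le_mono; lra.
split; first by apply: ln_le_mono; lra.
have H1 := @ln_sub1 (x / INR m); rewrite ln_div in H1; try lra.
have H2 := @ln_sub1 (ln x / ln (INR m)); rewrite ln_div in H2; try lra.
have {}H1 := H1 ltac:(apply: Rdiv_lt_0_compat; lra).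
have {}H2 := H2 ltac:(apply: Rdiv_lt_0_compat; lra).
have H3 : x / INR m <= 3 / 2.
  apply: (Rmult_le_reg_r (INR m)); first lra.
  by rewrite /Rdiv Rmult_assoc Rinv_l; lra.
have H4 : ln x / ln (INR m) <= 2.
  apply: (Rmult_le_reg_r (ln (INR m))); first lra.
  by rewrite {1}/Rdiv Rmult_assoc Rinv_l; lra.
lra.
Qed.

(** Abel summation with [g = / ln]. The 17 covers [6 / ln m <= 12] from the summation, [/ ln m <= 2]
    from the Riemann sum, and the rounding of [x] and [y] to integers. *)
Lemma mertens2 x y : 3 <= x -> x <= y ->
  ln (ln y) - ln (ln x) - 17 <= \rsum_(p <- primes_in x y) (/ INR p) <= ln (ln y) - ln (ln x) + 17.
Proof.
move=> x3 xy; have [m [d [m2 Hm Hn]]] := ceil_pair x3 xy.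
rewrite (primes_in_primes_upto _ Hm Hn).
have A := @abel_mertens_bd (fun k => / ln (INR k)) m d ltac:(lia) (inv_ln_dec m2).
have T := loglog_tele d m2.
have L1 := lnln_pred x3 Hm m2.
have L2 := @lnln_pred y (m + d)%N ltac:(lra) Hn ltac:(lia).
have I : / ln (INR m) <= 2.
  have -> : 2 = / (1 / 2) by field.
  by apply: Rinv_le_contravar; have := ln2nat_gt m2; lra.
have I' : 0 < / ln (INR (m + d)).
  by apply: Rinv_0_lt_compat; have := @ln2nat_gt (m + d)%N ltac:(lia); lra.
rewrite (rsum_eq (g := fun p => ln (INR p) / INR p * / ln (INR p))); last first.
  move=> p; rewrite mem_filter => /andP[H _].
  have := @ln2nat_gt p ltac:(lia); have := @INR_gt0 p ltac:(lia) => ? ?.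
  by field; split; lra.
move: A T; set S := bigop _ _ _; set T := bigop _ _ _.
rewrite /Rabs; case: Rcase_abs => ? ? ?; lra.
Qed.

Lemma inv_ln2_tele m d : (2 <= m)%N ->
  \rsum_(k <- iota m d) ((ln (INR k.+1) - ln (INR k)) * (/ ln (INR k.+1) * / ln (INR k.+1)))
  <= / ln (INR m) - / ln (INR (m + d)).
Proof.
move=> m2; elim: d => [|d IH]; first by rewrite addn0 rsum_nil; lra.
rewrite addnS rsum_iotaS.
move: IH; set n := (m + d)%N; set T := bigop _ _ _ => IH.
have n2 : (2 <= n)%N by rewrite /n; lia.
have [d0 _] := @lnS_diff n ltac:(lia).
have La := ln2nat_gt n2.
set a := ln (INR n) in IH d0 La *; set b := ln (INR n.+1) in d0 *.
have -> : (b - a) * (/ b * / b) = (/ a - / b) - (b - a) * (b - a) * (/ a * / b * / b) by field; lra.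
have P : 0 <= (b - a) * (b - a) * (/ a * / b * / b).
  have Ia : 0 < / a by apply: Rinv_0_lt_compat; lra.
  have Ib : 0 < / b by apply: Rinv_0_lt_compat; lra.
  by apply: Rmult_le_pos; [nra | left; do 2?apply: Rmult_lt_0_compat => //].
lra.
Qed.

(** Abel summation with [g = / ln ^ 2]: the error is at most [12 / ln m] and the main term at most
    [/ ln m], while [/ ln m <= 2 / ln x] because [x <= m + 1 <= m ^ 2]. *)
Lemma tail_primes_in x y : 3 <= x -> \rsum_(p <- primes_in x y) (/ (INR p * ln (INR p))) <=
  26 / ln x.
Proof.
move=> x3; have lx : 0 < ln x by apply: ln_gt0; lra.
have c0 : 0 < 26 / ln x by apply: Rdiv_lt_0_compat; lra.
case: (Rle_lt_dec x y) => xy; last first.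
  suff -> : primes_in x y = [::] by rewrite rsum_nil; lra.
  case E : (primes_in x y) => [//|p s]; have : p \in primes_in x y by rewrite E mem_head.
  by move=> /primes_inP[_ ?]; lra.
have [m [d [m2 Hm Hn]]] := ceil_pair x3 xy.
rewrite (primes_in_primes_upto _ Hm Hn).
have G k : (m <= k)%N -> 0 <= / ln (INR k.+1) * / ln (INR k.+1) <= / ln (INR k) * / ln (INR k).
  by move=> /(inv_ln_dec m2) H; nra.
have A := @abel_mertens_bd (fun k => / ln (INR k) * / ln (INR k)) m d ltac:(lia) G.
have T := inv_ln2_tele d m2.
have La := ln2nat_gt m2.
have I : / ln (INR m) <= 2.
  have -> : 2 = / (1 / 2) by field.
  by apply: Rinv_le_contravar; lra.
have I0 : 0 < / ln (INR m) by apply: Rinv_0_lt_compat; lra.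
have I' : 0 < / ln (INR (m + d)).
  by apply: Rinv_0_lt_compat; have := @ln2nat_gt (m + d)%N ltac:(lia); lra.
have I2 : / ln (INR m) <= 2 / ln x.
  have M2 : 2 <= INR m by have := leq_INR m2; rewrite /=; lra.
  have : ln x <= ln (INR m * INR m) by apply: ln_le_mono; nra.
  rewrite ln_mult; try lra; move=> H.
  apply: (Rmult_le_reg_r (ln (INR m) * ln x)); first nra.
  have -> : / ln (INR m) * (ln (INR m) * ln x) = ln x by field; lra.
  have -> : 2 / ln x * (ln (INR m) * ln x) = 2 * ln (INR m) by field; lra.
  lra.
rewrite (rsum_eq (g := fun p => ln (INR p) / INR p * (/ ln (INR p) * / ln (INR p)))); last first.
  move=> p; rewrite mem_filter => /andP[H _].
  have := @ln2nat_gt p ltac:(lia); have := @INR_gt0 p ltac:(lia) => ? ?.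
  by field; split; lra.
move: A T; set S := bigop _ _ _; set T := bigop _ _ _.
have -> : 26 / ln x = 13 * (2 / ln x) by field; lra.
have : / ln (INR m) * / ln (INR m) <= 2 * / ln (INR m) by apply: Rmult_le_compat_r; lra.
rewrite /Rabs; case: Rcase_abs => ? ? ? ?; lra.
Qed.

(** The inner sum is at most [6 / ln q], and the tail of the convergent sum of [1 / (q * ln q)] is
    [O(1 / ln x)]. For pairs of primes this is the source of the term [1 / ln D1] in (1). *)
Lemma close_pairs_primes_in x y : 3 <= x ->
  \rsum_(q <- primes_in x y) (/ INR q * \rsum_(p <- primes_in (INR q) (4 * INR q)) (/ INR p)) <=
    156 / ln x.
Proof.
move=> x3.
apply: (Rle_trans _ (\rsum_(q <- primes_in x y) (6 * (/ (INR q * ln (INR q)))))).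
  apply: rsum_le => q /primes_inP[pq [Hq _]].
  have lq : 0 < ln (INR q) by apply: ln_gt0; lra.
  apply: Rle_trans (Rmult_le_compat_l _ _ _ _ (@short_primes_in (INR q) ltac:(lra))) _.
    by left; apply: Rinv_0_lt_compat; lra.
  by right; field; lra.
rewrite rsum_mull; have := @tail_primes_in x y x3.
have -> : 156 / ln x = 6 * (26 / ln x) by field; apply: Rgt_not_eq; apply: ln_gt0; lra.
lra.
Qed.

Lemma inv_sq_primes_in x y : 3 < x -> \rsum_(p <- primes_in x y) (/ INR p * / INR p) <= 1 / 3.
Proof.
move=> x3; set n := Z.to_nat (up y).
apply: (Rle_trans _ (\rsum_(p <- iota 4 n) (/ INR p * / INR p))).
  apply: rsum_le_sub; first exact: primes_in_uniq.
    move=> p /primes_inP[_ [H1 /lt_up_nat H2]]; rewrite mem_iota.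
    have : (3 < p)%N by apply: INR_ltn; rewrite /=; lra.
    by rewrite -/n in H2; lia.
  by move=> j _; have := Rle_0_sqr (/ INR j); rewrite /Rsqr.
apply: (Rle_trans _ (1 / 3 - / INR (3 + n))); last first.
  by have := Rinv_0_lt_compat _ (@INR_gt0 (3 + n)%N isT); lra.
elim: n => [|n IH]; first by rewrite rsum_nil /=; lra.
rewrite rsum_iotaS.
have -> : (3 + n.+1 = 4 + n)%N by lia.
have E : INR (4 + n) = INR (3 + n) + 1 by rewrite -S_INR.
have a0 : 0 < INR (3 + n) by apply: INR_gt0.
apply: Rle_trans (Rplus_le_compat_r _ _ _ IH) _.
rewrite E; set a := INR (3 + n) in a0 *.
have -> : 1 / 3 - / a + / (a + 1) * / (a + 1) = 1 / 3 - / (a + 1) - / a * / (a + 1) * / (a +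
  1) by field; lra.
have : 0 < / a * / (a + 1) * / (a + 1).
  by do 2?apply: Rmult_lt_0_compat; apply: Rinv_0_lt_compat; lra.
lra.
Qed.

(** * Weighted sums over subsets of the primes *)

Definition ind (b : bool) : R := if b then 1 else 0.
Lemma ind_ge0 b : 0 <= ind b. Proof. by case: b => /=; lra. Qed.
Lemma ind_le1 b : ind b <= 1. Proof. by case: b => /=; lra. Qed.
Lemma ind_imp (b c : bool) : (b -> c) -> ind b <= ind c.
Proof. by case: b; case: c => //= H; try lra; have := H isT. Qed.
Lemma ind_and b c : ind (b && c) = ind b * ind c.
Proof. by case: b; case: c => /=; lra. Qed.

(* [wsum w l f] is the sum of [f S] over all subsequences [S] of [l], each weighted by the product
   of [w] over [S]. *)
Fixpoint wsum (w : nat -> R) (l : seq nat) (f : seq nat -> R) : R :=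
  if l is p :: l' then wsum w l' f + w p * wsum w l' (fun S => f (p :: S)) else f [::].

Lemma wsum_cons (w : nat -> R) p (l : seq nat) (f : seq nat -> R) :
  wsum w (p :: l) f = wsum w l f + w p * wsum w l (fun S => f (p :: S)).
Proof. by []. Qed.

Fixpoint subs (l : seq nat) : seq (seq nat) :=
  if l is p :: l' then subs l' ++ map (cons p) (subs l') else [:: [::]].

Fixpoint wt (w : nat -> R) (S : seq nat) : R :=
  if S is p :: S' then w p * wt w S' else 1.

Lemma wsum_subs (w : nat -> R) (l : seq nat) (f : seq nat -> R) : wsum w l f =
  \rsum_(S <- subs l) (wt w S * f S).
Proof.
elim: l f => [|p l IH] f /=; first by rewrite rsum_cons rsum_nil /=; lra.
rewrite rsum_cat rsum_map IH IH; congr (_ + _).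
by rewrite -rsum_mull; apply: rsum_eq => S _ /=; ring.
Qed.

Lemma mem_subs l S : (S \in subs l) = subseq S l.
Proof.
elim: l S => [|p l IH] S /=; first by rewrite mem_seq1; case: S.
rewrite mem_cat IH; case: S => [|q S].
  by rewrite sub0seq.
case: eqP => [->|ne].
  apply/orP/idP => [[H|/mapP[S' H [->]]]|H].
  - by apply: subseq_trans H; apply: subseq_cons.
  - by rewrite -IH.
  - by right; apply/mapP; exists S; rewrite ?IH.
apply/orP/idP => [[//|/mapP[S' _ [E _]]]|H]; first by rewrite E in ne.
by left.
Qed.

Lemma subs_uniq l : uniq l -> uniq (subs l).
Proof.
elim: l => [//|p l IH] /= /andP[np ul].
rewrite cat_uniq IH // map_inj_uniq ?IH ?andbT //; last by move=> a b [].
apply/hasPn => S /mapP[S' _ ->]; apply/negP; rewrite mem_subs => /mem_subseq H.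
by case/negP: np; apply: H; rewrite mem_head.
Qed.

Lemma wsum_eq (w : nat -> R) (l : seq nat) (f g : seq nat -> R) :
  (forall S : seq nat, subseq S l -> f S = g S) -> wsum w l f = wsum w l g.
Proof.
move=> H; rewrite !wsum_subs; apply: rsum_eq => S; rewrite mem_subs => /H -> //.
Qed.

Lemma wt_ge0 (w : nat -> R) (S : seq nat) : (forall p : nat, p \in S -> 0 <= w p) -> 0 <= wt w S.
Proof.
elim: S => [|p S IH] H /=; first lra.
apply: Rmult_le_pos; first by apply: H; rewrite mem_head.
by apply: IH => q Hq; apply: H; rewrite in_cons Hq orbT.
Qed.

Lemma wsum_le (w : nat -> R) (l : seq nat) (f g : seq nat -> R) : (forall p : nat, p \in l ->
  0 <= w p) ->
  (forall S : seq nat, subseq S l -> f S <= g S) -> wsum w l f <= wsum w l g.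
Proof.
move=> w0 H; rewrite !wsum_subs; apply: rsum_le => S; rewrite mem_subs => HS.
apply: Rmult_le_compat_l; last exact: H.
by apply: wt_ge0 => p /(mem_subseq HS) /w0.
Qed.

Lemma wsum_add (w : nat -> R) (l : seq nat) (f g : seq nat -> R) : wsum w l (fun S => f S + g S) =
  wsum w l f + wsum w l g.
Proof. by elim: l f g => [//|p l IH] f g /=; rewrite !IH; ring. Qed.

Lemma wsum_scal (w : nat -> R) (l : seq nat) c (f : seq nat -> R) : wsum w l (fun S => c * f S) =
  c * wsum w l f.
Proof. by elim: l f => [//|p l IH] f /=; rewrite !IH; ring. Qed.

Lemma wsum_scalr (w : nat -> R) (l : seq nat) c (f : seq nat -> R) : wsum w l (fun S => f S * c) =
  wsum w l f * c.
Proof. by elim: l f => [//|p l IH] f /=; rewrite !IH; ring. Qed.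

Lemma wsum_0 (w : nat -> R) (l : seq nat) : wsum w l (fun=> 0) = 0.
Proof. by elim: l => [//|p l IH] /=; rewrite !IH; ring. Qed.

Lemma wsum_ge0 (w : nat -> R) (l : seq nat) (f : seq nat -> R) : (forall p : nat, p \in l ->
  0 <= w p) ->
  (forall S : seq nat, subseq S l -> 0 <= f S) -> 0 <= wsum w l f.
Proof. by move=> w0 H; rewrite -(wsum_0 w l); apply: wsum_le. Qed.

Lemma wsum_cat (w : nat -> R) (l1 l2 : seq nat) (f : seq nat -> R) :
  wsum w (l1 ++ l2) f = wsum w l1 (fun S1 => wsum w l2 (fun S2 => f (S1 ++ S2))).
Proof. by elim: l1 f => [//|p l IH] f /=; rewrite !IH. Qed.

Lemma wsum_weight (w z : nat -> R) (l : seq nat) (f : seq nat -> R) : wsum w l (fun S =>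
  wt z S * f S) = wsum (fun p => w p * z p) l f.
Proof.
elim: l f => [|p l IH] f /=; first ring.
by rewrite IH -(IH (fun S => f (p :: S))) -!wsum_scal; congr (_ + _); apply: wsum_eq => S _; ring.
Qed.

Lemma wsum_split1 (w : nat -> R) (l : seq nat) (f : seq nat -> R) : (forall p : nat, p \in l ->
  0 <= w p) -> (forall S : seq nat, subseq S l -> 0 <= f S) ->
  f [::] <= wsum w l f.
Proof.
elim: l f => [|p l IH] f w0 f0 /=; first lra.
have H1 : f [::] <= wsum w l f.
  apply: IH => [q Hq|S HS]; first by apply: w0; rewrite in_cons Hq orbT.
  by apply: f0; apply: subseq_trans HS _; apply: subseq_cons.
have H2 : 0 <= w p * wsum w l (fun S => f (p :: S)).
  apply: Rmult_le_pos; first by apply: w0; rewrite mem_head.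
  apply: wsum_ge0 => [q Hq|S HS]; first by apply: w0; rewrite in_cons Hq orbT.
  by apply: f0; rewrite /= eqxx.
lra.
Qed.

(** The product of the [1 + w p]. For nonnegative [w], [wsum w l f / wmass w l] is the expectation
    of [f] when each [p] is chosen independently with odds [w p]. *)
Definition wmass (w : nat -> R) (l : seq nat) := wsum w l (fun=> 1).
Lemma wmass_cons (w : nat -> R) p (l : seq nat) : wmass w (p :: l) = (1 + w p) * wmass w l.
Proof. by rewrite /wmass /=; ring. Qed.
Lemma wmass_cat (w : nat -> R) (l1 l2 : seq nat) : wmass w (l1 ++ l2) = wmass w l1 * wmass w l2.
Proof.
rewrite /wmass wsum_cat -wsum_scalr; apply: wsum_eq => S _; ring.
Qed.
Lemma wmass_ge1 (w : nat -> R) (l : seq nat) : (forall p : nat, p \in l -> 0 <= w p) ->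
  1 <= wmass w l.
Proof. by move=> w0; apply: (wsum_split1 (f := fun=> 1)) => // S _; lra. Qed.
Lemma wmass_le (w : nat -> R) (l : seq nat) : (forall p : nat, p \in l -> 0 <= w p) ->
  wmass w l <= exp (\rsum_(p <- l) w p).
Proof.
elim: l => [|p l IH] w0; first by rewrite rsum_nil exp_0 /wmass /=; lra.
rewrite wmass_cons rsum_cons exp_plus.
have wp : 0 <= w p by apply: w0; rewrite mem_head.
have wl q : q \in l -> 0 <= w q by move=> Hq; apply: w0; rewrite in_cons Hq orbT.
apply: Rmult_le_compat; [lra | by have := wmass_ge1 wl; lra | exact: exp_ge1 | exact: IH].
Qed.
(** Each factor satisfies [ln (1 + t) >= t / (1 + t) >= t - t ^ 2]. *)
Lemma wmass_ge (w : nat -> R) (l : seq nat) : (forall p : nat, p \in l -> 0 <= w p) ->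
  exp (\rsum_(p <- l) w p - \rsum_(p <- l) (w p * w p)) <= wmass w l.
Proof.
elim: l => [|p l IH] w0; first by rewrite !rsum_nil Rminus_0_r exp_0 /wmass /=; lra.
rewrite wmass_cons !rsum_cons.
have wp : 0 <= w p by apply: w0; rewrite mem_head.
have wl q : q \in l -> 0 <= w q by move=> Hq; apply: w0; rewrite in_cons Hq orbT.
set a := bigop _ _ _ in IH *; set b := bigop _ _ _ in IH *.
have -> : w p + a - (w p * w p + b) = (w p - w p * w p) + (a - b) by ring.
rewrite exp_plus; apply: Rmult_le_compat;
  [left; exact: exp_pos | left; exact: exp_pos | | exact: IH].
rewrite -[X in _ <= X]exp_ln; last lra.
apply: exp_le; apply: Rle_trans (@ln_gt1sub (1 + w p) ltac:(lra)).
apply: (Rmult_le_reg_r (1 + w p)); first lra.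
have -> : (1 - / (1 + w p)) * (1 + w p) = w p by field; lra.
nra.
Qed.

(** * Terms [x ^ k / k!] of the exponential series and elementary symmetric sums *)

Fixpoint exp_term (x : R) (k : nat) : R := if k is k'.+1 then x / INR k * exp_term x k' else 1.

Lemma exp_term_rec x k : exp_term x k.+1 = x / INR k.+1 * exp_term x k.
Proof. by []. Qed.
Lemma exp_termE x k : exp_term x k = x ^ k / INR (k`!).
Proof.
elim: k => [|k IH]; first by rewrite /=; field.
rewrite exp_term_rec IH factS mulnE_INR -[x ^ k.+1]/(x * x ^ k).
by field; split; apply: Rgt_not_eq; apply: INR_gt0 => //; rewrite fact_gt0.
Qed.
Lemma exp_term_ge0 x k : 0 <= x -> 0 <= exp_term x k.
Proof.
move=> x0; elim: k => [|k IH]; first by rewrite /=; lra.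
by apply: Rmult_le_pos => //; apply: Rle_mult_inv_pos => //; apply: INR_gt0.
Qed.
Lemma exp_term_gt0 x k : 0 < x -> 0 < exp_term x k.
Proof.
move=> x0; elim: k => [|k IH]; first by rewrite /=; lra.
by apply: Rmult_lt_0_compat => //; apply: Rdiv_lt_0_compat => //; apply: INR_gt0.
Qed.
Lemma exp_termS x k : INR k.+1 * exp_term x k.+1 = x * exp_term x k.
Proof.
rewrite exp_term_rec; field.
by apply: Rgt_not_eq; apply: INR_gt0.
Qed.
Lemma exp_term_mono x y k : 0 <= x <= y -> exp_term x k <= exp_term y k.
Proof.
move=> xy; elim: k => [|k IH]; first by rewrite /=; lra.
apply: Rmult_le_compat => //; [|by apply: exp_term_ge0; lra|].
  by apply: Rle_mult_inv_pos; [lra | apply: INR_gt0].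
apply: Rmult_le_compat_r; last lra.
by left; apply: Rinv_0_lt_compat; apply: INR_gt0.
Qed.

(** These are the first two terms of the binomial expansion. The recursion [exp_termS] gives them by
    induction. *)
Lemma exp_term_add1 x y k : 0 <= x -> 0 <= y -> exp_term x k.+1 + y * exp_term x k <=
  exp_term (x + y) k.+1.
Proof.
move=> x0 y0; elim: k => [|k IH]; first by rewrite /=; lra.
have n0 : 0 < INR k.+2 by apply: INR_gt0.
apply: (Rmult_le_reg_l (INR k.+2)) => //.
rewrite exp_termS Rmult_plus_distr_l exp_termS.
have H1 := exp_termS x k; have E : INR k.+2 = INR k.+1 + 1 by rewrite S_INR.
have Hx := exp_term_ge0 k x0; have Hx1 := exp_term_ge0 k.+1 x0.
rewrite E; have : 0 <= y * y * exp_term x k by apply: Rmult_le_pos => //; nra.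
have : (x + y) * (exp_term x k.+1 + y * exp_term x k) <= (x + y) * exp_term (x + y) k.+1.
  by apply: Rmult_le_compat_l; lra.
nra.
Qed.

(** Taylor's formula of order two: [exp_term _ k.+1] has derivative [exp_term _ k], and the
    remainder is evaluated at the right end. *)
Lemma exp_term_taylor2 x y k : 0 <= x -> 0 <= y ->
  exp_term (x + y) k.+2 <= exp_term x k.+2 + y * exp_term x k.+1 + y * y / 2 * exp_term (x + y) k.
Proof.
move=> x0 y0; elim: k => [|k IH]; first by rewrite /=; right; field.
have n0 : 0 < INR k.+3 by apply: INR_gt0.
apply: (Rmult_le_reg_l (INR k.+3)) => //.
rewrite !Rmult_plus_distr_l !exp_termS.
have H1 := exp_termS x k.+1; have H2 := exp_termS (x + y) k.
have E : INR k.+3 = INR k.+1 + 2 by rewrite !S_INR; lra.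
have E2 : INR k.+2 = INR k.+1 + 1 by rewrite S_INR.
have H : (x + y) * exp_term (x + y) k.+2 <=
   (x + y) * (exp_term x k.+2 + y * exp_term x k.+1 + y * y / 2 * exp_term (x + y) k).
  by apply: Rmult_le_compat_l; lra.
apply: Rle_trans H _.
have M : y * y * exp_term x k.+1 <= y * y * exp_term (x + y) k.+1.
  by apply: Rmult_le_compat_l; [nra | apply: exp_term_mono; lra].
have A1 : (x + y) * (y * y / 2 * exp_term (x + y) k) =
  y * y / 2 * (INR k.+1 * exp_term (x + y) k.+1).
  by rewrite H2; ring.
rewrite Rmult_plus_distr_l A1 E.
have A2 : x * (y * exp_term x k.+1) = y * (INR k.+2 * exp_term x k.+2) by rewrite H1; ring.
rewrite E2 in A2; nra.
Qed.

Definition elem_sym (w : nat -> R) (l : seq nat) (k : nat) := wsum w l (fun S => ind (size S == k)).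

Lemma elem_sym_consS (w : nat -> R) p (l : seq nat) k : elem_sym w (p :: l) k.+1 =
  elem_sym w l k.+1 + w p * elem_sym w l k.
Proof. by rewrite /elem_sym /=; congr (_ + _ * _). Qed.
Lemma elem_sym_0 (w : nat -> R) (l : seq nat) : elem_sym w l 0%N = 1.
Proof.
elim: l => [//|p l IH]; rewrite /elem_sym /= -/(elem_sym w l 0%N) IH.
by rewrite wsum_0; ring.
Qed.
Lemma elem_sym_nilS w k : elem_sym w [::] k.+1 = 0. Proof. by []. Qed.
Lemma elem_sym_ge0 (w : nat -> R) (l : seq nat) k : (forall p : nat, p \in l -> 0 <= w p) ->
  0 <= elem_sym w l k.
Proof. by move=> w0; apply: wsum_ge0 => // S _; apply: ind_ge0. Qed.

Lemma cons_w0 (w : nat -> R) p l : (forall q : nat, q \in p :: l -> 0 <= w q) ->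
  0 <= w p /\ (forall q : nat, q \in l -> 0 <= w q).
Proof.
move=> w0; split; first by apply: w0; rewrite mem_head.
by move=> q Hq; apply: w0; rewrite in_cons Hq orbT.
Qed.

Lemma elem_sym_le (w : nat -> R) (l : seq nat) k : (forall p : nat, p \in l -> 0 <= w p) ->
  elem_sym w l k <= exp_term (\rsum_(p <- l) w p) k.
Proof.
elim: l k => [|p l IH] [|k] w0; rewrite ?elem_sym_0 ?elem_sym_nilS; try by rewrite /=; lra.
  by apply: exp_term_ge0; rewrite rsum_nil; lra.
have [wp wl] := cons_w0 w0.
rewrite elem_sym_consS rsum_cons Rplus_comm [w p + _]Rplus_comm.
have H1 := IH k.+1 wl; have H2 := Rmult_le_compat_l _ _ _ wp (IH k wl).
have P0 : 0 <= \rsum_(p <- l) w p := rsum_ge0 wl.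
have := exp_term_add1 k P0 wp.
lra.
Qed.

(** What [P ^ (k + 1) / (k + 1)!] counts beyond the symmetric sum are tuples with a repeated
    element; choosing two equal positions gives the correction. For [k = 0] there are no two
    positions. *)
Lemma elem_sym_ge (w : nat -> R) (l : seq nat) k : (forall p : nat, p \in l -> 0 <= w p) ->
  exp_term (\rsum_(p <- l) w p) k.+1
   - (\rsum_(p <- l) (w p * w p)) / 2 * (if k is k'.+1 then exp_term (\rsum_(p <- l) w p) k' else 0)
  <= elem_sym w l k.+1.
Proof.
elim: l k => [|p l IH] k w0.
  rewrite !rsum_nil elem_sym_nilS exp_term_rec.
  have -> : 0 / INR k.+1 = 0 by rewrite /Rdiv; ring.
  by case: k => [|k]; lra.
have [wp wl] := cons_w0 w0.
rewrite elem_sym_consS !rsum_cons.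
have P0 : 0 <= \rsum_(p <- l) w p := rsum_ge0 wl.
have Q0 : 0 <= \rsum_(p <- l) (w p * w p).
  by apply: rsum_ge0 => q Hq; have := wl q Hq; nra.
have IH1 := IH k wl.
move: P0 Q0 IH1; set P := bigop _ _ _; set Q := bigop _ _ _ => P0 Q0 IH1.
rewrite [w p + P]Rplus_comm.
case: k IH1 => [|k] IH1.
  rewrite elem_sym_0; move: IH1 => /=; lra.
have IH2 := Rmult_le_compat_l _ _ _ wp (IH k wl); rewrite -/P -/Q in IH2.
have T := exp_term_taylor2 k P0 wp.
suff : Q / 2 * (exp_term P k + w p * (if k is k'.+1 then exp_term P k' else 0)) <=
  Q / 2 * exp_term (P + w p) k.
  move=> H; nra.
apply: Rmult_le_compat_l; first lra.
case: k {IH1 IH2 T} => [|k]; first by rewrite /=; lra.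
exact: exp_term_add1.
Qed.

(** Marking an element [p] of [S] leaves [k] elements other than [p]; forgetting that they avoid [p]
    only increases the sum. This is the union bound over single primes. *)
Lemma wsum_marked (w : nat -> R) (l : seq nat) (g : nat -> R) k : (forall p : nat, p \in l ->
  0 <= w p) -> (forall p : nat, p \in l -> 0 <= g p) ->
  wsum w l (fun S => ind (size S == k.+1) * \rsum_(p <- S) g p)
  <= (\rsum_(p <- l) (w p * g p)) * elem_sym w l k.
Proof.
elim: l k => [|p l IH] k w0 g0; first by rewrite /= !rsum_nil; lra.
have [wp wl] := cons_w0 w0; have [gp gl] := cons_w0 g0.
rewrite rsum_cons /=.
have T0 : 0 <= \rsum_(q <- l) (w q * g q).
  by apply: rsum_ge0 => q Hq; apply: Rmult_le_pos; auto.
have E : wsum w l (fun S => ind ((size S).+1 == k.+1) * \rsum_(q <- p :: S) g q) =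
   g p * elem_sym w l k + wsum w l (fun S => ind (size S == k) * \rsum_(q <- S) g q).
  by rewrite -wsum_scal -wsum_add; apply: wsum_eq => S _; rewrite rsum_cons eqSS; ring.
rewrite E; have IH1 := IH k wl gl.
have wg : 0 <= w p * g p by nra.
case: k E IH1 => [|k] E IH1.
  have -> : wsum w l (fun S => ind (size S == 0%N) * \rsum_(q <- S) g q) = 0.
    rewrite -[RHS](wsum_0 w l); apply: wsum_eq => -[|q S] _ /=; rewrite ?rsum_nil; lra.
  by move: IH1; rewrite !elem_sym_0; lra.
have IH2 := Rmult_le_compat_l _ _ _ wp (IH k wl gl).
rewrite elem_sym_consS; have e0 := elem_sym_ge0 k wl.
have : 0 <= w p * g p * (w p * elem_sym w l k) by apply: Rmult_le_pos => //; nra.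
nra.
Qed.

Fixpoint pairsum (g : nat -> nat -> R) (S : seq nat) : R :=
  if S is p :: S' then pairsum g S' + \rsum_(q <- S') g p q else 0.

(** The same with two marked elements: the union bound over pairs. *)
Lemma wsum_marked2 (w : nat -> R) (l : seq nat) (g : nat -> nat -> R) k :
  (forall p : nat, p \in l -> 0 <= w p) ->
  (forall p q : nat, p \in l -> q \in l -> 0 <= g p q) ->
  wsum w l (fun S => ind (size S == k.+2) * pairsum g S)
  <= pairsum (fun p q => w p * (w q * g p q)) l * elem_sym w l k.
Proof.
elim: l k => [|p l IH] k w0 g0; first by rewrite /=; lra.
have [wp wl] := cons_w0 w0.
have gl : forall p q : nat, p \in l -> q \in l -> 0 <= g p q.
  by move=> a b Ha Hb; apply: g0; rewrite in_cons ?Ha ?Hb orbT.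
have gp : forall q : nat, q \in l -> 0 <= g p q.
  by move=> b Hb; apply: g0; rewrite in_cons ?eqxx ?Hb ?orbT.
have E : wsum w l (fun S => ind (size (p :: S) == k.+2) * pairsum g (p :: S)) =
   wsum w l (fun S => ind (size S == k.+1) * \rsum_(q <- S) g p q)
   + wsum w l (fun S => ind (size S == k.+1) * pairsum g S).
  by rewrite -wsum_add; apply: wsum_eq => S _ /=; rewrite eqSS; ring.
rewrite wsum_cons E [pairsum _ _]/= rsum_mull.
have IH1 := IH k wl gl.
have M := Rmult_le_compat_l _ _ _ wp (wsum_marked k wl gp).
have T1 : 0 <= \rsum_(q <- l) (w q * g p q).
  by apply: rsum_ge0 => q Hq; apply: Rmult_le_pos; auto.
case: k E IH1 M => [|k] E IH1 M.
  have -> : wsum w l (fun S => ind (size S == 1%N) * pairsum g S) = 0.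
    rewrite -[RHS](wsum_0 w l); apply: wsum_eq => -[|q [|a S]] _ /=; rewrite ?rsum_nil; lra.
  by move: IH1 M; rewrite !elem_sym_0; lra.
have IH2 := Rmult_le_compat_l _ _ _ wp (IH k wl gl).
rewrite elem_sym_consS; have e0 := elem_sym_ge0 k wl.
set T := \rsum_(q <- l) (w q * g p q) in M T1 *.
have : 0 <= w p * T * (w p * elem_sym w l k) by apply: Rmult_le_pos; nra.
nra.
Qed.

Lemma wt_ifcount (a : pred nat) z S : wt (fun p => if a p then z else 1) S = z ^ (count a S).
Proof.
elim: S => [//|p S IH] /=; rewrite IH; case: (a p) => /=; last by rewrite add0n; ring.
by rewrite add0n.
Qed.

(** The exponential moment behind the Chernoff bounds: a factor [z] for each element satisfying [a]
    amounts to multiplying the weights of these elements by [z]. *)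
Lemma wsum_pow_size (w : nat -> R) (l : seq nat) (a : pred nat) z (k : nat) :
  (forall p : nat, p \in l -> 0 <= w p) -> 0 <= z ->
  wsum w l (fun S => ind (size S == k) * z ^ (count a S)) <=
  exp_term (\rsum_(p <- l) w p + (z - 1) * \rsum_(p <- filter a l) w p) k.
Proof.
move=> w0 z0.
rewrite (@wsum_eq _ _ _ (fun S => wt (fun p => if a p then z else 1) S * ind (size S == k)));
  last first.
  by move=> S _; rewrite wt_ifcount; ring.
rewrite wsum_weight -/(elem_sym _ l k).
have H : forall p : nat, p \in l -> 0 <= w p * (if a p then z else 1).
  by move=> p /w0 ?; case: (a p); nra.
apply: Rle_trans (elem_sym_le k H) _; right; congr (exp_term _ _).
rewrite rsum_filter -rsum_mull -rsum_add; apply: rsum_eq => p _; case: (a p); ring.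
Qed.

Lemma wsum_pow (w : nat -> R) (l : seq nat) (a : pred nat) z : (forall p : nat, p \in l ->
  0 <= w p) -> 0 <= z ->
  wsum w l (fun S => z ^ (count a S)) <=
  exp (\rsum_(p <- l) w p + (z - 1) * \rsum_(p <- filter a l) w p).
Proof.
move=> w0 z0.
rewrite (@wsum_eq _ _ _ (fun S => wt (fun p => if a p then z else 1) S * 1)); last first.
  by move=> S _; rewrite wt_ifcount; ring.
rewrite wsum_weight -/(wmass _ l).
have H : forall p : nat, p \in l -> 0 <= w p * (if a p then z else 1).
  by move=> p /w0 ?; case: (a p); nra.
apply: Rle_trans (wmass_le H) _; right; congr exp.
rewrite rsum_filter -rsum_mull -rsum_add; apply: rsum_eq => p _; case: (a p); ring.
Qed.

(** * Subsequences split at a marked element *)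

Fixpoint splits (l : seq nat) : seq (seq nat * nat * seq nat) :=
  if l is p :: l' then ([::], p, l') :: map (fun t =>
    (p :: t.1.1, t.1.2, t.2)) (splits l') else [::].

Lemma splits_cat l t : t \in splits l -> l = t.1.1 ++ t.1.2 :: t.2.
Proof.
elim: l t => [//|p l IH] t; rewrite [splits _]/= in_cons => /orP[/eqP -> //|].
by case/mapP => t' /IH -> ->.
Qed.

Lemma splits_mid l : map (fun t => t.1.2) (splits l) = l.
Proof. by elim: l => [//|p l IH] /=; rewrite -map_comp -[in RHS]IH; congr (_ :: _). Qed.

(** The element [p] is chosen before the rest of the subsequence; the parts before and after [p]
    then range independently over the two sides of [l]. *)
Lemma wsum_splits w l (A : seq nat -> nat -> seq nat -> R) :
  wsum w l (fun S => \rsum_(t <- splits S) A t.1.1 t.1.2 t.2) =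
  \rsum_(t <- splits l) (w t.1.2 * wsum w t.1.1 (fun S1 => wsum w t.2 (A S1 t.1.2))).
Proof.
elim: l A => [|p l IH] A; first by rewrite /= !rsum_nil.
rewrite wsum_cons [splits (p :: l)]/= rsum_cons rsum_map IH.
have -> : wsum w l (fun S => \rsum_(t <- splits (p :: S)) A t.1.1 t.1.2 t.2) =
   wsum w l (A [::] p) + \rsum_(t <- splits l) (w t.1.2 * wsum w t.1.1 (fun S1 =>
     wsum w t.2 (A (p :: S1) t.1.2))).
  rewrite -(IH (fun S1 => A (p :: S1))) -wsum_add; apply: wsum_eq => S _ /=.
  by rewrite rsum_cons rsum_map.
rewrite Rmult_plus_distr_l -rsum_mull.
set X := bigop _ _ _; set Y := bigop _ _ _.
have -> : X + (w p * wsum w l (A [::] p) + Y) = w p * wsum w l (A [::] p) + (X + Y) by ring.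
congr (_ + _); rewrite -rsum_add; apply: rsum_eq => t _ /=; ring.
Qed.

(** * Squarefree numbers and their sets of primes *)

Notation recip := (fun p : nat => / INR p).

Lemma inv_ge0 x y (p : nat) : p \in primes_in x y -> 0 <= / INR p.
Proof. by move=> /primes_in_gt0 H; left; apply: Rinv_0_lt_compat. Qed.

Lemma primes_gt0 n p : p \in primes n -> (0 < p)%N.
Proof. by rewrite mem_primes => /andP[/prime_gt0]. Qed.

Lemma sqfree_prod n : (0 < n)%N -> squarefree n -> n = \prod_(p <- primes n) p.
Proof.
move=> n0 sf; rewrite {1}(prod_prime_decomp n0) prime_decompE big_map /=.
apply: eq_big_seq => p Hp /=.
have : (p \in primes n) by [].
rewrite mem_primes => /and3P[pp _ dp].
have H1 : (0 < logn p n)%N by rewrite logn_gt0.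
have H2 : ~~ (1 < logn p n)%N by rewrite -pfactor_dvdn // expnS expn1; apply/negP/sf.
by have -> : logn p n = 1%N by lia.
Qed.

Lemma wt_inv_prod (S : seq nat) : (forall p : nat, p \in S -> (0 < p)%N) ->
  wt recip S = / INR (\prod_(p <- S) p).
Proof.
elim: S => [|p S IH] H; first by rewrite big_nil /= Rinv_1.
rewrite big_cons mulnE_INR /= IH ?Rinv_mult //.
by move=> q Hq; apply: H; rewrite in_cons Hq orbT.
Qed.

Lemma prod_gt0 (S : seq nat) : (forall p : nat, p \in S -> (0 < p)%N) -> (0 < \prod_(p <- S) p)%N.
Proof. by move=> H; rewrite big_seq; apply: prodn_cond_gt0 => p Hp; apply: H. Qed.

Lemma subseq_filter_eq (S L : seq nat) : sorted ltn S -> sorted ltn L -> {subset S <= L} ->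
  subseq S L.
Proof.
move=> sS sL SL; have -> : S = filter (mem S) L; last exact: filter_subseq.
apply: sorted_ltn_eq => //; first exact: (sorted_filter ltn_trans).
by move=> p; rewrite mem_filter; apply/idP/andP => [H|[]] //; split => //; apply: SL.
Qed.

Lemma in_S_subseq r N D n : in_S r N D n -> subseq (primes n) (primes_in D N).
Proof.
move=> [n0 [nN [sf [sz HD]]]]; apply: subseq_filter_eq;
  [exact: sorted_primes | exact: primes_in_sorted |].
move=> p Hp; apply/primes_inP; have := Hp; rewrite mem_primes => /and3P[pp _ dp].
split => //; split; first exact: HD.
by apply: Rle_lt_trans nN; apply: leq_INR; apply: dvdn_leq.
Qed.

Lemma primes_prod (S : seq nat) : sorted ltn S -> (forall p : nat, p \in S -> prime p) ->
  primes (\prod_(p <- S) p) = S.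
Proof.
move=> sS pS; apply: sorted_ltn_eq => //; first exact: sorted_primes.
move=> q; have S0 : (0 < \prod_(p <- S) p)%N by apply: prod_gt0 => p /pS /prime_gt0.
rewrite mem_primes S0 /=; apply/andP/idP => [[pq]|Hq].
  rewrite Euclid_dvd_prod // big_has => /hasP[p Hp].
  by rewrite dvdn_prime2 // ?pS // => /eqP ->.
by split; [exact: pS | rewrite (perm_big _ (perm_to_rem Hq)) big_cons dvdn_mulr].
Qed.

Lemma sqfree_prod_primes (S : seq nat) : uniq S -> (forall p : nat, p \in S -> prime p) ->
  squarefree (\prod_(p <- S) p).
Proof.
move=> uS pS p pp; apply/negP.
case Hp : (p \in S).
  rewrite (perm_big _ (perm_to_rem Hp)) big_cons /= dvdn_pmul2l ?prime_gt0 //.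
  rewrite Euclid_dvd_prod // big_has; apply/negP => /hasP[q Hq].
  rewrite dvdn_prime2 // ?pS //; last exact: mem_rem Hq.
  by move=> /eqP E; rewrite -E mem_rem_uniq // inE eqxx in Hq.
apply/negP => H; have : (p %| \prod_(p <- S) p)%N by apply: dvdn_trans H; apply: dvdn_mulr.
rewrite Euclid_dvd_prod // big_has => /hasP[q Hq].
by rewrite dvdn_prime2 // ?pS // => /eqP E; rewrite E Hq in Hp.
Qed.

Lemma sum_ln_primes n : (0 < n)%N -> squarefree n ->
  \rsum_(p <- primes n) ln (INR p) = ln (INR n).
Proof.
move=> n0 sf; rewrite {2}(sqfree_prod n0 sf) ln_prodn // => p; exact: primes_gt0.
Qed.

Definition count_S N (A : nat -> Prop) : R := INR (size (filter (fun n => dec (A n)) (cands N))).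

(** * Counting products of primes *)

(** The pairs [(n, p)] are counted twice with weight [ln p]. Each [n] contributes at least [kappa];
    each [m = n / p] contributes at most the sum of [ln p] over [p < N / m]. With [kappa] of order
    [ln N] this saves the factor [ln N]. *)
Lemma count_upper r N D (A : nat -> Prop) (B : seq nat -> bool) kappa : 0 < N ->
  (forall n, in_S r N D n -> A n ->
     kappa <= \rsum_(p <- primes n) (ind (B (rem p (primes n))) * ln (INR p))) ->
  kappa * count_S N (fun n => in_S r N D n /\ A n)
  <= 1.5 * N * wsum recip (primes_in D N) (fun S => ind (size S == r.-1) * ind (B S)).
Proof.
move=> N0 H; rewrite /count_S; set F := filter _ _.
have HF n : n \in F -> in_S r N D n /\ A n by rewrite mem_filter => /andP[/decP].
have uF : uniq F by rewrite filter_uniq // iota_uniq.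
apply: (Rle_trans _ (\rsum_(n <- F) \rsum_(p <- primes n)
  (ind (B (rem p (primes n))) * ln (INR p)))).
  rewrite Rmult_comm -rsum_const; apply: rsum_le => n /HF[]; exact: H.
set g := fun t : seq nat * nat => ind (size t.1 == r.-1) * ind (B t.1) * ln (INR t.2).
(* The pair [(n, p)] goes to the set of primes of [n / p], together with [p]. This is injective
   since [n] is the product of them all. *)
set h := fun t : nat * nat => (rem t.2 (primes t.1), t.2).
have sz n p : n \in F -> p \in primes n -> size (rem p (primes n)) = r.-1.
  by move=> /HF[[_ [_ [_ [sn _]]]] _] Hp; rewrite size_rem // sn.
apply: (Rle_trans _ (\rsum_(t <- [seq (n, p) | n <- F, p <- primes n]) g (h t))).
  rewrite big_allpairs_dep /=; right; apply: rsum_eq => n Hn; apply: rsum_eq => p Hp.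
  by rewrite /g /= sz // eqxx /=; ring.
pose T := [seq (U, p) | U <- subs (primes_in D N), p <- primes_in 0 (N / INR (\prod_(q <- U) q))].
apply: (Rle_trans _ (\rsum_(t <- T) g t)).
  have mem t : t \in [seq (n, p) | n <- F, p <- primes n] -> t.1 \in F /\ t.2 \in primes t.1.
    by case/allpairsPdep => n [p [Hn Hp ->]].
  have np n p : n \in F -> p \in primes n -> n = (p * \prod_(q <- rem p (primes n)) q)%N.
    move=> /HF[[n0 [_ [sf _]]] _] Hp.
    by rewrite {1}(sqfree_prod n0 sf) (perm_big _ (perm_to_rem Hp)) big_cons.
  apply: rsum_le_inj.
  - apply: allpairs_uniq_dep => //; first by move=> n _; apply: sorted_uniq (sorted_primes n);
    [exact: ltn_trans | exact: ltnn].
    by move=> [n p] [n' p'] /= _ _ [-> ->].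
  - move=> [n p] [n' p'] /mem[/= Hn Hp] /mem[/= Hn' Hp'] [E1 E2].
    by subst p'; rewrite (np n p) // E1 -(np n' p).
  - move=> [n p] /mem[/= Hn Hp]; apply/allpairsPdep; exists (rem p (primes n)), p; split => //.
      rewrite mem_subs; apply: subseq_trans (rem_subseq _ _) _.
      by apply: (in_S_subseq (r := r)); case: (HF _ Hn).
    have Hp' := Hp; rewrite mem_primes in Hp'; case/andP: Hp' => pp _.
    apply/primes_inP; split => //; split; first exact: pos_INR.
    have [[n0 [nN _]] _] := HF _ Hn.
    have R0 : 0 < INR (\prod_(q <- rem p (primes n)) q).
      by apply: INR_gt0; apply: prod_gt0 => q /mem_rem; apply: primes_gt0.
    apply: (Rmult_lt_reg_r (INR (\prod_(q <- rem p (primes n)) q))) => //.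
    rewrite -mulnE_INR -np // /Rdiv Rmult_assoc Rinv_l ?Rmult_1_r //.
    exact: Rgt_not_eq.
  - move=> t /allpairsPdep [S [p [_ Hp ->]]] /=.
    apply: Rmult_le_pos; last by apply: ln_ge0; apply: primes_in_ge1 Hp.
    by apply: Rmult_le_pos; exact: ind_ge0.
rewrite big_allpairs_dep wsum_subs -rsum_mull /=; apply: rsum_le => S HS.
have pS p : p \in S -> (0 < p)%N.
  by rewrite mem_subs in HS; move=> /(mem_subseq HS) /primes_in_prime /prime_gt0.
pose X := (\prod_(q <- S) q)%N; have W : wt recip S = / INR X := wt_inv_prod pS.
have R0 : 0 < INR X by apply: INR_gt0; apply: prod_gt0.
pose b := ind (size S == r.-1) * ind (B S).
have I0 : 0 <= b by apply: Rmult_le_pos; exact: ind_ge0.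
have NR : 0 <= N / INR X by apply: Rle_mult_inv_pos; lra.
apply: (Rle_trans _ (b * \rsum_(p <- primes_in 0 (N / INR X)) ln (INR p))).
  by right; rewrite -rsum_mull.
apply: Rle_trans (Rmult_le_compat_l _ _ _ I0 (theta_primes_in NR)) _.
by right; rewrite W -/b /Rdiv; ring.
Qed.

Lemma count_dvd (s : seq nat) d x : uniq s -> (0 < d)%N -> 0 < x ->
  (forall n, n \in s -> [/\ (0 < n)%N, INR n < x & d %| n]) -> INR (size s) <= x / INR d.
Proof.
move=> us d0 x0 Hs; have D0 := INR_gt0 d0.
have q0 : 0 < x / INR d by apply: Rdiv_lt_0_compat.
have [M [M1 M2]] := ceil_nat q0.
apply: Rle_trans (Rlt_le _ _ M1).
have E (t : seq nat) : INR (size t) = \rsum_(i <- t) 1 by rewrite rsum_const Rmult_1_r.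
rewrite -[M](size_iota 1) !E.
apply: (rsum_le_inj (h := fun n => (n %/ d)%N)) => //; last by move=> *; lra.
  move=> n m /Hs[_ _ dn] /Hs[_ _ dm] /= Enm.
  by rewrite -(divnK dn) -(divnK dm) Enm.
move=> n /Hs[n0 nx dn]; rewrite mem_iota add1n ltnS; apply/andP; split.
  by rewrite divn_gt0 // dvdn_leq.
have : (n %/ d < M.+1)%N; last by rewrite ltnS.
apply: INR_ltn; rewrite S_INR; apply: Rlt_le_trans M2.
apply: (Rmult_lt_reg_r (INR d)) => //.
rewrite -mulnE_INR divnK // /Rdiv Rmult_assoc Rinv_l; lra.
Qed.

Lemma cnt_le N (A B : nat -> Prop) : (forall n, A n -> B n) -> count_S N A <= count_S N B.
Proof.
move=> AB; rewrite /count_S; apply: leq_INR; rewrite !size_filter.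
by apply: sub_count => n /decP H; apply/decP; apply: AB.
Qed.

Lemma cnt_or N (A B : nat -> Prop) : count_S N (fun n => A n \/ B n) <= count_S N A + count_S N B.
Proof.
rewrite /count_S -addnE_INR; apply: leq_INR; rewrite !size_filter.
rewrite -count_predUI; apply: leq_trans (leq_addr _ _).
apply: sub_count => n /decP /= [H|H]; apply/orP; [left|right]; exact/decP.
Qed.

Lemma cnt_ge0 N A : 0 <= count_S N A. Proof. exact: pos_INR. Qed.

Lemma cnt_small N x (A : nat -> Prop) : 0 < x -> (forall n, A n -> (0 < n)%N /\ INR n < x) ->
  count_S N A <= x.
Proof.
move=> x0 H; rewrite /count_S; have -> : x = x / INR 1 by rewrite /=; field.
apply: count_dvd => //; first by rewrite filter_uniq // iota_uniq.
by move=> n; rewrite mem_filter => /andP[/decP /H[? ?] _].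
Qed.

Lemma cnt_exists_dvd N (I : eqType) (s : seq I) (d : I -> nat) (A : nat -> Prop) : 0 < N ->
  (forall i, i \in s -> (0 < d i)%N) ->
  (forall n, A n -> [/\ (0 < n)%N, INR n < N & exists2 i, i \in s & d i %| n]) ->
  count_S N A <= N * \rsum_(i <- s) / INR (d i).
Proof.
move=> N0 d0 H; rewrite -rsum_mull.
apply: (Rle_trans _ (\rsum_(i <- s) count_S N (fun n => (0 < n)%N /\ INR n < N /\ d i %| n)));
  last first.
  apply: rsum_le => i Hi; rewrite /count_S; apply: count_dvd => //;
    [by rewrite filter_uniq // iota_uniq | exact: d0 |].
  by move=> n; rewrite mem_filter => /andP[/decP [? [? ?]] _].
rewrite /count_S size_filter rsum_count.
rewrite (rsum_eq (I := I) (g := fun i => \rsum_(n <- cands N)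
  (if dec ((0 < n)%N /\ INR n < N /\ d i %| n) then 1 else 0))); last first.
  by move=> i _; rewrite size_filter rsum_count.
rewrite rsum_exchange; apply: rsum_le => n _.
have pos i : 0 <= (if dec ((0 < n)%N /\ INR n < N /\ d i %| n) then 1 else 0) by case: (dec _); lra.
case: decP => HA; last by apply: rsum_ge0.
have [n0 nN [i Hi di]] := H n HA.
apply: Rle_trans (rsum_mem_le (g := fun i =>
  if dec ((0 < n)%N /\ INR n < N /\ d i %| n) then 1 else 0) Hi _) => //.
by case: decP => //= K; [lra | case: K].
Qed.

Lemma wt_inv_subseq x y (U : seq nat) : subseq U (primes_in x y) ->
  wt recip U = / INR (\prod_(p <- U) p) /\ 0 < INR (\prod_(p <- U) p).
Proof.
move=> HU; have pU (p : nat) : p \in U -> (0 < p)%N by move=>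
  /(mem_subseq HU) /primes_in_prime /prime_gt0.
by split; [exact: wt_inv_prod | apply: INR_gt0; exact: prod_gt0].
Qed.

(* Numbers [q * prod U] with [U] a set of [r - 1] primes in [D, y) of product at most [M], and [q] a
   prime just below [N / prod U]. *)
Lemma card_lower_pairs r N D y M : (0 < r)%N -> 0 < D -> 0 < M -> D <= y ->
  y <= N / M / exp 7 -> exp 8 <= N / M ->
  N / exp 7 / ln N * wsum recip (primes_in D y) (fun U => ind (size U == r.-1) *
     ind (dec (INR (\prod_(p <- U) p) <= M))) <= INR (card_S r N D).
Proof.
move=> r0 D0 M0 Dy Hy H8.
have e7 : 0 < exp 7 by exact: exp_pos.
have NM : 0 < N / M by have := exp_pos 8; lra.
have N0 : 0 < N.
  have -> : N = N / M * M by field; lra.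
  exact: Rmult_lt_0_compat.
have c0 : 0 < N / exp 7 by apply: Rdiv_lt_0_compat.
pose ok (U : seq nat) := (size U == r.-1) && dec (INR (\prod_(p <- U) p) <= M).
pose z (U : seq nat) := N / INR (\prod_(p <- U) p).
pose T := [seq (U, q) | U <- [seq U <- subs (primes_in D y) | ok U],
  q <- primes_in (z U / exp 7) (z U)].
have memT t : t \in T -> [/\ subseq t.1 (primes_in D y), size t.1 =
  r.-1, INR (\prod_(p <- t.1) p) <= M
    & t.2 \in primes_in (z t.1 / exp 7) (z t.1)].
  case/allpairsPdep => U [q [HU Hq ->]] /=; move: HU.
  by rewrite mem_filter mem_subs => /andP[/andP[/eqP s1 /decP s2] s3].
(* The primes of [U] are below [y <= q], so [q] is the largest prime of the product, whose sorted
   list of primes determines [(U, q)]. *)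
have big t : t \in T -> y <= INR t.2.
  case: t => U q /memT [/= HU _ HM /primes_inP[_ [H _]]].
  have [_ P0] := wt_inv_subseq HU.
  apply: Rle_trans Hy _; apply: Rle_trans H.
  rewrite /z; apply: Rmult_le_compat_r; first by left; apply: Rinv_0_lt_compat.
  by apply: Rmult_le_compat_l; [lra | apply: Rinv_le_contravar].
pose h (t : seq nat * nat) := (\prod_(p <- rcons t.1 t.2) p)%N.
have srt t : t \in T -> sorted ltn (rcons t.1 t.2).
  move=> Ht; have B := big _ Ht; have [HU _ _ _] := memT _ Ht.
  rewrite -cats1; apply: sorted_ltn_cat => //.
    by apply: subseq_sorted HU (primes_in_sorted _ _); exact: ltn_trans.
  move=> p q /(mem_subseq HU) /primes_inP[_ [_ H]]; rewrite mem_seq1 => /eqP ->.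
  by apply: INR_ltn; lra.
have prm t p : t \in T -> p \in rcons t.1 t.2 -> prime p.
  move=> Ht; have [HU _ _ Hq] := memT _ Ht.
  rewrite mem_rcons in_cons => /orP[/eqP ->|/(mem_subseq HU) H];
    [exact: primes_in_prime Hq | exact: primes_in_prime H].
have prh t : t \in T -> primes (h t) = rcons t.1 t.2.
  by move=> Ht; apply: primes_prod; [exact: srt | move=> p; exact: prm].
have hS t : t \in T -> in_S r N D (h t).
  move=> Ht; have [HU s1 HM Hq] := memT _ Ht.
  have [_ P0] := wt_inv_subseq HU.
  split; first by apply: prod_gt0 => p /(prm _ _ Ht) /prime_gt0.
  split.
    rewrite /h -cats1 big_cat big_seq1 /= mulnE_INR.
    case/primes_inP: Hq => _ [_ Hq]; rewrite Rmult_comm.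
    apply: Rlt_le_trans (Rmult_lt_compat_r _ _ _ P0 Hq) _.
    by rewrite /z; right; field; apply: Rgt_not_eq.
  split; first by apply: sqfree_prod_primes;
    [apply: (sorted_uniq ltn_trans ltnn); exact: srt | move=> p; exact: prm].
  rewrite prh // size_rcons s1; split; first by rewrite prednK.
  move=> p; rewrite mem_rcons in_cons => /orP[/eqP ->|/(mem_subseq HU)]; last by case/primes_inP =>
    _ [].
  by have := big _ Ht; lra.
apply: (Rle_trans _ (INR (size T))); last first.
  rewrite /card_S; set F := filter _ _.
  have E (t : seq nat) : INR (size t) = \rsum_(i <- t) 1 by rewrite rsum_const Rmult_1_r.
  have E' (t : seq (seq nat * nat)) : INR (size t) =
    \rsum_(i <- t) 1 by rewrite rsum_const Rmult_1_r.
  rewrite E E'; apply: (rsum_le_inj (h := h)) => //.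
  - apply: allpairs_uniq_dep; first by rewrite filter_uniq // subs_uniq // primes_in_uniq.
      by move=> U _; exact: primes_in_uniq.
    by move=> [U q] [U' q'] _ _ [-> ->].
  - move=> [U q] [U' q'] Ht Ht' E2; have := prh _ Ht; rewrite E2 prh //=.
    by move=> /rcons_inj[-> ->].
  - move=> t Ht; rewrite mem_filter; have HS := hS t Ht.
    apply/andP; split; first exact/decP.
    by rewrite mem_iota add0n /=; apply: lt_up_nat; case: HS => _ [].
  - by move=> *; lra.
have -> : INR (size T) = \rsum_(U <- [seq U <- subs (primes_in D y) | ok U]) INR
  (size (primes_in (z U / exp 7) (z U))).
  rewrite /T size_allpairs_dep sumnE big_map.
  elim: [seq _ <- _ | _] => [|a s IH]; first by rewrite big_nil rsum_nil.
  by rewrite big_cons rsum_cons addnE_INR IH.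
rewrite rsum_filter wsum_subs -rsum_mull; apply: rsum_le => U; rewrite mem_subs => HU.
have [W P0] := wt_inv_subseq HU.
rewrite -ind_and -/(ok U) W; case K: (ok U) => /=; last lra.
move: K => /andP[_ /decP HM].
have zM : N / M <= z U by apply: Rmult_le_compat_l; [lra | apply: Rinv_le_contravar].
have H := @cheb_lower (z U) ltac:(lra).
apply: Rle_trans H.
have lz : 0 < ln (z U).
  apply: ln_gt0; apply: Rlt_le_trans (_ : exp 8 <= _); last lra.
  by have := exp_ge1 8; lra.
have P1 : 1 <= INR (\prod_(p <- U) p).
  by apply: ge1_INR; apply: prod_gt0 => p /(mem_subseq HU) /primes_in_prime /prime_gt0.
have lzN : ln (z U) <= ln N.
  apply: ln_le_mono; first lra.
  rewrite /z -[X in _ <= X]Rmult_1_r; apply: Rmult_le_compat_l; first lra.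
  by rewrite -Rinv_1; apply: Rinv_le_contravar => //; lra.
have I1 : / ln N <= / ln (z U) by apply: Rinv_le_contravar.
apply: (Rle_trans _ (z U / exp 7 * / ln N)).
  by right; rewrite /z /Rdiv; ring.
apply: Rmult_le_compat_l => //; apply: Rle_mult_inv_pos; lra.
Qed.

Lemma exp_term_ratio x y k : 0 < y -> exp_term x k = (x / y) ^ k * exp_term y k.
Proof.
move=> y0; rewrite !exp_termE.
have -> : x ^ k = (x / y) ^ k * y ^ k.
  by rewrite -Rpow_mult_distr; congr (_ ^ _); field; lra.
by rewrite /Rdiv; ring.
Qed.

Lemma pow_exp x k : exp x ^ k = exp (INR k * x).
Proof.
elim: k => [|k IH]; first by rewrite /= Rmult_0_l exp_0.
by rewrite -[_ ^ k.+1]/(exp x * exp x ^ k) IH -exp_plus S_INR; congr exp; ring.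
Qed.

Lemma one_sub_ge x : 0 <= x <= 1 / 2 -> exp (- 2 * x) <= 1 - x.
Proof.
move=> H; rewrite -[X in _ <= X]exp_ln; last lra.
apply: exp_le; apply: Rle_trans (@ln_gt1sub (1 - x) ltac:(lra)).
apply: (Rmult_le_reg_r (1 - x)); first lra.
have -> : (1 - / (1 - x)) * (1 - x) = - x by field; lra.
nra.
Qed.

(** Take [y = N ^ (1 / 32)] and [M = N ^ (1 / 4)]. The mean of [ln (prod U)] is about [ln N / 16] at
    most, so Markov's inequality keeps a constant proportion of the sets [U]. Restricting the primes
    to those below [y] lowers [P] by at most [17 + ln 32 <= 21], which costs a constant factor since
    [r - 1 <= 1.05 * P]. *)
Lemma card_lower r N D : 0 < N -> D > 3 -> 1000 <= ln N -> ln D <= ln N / 32 ->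
  let P := \rsum_(p <- primes_in D N) / INR p in
  1000 <= P -> (2 < r)%N -> INR r.-1 <= 1.05 * P ->
  exp (-100) * (N / ln N) * exp_term P r.-1 <= INR (card_S r N D).
Proof.
move=> N1 D3 lN lD P P0 r2 rP.
have EN : N = exp (ln N) by rewrite exp_ln.
pose y := exp (ln N / 32); pose M := exp (ln N / 4).
have NM : N / M = exp (3 / 4 * ln N).
  by rewrite {1}EN /M /Rdiv -exp_Ropp -exp_plus; congr exp; lra.
have Dy : D <= y by apply: ln_le_exp; lra.
have yN : y <= N by rewrite EN; apply: exp_le; lra.
have L := @card_lower_pairs r N D y M ltac:(lia) ltac:(lra) (exp_pos _) Dy.
have {}L := L ltac:(rewrite NM /Rdiv -exp_Ropp -exp_plus; apply: exp_le; lra)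
   ltac:(rewrite NM; apply: exp_le; lra).
apply: Rle_trans L.
set l := primes_in D y; set k := r.-1 in rP *.
have w0 (p : nat) : p \in l -> 0 <= / INR p by exact: inv_ge0.
have k2 : exists k2, k = k2.+2 by exists (k.-2); rewrite /k; lia.
set Py := \rsum_(p <- l) / INR p.
have PPy : P - 21 <= Py.
  rewrite /P /Py (@primes_in_cat D y N) // rsum_cat.
  have [_ H] := @mertens2 y N ltac:(lra) yN.
  have E : ln (ln N) - ln (ln y) = ln 32.
    by rewrite /y ln_exp ln_div; lra.
  have l32 : ln 32 <= 4.
    have -> : 32 = 2 * 2 * 2 * 2 * 2 by lra.
    by rewrite !ln_mult; have := ln2_bounds; lra.
  rewrite -/l; lra.
have Py0 : 0 < Py by lra.
have low : exp_term Py k / 2 <= wsum recip l (fun U =>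
  ind (size U == k) * ind (dec (INR (\prod_(p <- U) p) <= M))).
  (* As [k <= 1.1 * Py], lowering the index of [exp_term Py] by one costs at most a factor 1.1. The
     losses [1.21 / 6] from repeated primes and [1.1 / 4] from Markov's inequality leave more than
     one half. *)
  apply: (Rle_trans _ (elem_sym recip l k - 1 / 4 * elem_sym recip l k.-1)).
    have [j Ej] := k2; rewrite Ej succnK.
    have H1 : exp_term Py j.+2 - (\rsum_(p <- l) (/ INR p * / INR p)) / 2 * exp_term Py j <=
      elem_sym recip l j.+2.
      exact: (elem_sym_ge j.+1 w0).
    have H2 : elem_sym recip l j.+1 <= exp_term Py j.+1 := elem_sym_le j.+1 w0.
    have Q : \rsum_(p <- l) (/ INR p * / INR p) <= 1 / 3 by apply: inv_sq_primes_in; lra.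
    have R1 := exp_termS Py j.+1; have R2 := exp_termS Py j.
    have g0 := @exp_term_ge0 Py j ltac:(lra); have g1 := @exp_term_ge0 Py j.+1 ltac:(lra);
      have g2 := @exp_term_ge0 Py j.+2 ltac:(lra).
    rewrite Ej in rP; have E2 : INR j.+2 = INR j.+1 + 1 by rewrite S_INR.
    have j0 := pos_INR j.+1.
    have B1 : exp_term Py j.+1 <= 1.1 * exp_term Py j.+2.
      apply: (Rmult_le_reg_l Py) => //; rewrite -R1.
      have : INR j.+2 <= 1.1 * Py by lra.
      nra.
    have B2 : exp_term Py j <= 1.1 * exp_term Py j.+1.
      apply: (Rmult_le_reg_l Py) => //; rewrite -R2.
      have : INR j.+1 <= 1.1 * Py by lra.
      nra.
    have : (\rsum_(p <- l) (/ INR p * / INR p)) / 2 * exp_term Py j <= 1 / 6 * exp_term Py j.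
      by apply: Rmult_le_compat_r => //; lra.
    lra.
  have Mk := @wsum_marked recip l (fun p => ln (INR p)) k.-1 w0 ltac:(by move=>
    p /primes_in_ge1 /ln_ge0).
  have Ek : k.-1.+1 = k by have [j ->] := k2.
  rewrite Ek in Mk.
  have T : \rsum_(p <- l) (/ INR p * ln (INR p)) <= ln N / 16.
    have H := @mertens1_le D y ltac:(lra).
    rewrite (rsum_eq (g := fun p => ln (INR p) / INR p)); last by move=> p _; rewrite Rmult_comm.
    apply: Rle_trans H _; rewrite /y ln_exp; lra.
  have e0 := elem_sym_ge0 k.-1 w0.
  (* Markov's inequality: a product above [N ^ (1 / 4)] has [4 / ln N] times its logarithm at least
     1. *)
  have : wsum recip l (fun U => ind (size U == k)) - 4 / ln N * wsum recip l (fun U =>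
    ind (size U == k) * \rsum_(p <- U) ln (INR p))
    <= wsum recip l (fun U => ind (size U == k) * ind (dec (INR (\prod_(p <- U) p) <= M))).
    rewrite /Rminus Ropp_mult_distr_l -wsum_scal -wsum_add; apply: wsum_le => // U HU.
    have [_ X0] := wt_inv_subseq HU.
    have pU (p : nat) : p \in U -> (0 < p)%N by move=> /(mem_subseq HU) /primes_in_prime /prime_gt0.
    rewrite -ln_prodn //.
    case: (size U == k) => /=; last lra.
    case: decP => /= H.
      have : 0 <= ln (INR (\prod_(p <- U) p)) by apply: ln_ge0; apply: ge1_INR; exact: prod_gt0.
      have : 0 < 4 / ln N by apply: Rdiv_lt_0_compat; lra.
      set a := ln (INR _); set b := 4 / ln N; nra.
    have : ln M <= ln (INR (\prod_(p <- U) p)) by apply: ln_le_mono; [exact: exp_pos | lra].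
    rewrite /M ln_exp => H2.
    have : 4 / ln N * (ln N / 4) <= 4 / ln N * ln (INR (\prod_(p <- U) p)).
      by apply: Rmult_le_compat_l => //; left; apply: Rdiv_lt_0_compat; lra.
    have -> : 4 / ln N * (ln N / 4) = 1 by field; lra.
    lra.
  rewrite -/(elem_sym recip l k) => H; apply: Rle_trans H.
  have A : 4 / ln N * wsum recip l (fun U => ind (size U == k) * \rsum_(p <- U) ln (INR p))
     <= 4 / ln N * (ln N / 16 * elem_sym recip l k.-1).
    apply: Rmult_le_compat_l; first by left; apply: Rdiv_lt_0_compat; lra.
    by apply: Rle_trans Mk _; apply: Rmult_le_compat_r.
  have E : 4 / ln N * (ln N / 16 * elem_sym recip l k.-1) = 1 / 4 * elem_sym recip l k.-1 by field;
    lra.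
  rewrite E in A; lra.
have R : exp (-50) * exp_term P k <= exp_term Py k.
  rewrite (@exp_term_ratio Py P); last lra.
  apply: Rmult_le_compat_r; first by apply: exp_term_ge0; lra.
  have H : exp (- 2 * (21 / P)) <= Py / P.
    apply: Rle_trans (_ : 1 - 21 / P <= _).
      apply: one_sub_ge; split; first by apply: Rle_mult_inv_pos; lra.
      by apply: (Rmult_le_reg_r P); [lra | rewrite /Rdiv Rmult_assoc Rinv_l; lra].
    have -> : 1 - 21 / P = (P - 21) / P by field; lra.
    by apply: Rmult_le_compat_r; [left; apply: Rinv_0_lt_compat; lra | lra].
  apply: Rle_trans (pow_incr _ _ k (conj (Rlt_le _ _ (exp_pos _)) H)).
  rewrite pow_exp; apply: exp_le.
  have -> : INR k * (-2 * (21 / P)) = - 42 * (INR k / P) by field; lra.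
  have : INR k / P <= 1.05.
    by apply: (Rmult_le_reg_r P); [lra | rewrite /Rdiv Rmult_assoc Rinv_l; lra].
  lra.
have c0 : 0 < N / ln N by apply: Rdiv_lt_0_compat; lra.
have E7 : exp (-7) = / exp 7 by rewrite -exp_Ropp; congr exp; lra.
have -> : N / exp 7 / ln N = exp (-7) * (N / ln N) by rewrite E7 /Rdiv; ring.
have pw0 := @exp_term_ge0 P k ltac:(lra).
apply: (Rle_trans _ (exp (-7) * (N / ln N) * (exp_term Py k / 2))); last first.
  apply: Rmult_le_compat_l => //; apply: Rmult_le_pos; [left; exact: exp_pos | lra].
have S1 : exp (-100) <= exp (-7) * exp (-50) / 2.
  rewrite -exp_plus.
  have -> : exp (-100) = exp (-7 + -50) * exp (-43) by rewrite -exp_plus; congr exp; lra.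
  have : exp (-43) <= 1 / 2.
    have -> : exp (-43) = / exp 43 by rewrite -exp_Ropp; congr exp; lra.
    have -> : 1 / 2 = / 2 by lra.
    by apply: Rinv_le_contravar; have := exp_ge1 43; lra.
  have := exp_pos (-7 + -50); nra.
have -> : exp (-100) * (N / ln N) * exp_term P k = exp (-100) * ((N / ln N) * exp_term P k) by ring.
apply: Rle_trans (Rmult_le_compat_r _ _ _ _ S1) _.
  by apply: Rmult_le_pos; lra.
have -> : exp (-7) * exp (-50) / 2 * (N / ln N * exp_term P k) =
  exp (-7) * (N / ln N) / 2 * (exp (-50) * exp_term P k) by field; lra.
have -> : exp (-7) * (N / ln N) * (exp_term Py k / 2) =
  exp (-7) * (N / ln N) / 2 * exp_term Py k by field; lra.
apply: Rmult_le_compat_l => //.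
have := exp_pos (-7); nra.
Qed.

(** * Stirling bounds *)

(** [t ^ 2 - 2 * t * ln t] is increasing. At [t = 1 + 1 / n] this is the upper half of the step in
    [stirling]. *)
Lemma ln_le_half_diff t : 1 <= t -> ln t <= (t - / t) / 2.
Proof.
case=> [t1|<-]; last by rewrite ln_1; lra.
have D c : 1 <= c <= t -> derivable_pt_lim
  (minus_fct (mult_fct id id) (mult_real_fct 2 (mult_fct id ln)))
    c ((1 * id c + id c * 1) - 2 * (1 * ln c + id c * / c)).
  move=> Hc; apply: derivable_pt_lim_minus.
    by apply: derivable_pt_lim_mult; exact: derivable_pt_lim_id.
  apply: derivable_pt_lim_scal; apply: derivable_pt_lim_mult; first exact: derivable_pt_lim_id.
  by apply: derivable_pt_lim_ln; lra.
have [c [E Hc]] := MVT_cor2 _ _ _ _ t1 D.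
have P : 0 <= (1 * id c + id c * 1 - 2 * (1 * ln c + id c * / c)) * (t - 1).
  apply: Rmult_le_pos; last lra.
  rewrite /id Rinv_r; last lra.
  by have := @ln_sub1 c ltac:(lra); lra.
move: P; rewrite -E /minus_fct /mult_real_fct /mult_fct /id ln_1 => P.
apply: (Rmult_le_reg_r t); first lra.
have -> : (t - / t) / 2 * t = (t * t - 1) / 2 by field; lra.
lra.
Qed.

(** [(t + 1) * ln t - 2 * t] is increasing. At [t = 1 + 1 / n] this gives
    [(n + 1 / 2) * ln (1 + 1 / n) >= 1], the lower half. *)
Lemma ln_ge_pade t : 1 <= t -> 2 - 4 / (t + 1) <= ln t.
Proof.
case=> [t1|<-]; last by rewrite ln_1; lra.
have D c : 1 <= c <= t -> derivable_pt_lim (minus_fct (mult_fct (plus_fct id (fct_cte 1)) ln)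
  (mult_real_fct 2 id))
    c ((1 + 0) * ln c + (id c + fct_cte 1 c) * / c - 2 * 1).
  move=> Hc; apply: derivable_pt_lim_minus; last first.
    by apply: derivable_pt_lim_scal; exact: derivable_pt_lim_id.
  apply: derivable_pt_lim_mult; last by apply: derivable_pt_lim_ln; lra.
  by apply: derivable_pt_lim_plus; [exact: derivable_pt_lim_id | exact: derivable_pt_lim_const].
have [c [E Hc]] := MVT_cor2 _ _ _ _ t1 D.
have P : 0 <= ((1 + 0) * ln c + (id c + fct_cte 1 c) * / c - 2 * 1) * (t - 1).
  apply: Rmult_le_pos; last lra.
  rewrite /id /fct_cte; have -> : (c + 1) * / c = 1 + / c by field; lra.
  by have := @ln_gt1sub c ltac:(lra); lra.
move: P; rewrite -E /minus_fct /mult_real_fct /mult_fct /plus_fct /fct_cte /id ln_1 => P.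
apply: (Rmult_le_reg_r (t + 1)); first lra.
have -> : (2 - 4 / (t + 1)) * (t + 1) = 2 * (t - 1) by field; lra.
lra.
Qed.

Lemma exp_term_diag_S k : (0 < k)%N -> exp_term (INR k.+1) k.+1 =
  (INR k.+1 / INR k) ^ k * exp_term (INR k) k.
Proof.
move=> k0; have K := INR_gt0 k0.
rewrite exp_term_rec {1}/Rdiv Rinv_r ?Rmult_1_l; first exact: exp_term_ratio.
by apply: Rgt_not_eq; apply: INR_gt0.
Qed.

(** The middle expression is [-1] at [k = 1], and its increment [(k + 1 / 2) * ln (1 + 1 / k) - 1]
    lies between 0 and [1 / (4 * k) - 1 / (4 * (k + 1))], so both bounds telescope. *)
Lemma stirling k : (0 < k)%N ->
  -1 <= ln (exp_term (INR k) k) + ln (INR k) / 2 - INR k <= - / (4 * INR k).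
Proof.
elim: k => [//|[|k] IH] _.
  have -> : exp_term (INR 1) 1 = 1 by rewrite /=; field.
  by rewrite /= ln_1; lra.
have {}IH := IH isT; set n := k.+1 in IH *.
have K : 0 < INR n by apply: INR_gt0.
have K1 : INR n.+1 = INR n + 1 by rewrite S_INR.
have Q : 0 < INR n.+1 / INR n by apply: Rdiv_lt_0_compat; lra.
have E1 : INR n.+1 / INR n = 1 + / INR n by rewrite K1; field; lra.
rewrite exp_term_diag_S // ln_mult; [|exact: pow_lt|exact: exp_term_gt0].
rewrite ln_pow //.
have EL : ln (INR n.+1) = ln (INR n) + ln (INR n.+1 / INR n) by rewrite ln_div; lra.
rewrite EL; set y := ln (INR n.+1 / INR n).
have I0 : 0 < / INR n by apply: Rinv_0_lt_compat.
have U := @ln_le_half_diff (INR n.+1 / INR n) ltac:(lra).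
have L := @ln_ge_pade (INR n.+1 / INR n) ltac:(lra).
rewrite -/y in U L; rewrite K1 in U L *; set a := INR n in K IH U L *.
have U2 : (a + / 2) * y <= 1 + (/ (4 * a) - / (4 * (a + 1))).
  apply: Rle_trans (Rmult_le_compat_l (a + / 2) _ _ ltac:(lra) U) _.
  by right; field; lra.
have L2 : 1 <= (a + / 2) * y.
  apply: Rle_trans (Rmult_le_compat_l (a + / 2) _ _ ltac:(lra) L).
  by right; field; lra.
lra.
Qed.

Lemma ln_sqrt x : 0 < x -> ln (sqrt x) = ln x / 2.
Proof. by move=> x0; rewrite -Rpower_sqrt // /Rpower ln_exp; lra. Qed.

Lemma exp_term_diag_ge k : (0 < k)%N -> exp (INR k - 1) <= exp_term (INR k) k * sqrt (INR k).
Proof.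
move=> k0; have K := INR_gt0 k0; have [H _] := stirling k0.
have S : 0 < sqrt (INR k) by apply: sqrt_lt_R0.
have PW := exp_term_gt0 k K.
rewrite -[X in _ <= X]exp_ln; last exact: Rmult_lt_0_compat.
by apply: exp_le; rewrite ln_mult // ln_sqrt //; lra.
Qed.

Lemma exp_term_diag_le k : (0 < k)%N -> exp_term (INR k) k * sqrt (INR k) <= exp (INR k).
Proof.
move=> k0; have K := INR_gt0 k0; have [_ H] := stirling k0.
have S : 0 < sqrt (INR k) by apply: sqrt_lt_R0.
have PW := exp_term_gt0 k K.
have I0 : 0 < / (4 * INR k) by apply: Rinv_0_lt_compat; lra.
apply: ln_le_exp; first exact: Rmult_lt_0_compat.
by rewrite ln_mult // ln_sqrt //; lra.
Qed.

Lemma exp_term_upto x j d : 0 <= x -> INR (j + d) <= x -> exp_term x j <= exp_term x (j + d).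
Proof.
move=> x0; elim: d => [|d IH] H; first by rewrite addn0; lra.
rewrite addnS in H *; apply: Rle_trans (IH _) _; first by rewrite S_INR in H; lra.
have K : 0 < INR (j + d).+1 by apply: INR_gt0.
rewrite exp_term_rec -[X in X <= _]Rmult_1_l; apply: Rmult_le_compat_r; first exact: exp_term_ge0.
by apply: (Rmult_le_reg_r (INR (j + d).+1)) => //; rewrite /Rdiv Rmult_assoc Rinv_l; lra.
Qed.

Lemma exp_term_le_exp_big x j : 0 < x -> (0 < j)%N -> exp_term x j * sqrt (INR j) <= exp x.
Proof.
move=> x0 j0; have K := INR_gt0 j0.
have S : 0 < sqrt (INR j) by apply: sqrt_lt_R0.
rewrite (exp_term_ratio _ _ K).
have H := exp_term_diag_le j0.
have H2 : (x / INR j) ^ j <= exp (x - INR j).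
  have q0 : 0 < x / INR j by apply: Rdiv_lt_0_compat.
  rewrite -[x / INR j]exp_ln // pow_exp; apply: exp_le.
  have := Rmult_le_compat_l _ _ _ (Rlt_le _ _ K) (ln_sub1 q0).
  have -> : INR j * (x / INR j - 1) = x - INR j by field; lra.
  by [].
have -> : exp x = exp (x - INR j) * exp (INR j) by rewrite -exp_plus; congr exp; lra.
rewrite Rmult_assoc; apply: Rmult_le_compat => //.
  by apply: pow_le; left; apply: Rdiv_lt_0_compat.
by apply: Rmult_le_pos; [left; exact: exp_term_gt0 | lra].
Qed.

(** The terms increase with the index up to [x], so a term with [j < x / 2] is at most the one with
    index just below [x]. Hence [exp_term_le_exp_big] may be applied with an index of at least
    [x / 2]. *)
Lemma exp_term_le_exp x j : 2 <= x -> exp_term x j * sqrt x <= 2 * exp x.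
Proof.
move=> x2.
have s0 : 0 < sqrt x by apply: sqrt_lt_R0; lra.
suff [i [Hi xi]] : exists i : nat, exp_term x j <= exp_term x i /\ x / 2 <= INR i.
  have i0 : (0 < i)%N by apply: INR_ltn; rewrite /=; lra.
  have P := @exp_term_le_exp_big x i ltac:(lra) i0.
  have S : sqrt x <= 2 * sqrt (INR i).
    have -> : 2 = sqrt 4 by have -> : 4 = 2 * 2 by [lra]; rewrite sqrt_square; lra.
    by rewrite -sqrt_mult; [apply: sqrt_le_1; lra | lra | lra].
  have := @exp_term_ge0 x j ltac:(lra); have := @exp_term_ge0 x i ltac:(lra); nra.
case: (Rle_lt_dec (x / 2) (INR j)) => H; first by exists j; split => //; lra.
have [m [Hm1 Hm2]] := @ceil_nat x ltac:(lra).
exists m; split; last by lra.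
have jm : (j <= m)%N.
  have : (j < m.+1)%N by apply: INR_ltn; rewrite S_INR; lra.
  by rewrite ltnS.
by rewrite -(subnKC jm); apply: exp_term_upto; rewrite ?subnKC //; lra.
Qed.

(** A Gaussian lower bound around the peak: [(P / k) ^ k >= exp (k * (1 - k / P))], and [k * (1 - k
    / P) + k = P - (k - P) ^ 2 / P]. *)
Lemma exp_term_lower P k : 0 < P -> (0 < k)%N ->
  exp (P - (INR k - P) * (INR k - P) / P - 1) <= exp_term P k * sqrt (INR k).
Proof.
move=> P0 k0; have K := INR_gt0 k0.
have S : 0 < sqrt (INR k) by apply: sqrt_lt_R0.
rewrite (exp_term_ratio _ _ K) Rmult_assoc.
have q0 : 0 < P / INR k by apply: Rdiv_lt_0_compat.
have H1 : exp (INR k * (1 - INR k / P)) <= (P / INR k) ^ k.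
  rewrite -[P / INR k]exp_ln // pow_exp; apply: exp_le; apply: Rmult_le_compat_l; first lra.
  have := ln_gt1sub q0; have -> : / (P / INR k) = INR k / P by field; lra.
  lra.
have -> : P - (INR k - P) * (INR k - P) / P - 1 = INR k * (1 - INR k / P) + (INR k - 1) by field;
  lra.
rewrite exp_plus; apply: Rmult_le_compat;
  [left; exact: exp_pos | left; exact: exp_pos | exact: H1 | exact: exp_term_diag_ge].
Qed.

(** * Probability bounds for large N *)

(* [x ^ 3] is the paper's [log (log N / log D)]. *)
Record setup (N D : R) (r : nat) (x P : R) : Prop := Setup {
  s_N : 0 < N;
  s_D : 3 < D;
  s_DN : D <= N;
  s_x : 100 <= x;
  s_L : ln (ln N) - ln (ln D) = x * x * x;
  s_ll : x * x * x <= ln (ln N) <= 4 / 3 * (x * x * x);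
  s_lN : 1000 <= ln N;
  s_r : - (x * x) <= INR r - x * x * x <= x * x;
  s_r2 : (2 < r)%N;
  s_PE : P = \rsum_(p <- primes_in D N) / INR p;
  s_P : - 17 <= P - x * x * x <= 17;
  s_card : exp (-100) * (N / ln N) * exp_term P r.-1 <= INR (card_S r N D)
}.

Lemma ln3_gt1 D : 3 < D -> 1 < ln D.
Proof.
move=> H; rewrite -(ln_exp 1); apply: ln_increasing; first exact: exp_pos.
by have := exp_le_3; lra.
Qed.

(** From [ln (ln D) <= ln (ln N) / 4] one gets [x ^ 3 >= 3 / 4 * ln (ln N)], hence the threshold for
    [N]. *)
Lemma setup_ex x0 : 100 <= x0 -> exists N0, forall N D r, hyps N D r -> N0 <= N ->
  exists x P, x0 <= x /\ setup N D r x P.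
Proof.
move=> x0_100; exists (exp (exp (4 / 3 * (x0 * x0 * x0)))) => N D r [N30 [D3 [ND [r0 Hr]]]] HN.
have N1 : 0 < N by lra.
have lN : exp (4 / 3 * (x0 * x0 * x0)) <= ln N by apply: exp_le_ln.
have ll : 4 / 3 * (x0 * x0 * x0) <= ln (ln N) by apply: exp_le_ln.
have x3 : 1000000 <= x0 * x0 * x0.
  have : 10000 <= x0 * x0 by nra.
  nra.
have lN0 : 0 < ln N by have := exp_pos (4 / 3 * (x0 * x0 * x0)); lra.
have lD1 := ln3_gt1 D3.
have llD : 0 < ln (ln D) by apply: ln_gt0.
have llD4 : ln (ln D) <= ln (ln N) / 4.
  have : ln (ln D) <= ln (Rpower (ln N) (1 / 4)) by apply: ln_le_mono; lra.
  by rewrite /Rpower ln_exp; lra.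
set l := ln (ln N) in ll llD4 *.
have L : ln (ln N / ln D) = l - ln (ln D) by apply: ln_div; lra.
rewrite L in Hr; set L0 := l - ln (ln D) in L Hr.
have L00 : 0 < L0 by rewrite /L0; lra.
pose x := Rpower L0 (1 / 3).
have xE : x * x * x = L0.
  rewrite /x -!Rpower_plus; have -> : 1 / 3 + 1 / 3 + 1 / 3 = 1 by lra.
  exact: Rpower_1.
have xE2 : Rpower L0 (2 / 3) = x * x.
  by rewrite /x -Rpower_plus; congr Rpower; lra.
have x00 : 0 < x by exact: exp_pos.
have xx0 : x0 <= x.
  apply: Rnot_lt_le => H.
  have : x * x * x < x0 * x0 * x0.
    have : x * x < x0 * x0 by nra.
    nra.
  rewrite xE /L0; lra.
rewrite xE2 in Hr.
have Hr' : - (x * x) <= INR r - x * x * x <= x * x.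
  by rewrite xE; move: Hr; rewrite /Rabs; case: Rcase_abs; lra.
have x4 : 10000 <= x * x by nra.
have x6 : 100 * (x * x) <= x * x * x by nra.
have DN : D <= N.
  apply: Rnot_lt_le => H.
  have : ln (ln N) <= ln (ln D) by apply: ln_le_mono => //; apply: ln_le_mono; lra.
  rewrite -/l; lra.
have M := @mertens2 D N ltac:(lra) DN.
set P := bigop _ _ _ in M; rewrite -/l -/L0 -xE in M.
have r2 : (2 < r)%N by apply: INR_ltn; rewrite /=; lra.
have lN1 : 1000 <= ln N.
  by have := exp_ge1 (4 / 3 * (x0 * x0 * x0)); lra.
have rP : INR r.-1 <= INR r by apply: leq_INR; rewrite leq_pred.
exists x, P; split => //; split => //; try lra; first by rewrite -/l xE /L0; lra.
apply: card_lower => //; try lra; rewrite -/P; last by rewrite -/P; lra.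
  have l32 : ln 32 <= 4.
    have -> : 32 = 2 * 2 * 2 * 2 * 2 by lra.
    by rewrite !ln_mult; have := ln2_bounds; lra.
  have : 32 * ln D <= ln N; last by lra.
  apply: Rnot_lt_le => H.
  have : ln (ln N) < ln (32 * ln D) by apply: ln_increasing.
  rewrite ln_mult -/l; lra.
rewrite -/P; lra.
Qed.

Lemma setup_k N D r x P : setup N D r x P -> INR r.-1 = INR r - 1.
Proof. by move=> [] *; have -> : INR r = INR r.-1 + 1; [rewrite -S_INR prednK //; lia | lra]. Qed.

(** Since [|k - P| <= x ^ 2 + 18], the Gaussian loss is at most [2 * x] and [exp_term_lower] has an
    exponent close to [x ^ 3]. Half of [ln (ln N)] is at most [2 / 3 * x ^ 3]; the difference also
    pays for [sqrt k]. *)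
Lemma setup_exp_term N D r x P : setup N D r x P -> exp (ln (ln N) / 2) <= exp_term P r.-1.
Proof.
move=> S; have K := setup_k S; case: S => N0 D3 DN x1 L ll lN Hr r2 _ HP _.
have k0 : (0 < r.-1)%N by lia.
set k := r.-1 in K k0 *.
have x4 : 10000 <= x * x by nra.
have x6 : 100 * (x * x) <= x * x * x by nra.
have P0 : 0 < P by lra.
have H := exp_term_lower P0 k0.
have K0 := INR_gt0 k0.
have s0 : 0 < sqrt (INR k) by apply: sqrt_lt_R0.
have sk : sqrt (INR k) <= 2 * (x * x).
  rewrite -[X in _ <= X]sqrt_square; last lra.
  by apply: sqrt_le_1; nra.
have Q : (INR k - P) * (INR k - P) / P <= 2 * x.
  have Hd : -(x * x + 18) <= INR k - P <= x * x + 18 by lra.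
  have H1 : (INR k - P) * (INR k - P) <= (x * x + 18) * (x * x + 18) by nra.
  apply: (Rmult_le_reg_r P) => //.
  rewrite /Rdiv Rmult_assoc Rinv_l ?Rmult_1_r; last lra.
  have H2 : 2 * x * (x * x * x - 17) <= 2 * x * P by apply: Rmult_le_compat_l; lra.
  nra.
apply: (Rmult_le_reg_r (sqrt (INR k))) => //; apply: Rle_trans H.
apply: (Rle_trans _ (exp (ln (ln N) / 2) * exp (sqrt (INR k)))).
  apply: Rmult_le_compat_l; first by left; exact: exp_pos.
  by have := exp_ge1 (sqrt (INR k)); lra.
rewrite -exp_plus; apply: exp_le; nra.
Qed.

Lemma prob_cnt r N D (A : nat -> Prop) :
  prob_S r N D A = count_S N (fun n => in_S r N D n /\ A n) / INR (card_S r N D).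
Proof. by []. Qed.

Lemma prob_S_le1 r N D (A : nat -> Prop) : prob_S r N D A <= 1.
Proof.
rewrite prob_cnt.
have H : count_S N (fun n => in_S r N D n /\ A n) <= INR (card_S r N D).
  by apply: cnt_le => n [].
have H0 := cnt_ge0 N (fun n => in_S r N D n /\ A n).
case: (Req_dec (INR (card_S r N D)) 0) => E.
  by rewrite E; rewrite E in H; have -> : count_S N (fun n => in_S r N D n /\ A n) = 0 by [lra];
    rewrite /Rdiv; lra.
have c0 : 0 < INR (card_S r N D) by lra.
apply: (Rmult_le_reg_r (INR (card_S r N D))) => //.
by rewrite /Rdiv Rmult_assoc Rinv_l; lra.
Qed.

Lemma prob_S_or r N D (A B A' : nat -> Prop) :
  (forall n, in_S r N D n -> A n -> B n \/ A' n) -> prob_S r N D A <= prob_S r N D B +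
    prob_S r N D A'.
Proof.
move=> H; rewrite !prob_cnt /Rdiv -Rmult_plus_distr_r; apply: Rmult_le_compat_r.
  have := pos_INR (card_S r N D); case=> [c|<-]; first by left; apply: Rinv_0_lt_compat.
  by rewrite Rinv_0; lra.
apply: Rle_trans (cnt_or _ _ _); apply: cnt_le => n [HS HA].
by case: (H n HS HA) => ?; [left|right].
Qed.

Lemma prob_le_cnt N D r x P (A : nat -> Prop) c : setup N D r x P ->
  count_S N (fun n => in_S r N D n /\ A n) <= c ->
  prob_S r N D A <= exp 100 * (c * ln N / (N * exp_term P r.-1)).
Proof.
move=> S H; have PW := setup_exp_term S; case: S => N0 D3 DN x1 L ll lN Hr r2 _ HP Hc.
have p0 : 0 < exp_term P r.-1 by have := exp_pos (ln (ln N) / 2); lra.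
have e0 := exp_pos 100.
have E : exp (-100) = / exp 100 by rewrite -exp_Ropp; congr exp; lra.
rewrite E in Hc.
have q0 : 0 < N / ln N by apply: Rdiv_lt_0_compat; lra.
have d0 : 0 < / exp 100 * (N / ln N) * exp_term P r.-1.
  by do 2?apply: Rmult_lt_0_compat => //; apply: Rinv_0_lt_compat.
rewrite prob_cnt.
have -> : exp 100 * (c * ln N / (N * exp_term P r.-1)) =
  c / (/ exp 100 * (N / ln N) * exp_term P r.-1).
  by field; repeat split; lra.
apply: Rmult_le_compat => //; first exact: cnt_ge0.
  by left; apply: Rinv_0_lt_compat; lra.
by apply: Rinv_le_contravar.
Qed.

(** The transfer to the model: [A] concerns [n], and [B] the primes of [n / p]. It suffices that
    half of [ln n] comes from admissible [p] when [n >= sqrt N]; the at most [sqrt N] smaller [n]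
    give the term [/ ln N]. *)
Lemma prob_upper N D r x P (A : nat -> Prop) (B : seq nat -> bool) : setup N D r x P ->
  (forall n, in_S r N D n -> A n -> sqrt N <= INR n ->
     ln N / 4 <= \rsum_(p <- primes n) (ind (B (rem p (primes n))) * ln (INR p))) ->
  prob_S r N D A <= exp 110 * (wsum recip (primes_in D N) (fun S =>
    ind (size S == r.-1) * ind (B S)) / exp_term P r.-1
     + / ln N).
Proof.
move=> S H; have PW := setup_exp_term S; have N0 := s_N S; have lN := s_lN S.
have p0 : 0 < exp_term P r.-1 by have := exp_pos (ln (ln N) / 2); lra.
have p1 : 1 <= exp_term P r.-1.
  have l1 : 0 <= ln (ln N) by apply: ln_ge0; lra.
  by have := exp_ge1 (ln (ln N) / 2); lra.
have sN0 : 0 < sqrt N by apply: sqrt_lt_R0.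
set E := wsum _ _ _.
have E0 : 0 <= E.
  apply: wsum_ge0 => [p|T _]; first exact: inv_ge0.
  by apply: Rmult_le_pos; exact: ind_ge0.
have C1 := @count_upper r N D (fun n => A n /\ sqrt N <= INR n) B (ln N / 4) N0
   (fun n HS HA => H n HS (proj1 HA) (proj2 HA)).
rewrite -/E in C1.
have C2 : count_S N (fun n => in_S r N D n /\ A n) <= 6 * N * E / ln N + sqrt N.
  apply: (Rle_trans _ (count_S N (fun n => in_S r N D n /\ A n /\ sqrt N <= INR n)
    + count_S N (fun n => in_S r N D n /\ INR n < sqrt N))).
    apply: Rle_trans (cnt_or _ _ _); apply: cnt_le => n [HS HA].
    by case: (Rle_lt_dec (sqrt N) (INR n)) => ?; [left | right].
  apply: Rplus_le_compat; last by apply: cnt_small => // n [[? _] ?].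
  apply: (Rmult_le_reg_l (ln N / 4)); first lra.
  apply: Rle_trans C1 _; have -> : ln N / 4 * (6 * N * E / ln N) = 3 / 2 * N * E by field; lra.
  lra.
apply: Rle_trans (prob_le_cnt S C2) _.
have X : sqrt N * ln N / (N * exp_term P r.-1) <= 8 * / ln N.
  have EN : N = sqrt N * sqrt N by rewrite sqrt_sqrt; lra.
  have B1 : ln N * ln N <= 8 * sqrt N.
    have -> : sqrt N = exp (ln N / 4) * exp (ln N / 4).
      by rewrite -exp_plus -Rpower_sqrt // /Rpower; congr exp; field.
    have := exp_ge1 (ln N / 8); have -> : exp (ln N / 4) = exp (ln N / 8) * exp (ln N / 8).
      by rewrite -exp_plus; congr exp; field.
    set a := exp _ => H1.
    have H2 : ln N / 8 * (ln N / 8) <= a * a by nra.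
    have H3 : 125 <= ln N / 8 by lra.
    have H5 : 15625 <= ln N / 8 * (ln N / 8) by nra.
    have H4 : ln N / 8 * (ln N / 8) * 15625 <= a * a * (a * a) by apply: Rmult_le_compat; lra.
    lra.
  apply: (Rmult_le_reg_r (sqrt N * ln N)); first nra.
  have -> : 8 * / ln N * (sqrt N * ln N) = 8 * sqrt N by field; lra.
  apply: Rle_trans B1.
  have -> : sqrt N * ln N / (N * exp_term P r.-1) * (sqrt N * ln N) =
    ln N * ln N * / exp_term P r.-1.
    have -> : N * exp_term P r.-1 = sqrt N * sqrt N * exp_term P r.-1 by rewrite -EN.
    by field; split; lra.
  rewrite -[X in _ <= X]Rmult_1_r; apply: Rmult_le_compat_l; first nra.
  by rewrite -Rinv_1; apply: Rinv_le_contravar; lra.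
have -> : exp 110 = exp 100 * exp 10 by rewrite -exp_plus; congr exp; lra.
rewrite (Rmult_assoc (exp 100)); apply: Rmult_le_compat_l; first by left; exact: exp_pos.
have -> : (6 * N * E / ln N + sqrt N) * ln N / (N * exp_term P r.-1) =
   6 * (E / exp_term P r.-1) + sqrt N * ln N / (N * exp_term P r.-1) by field; repeat split; lra.
have e10 := exp_ge1 10.
have q0 : 0 <= E / exp_term P r.-1 by apply: Rle_mult_inv_pos.
have i0 : 0 < / ln N by apply: Rinv_0_lt_compat; lra.
nra.
Qed.

Lemma rsum_pick (s : seq nat) (q : nat) (f : nat -> R) : uniq s -> q \in s ->
  \rsum_(p <- s) (if p == q then f p else 0) = f q.
Proof.
move=> us qs; rewrite -rsum_filter filter_pred1_uniq //.
by rewrite rsum_cons rsum_nil Rplus_0_r.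
Qed.

Lemma pairsum_ge0 (g : nat -> nat -> R) (s : seq nat) : (forall p q, 0 <= g p q) ->
  0 <= pairsum g s.
Proof.
move=> g0; elim: s => [|p s IH] /=; first lra.
by apply: Rplus_le_le_0_compat => //; apply: rsum_ge0.
Qed.

Lemma pairsum_mem (g : nat -> nat -> R) (s : seq nat) (q q' : nat) : (forall p q, 0 <= g p q) ->
  sorted ltn s -> q \in s -> q' \in s -> (q < q')%N -> g q q' <= pairsum g s.
Proof.
move=> g0; elim: s => [//|p s IH] srt; rewrite !in_cons /= => Hq Hq' qq.
have S0 := rsum_ge0 (s := s) (fun i _ => g0 p i).
have P0 := pairsum_ge0 s g0.
have ps : forall a, a \in s -> (p < a)%N.
  by move: srt; rewrite /= path_sortedE; [move=> /andP[/allP H _] a /H | exact: ltn_trans].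
case/orP: Hq => [/eqP Eq|Hq].
  have Hs : q' \in s by case/orP: Hq' => // /eqP E; move: qq; rewrite Eq E ltnn.
  have := rsum_mem_le (g := g p) Hs (fun i _ => g0 p i).
  by rewrite Eq => H; apply: Rle_trans H _; rewrite -[X in X <= _]Rplus_0_l;
    apply: Rplus_le_compat_r.
have Hs : q' \in s by case/orP: Hq' => // /eqP E; move: qq (ps _ Hq); rewrite E; lia.
apply: Rle_trans (IH (path_sorted srt) Hq Hs qq) _.
by rewrite -[X in X <= _]Rplus_0_r; apply: Rplus_le_compat_l.
Qed.

Lemma pairsum_le (h : nat -> nat -> R) (L s : seq nat) : (forall p q, 0 <= h p q) ->
  sorted ltn s -> {subset s <= L} ->
  pairsum h s <= \rsum_(p <- s) \rsum_(q <- L) (if (p < q)%N then h p q else 0).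
Proof.
move=> h0; elim: s => [|p s IH] srt sL; first by rewrite rsum_nil /=; lra.
have ps : forall a, a \in s -> (p < a)%N.
  by move: srt; rewrite /= path_sortedE; [move=> /andP[/allP H _] a /H | exact: ltn_trans].
have us : uniq (p :: s) by apply: (sorted_uniq ltn_trans ltnn).
rewrite rsum_cons /= Rplus_comm; apply: Rplus_le_compat.
  rewrite (rsum_eq (g := fun q => if (p < q)%N then h p q else 0)); last by move=> q /ps ->.
  apply: rsum_le_sub.
  - by case/andP: us.
  - by move=> q Hq; apply: sL; rewrite in_cons Hq orbT.
  - by move=> q _; case: ifP => _; [exact: h0 | lra].
apply: IH; first exact: path_sorted srt.
by move=> q Hq; apply: sL; rewrite in_cons Hq orbT.
Qed.

Lemma setup_kP N D r x P : setup N D r x P -> INR r.-1 <= 2 * P /\ 0 < P.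
Proof.
move=> S; have K := setup_k S; case: S => N0 D3 DN x1 L ll lN Hr r2 _ HP _.
have x6 : 100 * (x * x) <= x * x * x by nra.
have : 10000 <= x * x by nra.
by lra.
Qed.

Lemma exp_term_pred P k : 0 < P -> INR k.+1 <= 2 * P -> exp_term P k <= 2 * exp_term P k.+1.
Proof.
move=> P0 H; have E := exp_termS P k.
have := @exp_term_ge0 P k.+1 ltac:(lra) => g.
apply: (Rmult_le_reg_l P) => //; rewrite -E; nra.
Qed.

Lemma ln_in_S r N D n : in_S r N D n -> \rsum_(p <- primes n) ln (INR p) = ln (INR n).
Proof. by move=> [n0 [_ [sf _]]]; exact: sum_ln_primes. Qed.

Lemma ln_primes_ge0 n p : p \in primes n -> 0 <= ln (INR p).
Proof. by move=> /primes_gt0 /ge1_INR /ln_ge0. Qed.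

(** Deleting a prime other than the witnesses [q] and [q'] keeps the property, so at most
    [ln q + ln q'] of the weight [ln n] is lost. A single witness is the case [q = q']. *)
Lemma weight_without r N D n (B : seq nat -> bool) (q q' : nat) : in_S r N D n ->
  q \in primes n -> q' \in primes n ->
  (forall p, p \in primes n -> p != q -> p != q' -> B (rem p (primes n))) ->
  ln (INR n) - ln (INR q) - ln (INR q') <= \rsum_(p <- primes n)
    (ind (B (rem p (primes n))) * ln (INR p)).
Proof.
move=> HS Hq Hq' H; rewrite -(ln_in_S HS).
rewrite -(rsum_pick (fun p => ln (INR p)) (primes_uniq n) Hq) -(rsum_pick (fun p =>
  ln (INR p)) (primes_uniq n) Hq').
rewrite -!rsum_sub; apply: rsum_le => p Hp; have l0 := ln_primes_ge0 Hp.
have i0 := ind_ge0 (B (rem p (primes n))).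
case: (boolP (p == q)) => [_|pq].
  have i1 := Rmult_le_pos _ _ i0 l0; case: (p == q'); lra.
case: (boolP (p == q')) => [_|pq'].
  have i1 := Rmult_le_pos _ _ i0 l0; lra.
rewrite H //=; lra.
Qed.

Lemma ln_half_N N n : 0 < N -> sqrt N <= INR n -> ln N / 2 <= ln (INR n).
Proof.
move=> N0 H; rewrite -ln_sqrt //; apply: ln_le_mono => //; exact: sqrt_lt_R0.
Qed.

Lemma mem_rem_primes n p q : q \in primes n -> p != q -> q \in rem p (primes n).
Proof. by move=> Hq pq; rewrite mem_rem_uniq ?primes_uniq // inE eq_sym pq. Qed.

(** * Comfortable spacing *)

(** A witness below [N ^ (1 / 16)] leaves enough weight to the other primes. The factor 12 is 6 from
    [short_primes_in] times 2 for lowering the index of [exp_term] by one. *)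
Lemma comfort_single N D r x P D1 : setup N D r x P -> 3 < D1 ->
  prob_S r N D (fun n => exists q, [/\ q \in primes n, D1 < INR q <= 2 * D1 & INR q <=
    exp (ln N / 16)])
  <= exp 110 * (12 / ln D1 + / ln N).
Proof.
move=> S D13; have [kP P0] := setup_kP S.
have N0 := s_N S; have lN := s_lN S; have PE := s_PE S; have r2 := s_r2 S.
have PW : 0 < exp_term P r.-1 by exact: exp_term_gt0.
pose c q := dec (D1 < INR q <= 2 * D1).
apply: Rle_trans (prob_upper (B := has c) S _) _.
  move=> n HS [q [Hq qD qV]] Hn.
  have H1 := ln_half_N N0 Hn.
  have lq : ln (INR q) <= ln N / 16.
    by rewrite -(ln_exp (ln N / 16)); apply: ln_le_mono => //; lra.
  have W := @weight_without r N D n (has c) q q HS Hq Hq.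
  have : ln (INR n) - ln (INR q) - ln (INR q) <=
    \rsum_(p <- primes n) (ind (has c (rem p (primes n))) * ln (INR p)).
    apply: W => p Hp pq _; apply/hasP; exists q; last exact/decP.
    exact: mem_rem_primes.
  lra.
apply: Rmult_le_compat_l; first by left; exact: exp_pos.
apply: Rplus_le_compat_r.
apply: (Rmult_le_reg_r (exp_term P r.-1)) => //; rewrite {1}/Rdiv Rmult_assoc Rinv_l ?Rmult_1_r;
  last lra.
have w0 : forall p : nat, p \in primes_in D N -> 0 <= / INR p by move=> p; exact: inv_ge0.
have [j Ej] : exists j, r.-1 = j.+1 by exists r.-2; lia.
rewrite Ej in kP PW *.
have g0 : forall p : nat, p \in primes_in D N -> 0 <= ind (c p) by move=> p _; exact: ind_ge0.
apply: (Rle_trans _ (wsum recip (primes_in D N) (fun S =>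
  ind (size S == j.+1) * \rsum_(p <- S) ind (c p)))).
  apply: wsum_le => // T HT; apply: Rmult_le_compat_l; first exact: ind_ge0.
  case: hasP => [[q Hq cq]|_] /=.
    have : 1 <= ind (c q) by rewrite cq /=; lra.
    by move=> H; apply: Rle_trans H _; apply: (rsum_mem_le (g := fun p => ind (c p))) => // i _;
      exact: ind_ge0.
  by apply: rsum_ge0 => i _; exact: ind_ge0.
apply: Rle_trans (wsum_marked j w0 g0) _.
have e1 : elem_sym recip (primes_in D N) j <= exp_term P j by rewrite PE; exact: elem_sym_le.
have e0 : 0 <= elem_sym recip (primes_in D N) j by exact: elem_sym_ge0.
have pp := exp_term_pred P0 kP.
have sm : \rsum_(p <- primes_in D N) (/ INR p * ind (c p)) <= 6 / ln D1.
  apply: Rle_trans (short_primes_in (x := D1) ltac:(lra)).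
  rewrite (rsum_eq (g := fun p => if c p then / INR p else 0)); last by move=> p _; rewrite /ind;
    case: (c p); lra.
  rewrite -rsum_filter; apply: rsum_le_sub; first by rewrite filter_uniq ?primes_in_uniq.
    move=> p; rewrite mem_filter => /andP[/decP H /primes_inP[pp' _]]; apply/primes_inP; split =>
      //; lra.
  by move=> p; exact: inv_ge0.
have l1 : 0 < / ln D1 by apply: Rinv_0_lt_compat; have := ln3_gt1 D13; lra.
apply: (Rle_trans _ (6 / ln D1 * (2 * exp_term P j.+1))).
  apply: Rmult_le_compat => //; [by apply: rsum_ge0 => p Hp; apply: Rmult_le_pos;
    [exact: w0 | exact: ind_ge0] | lra].
by right; rewrite /Rdiv; ring.
Qed.

(** Here [624 = 156 * 4]: the bound for close pairs, and the index of [exp_term] lowered twice. *)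
Lemma comfort_pair N D r x P D1 : setup N D r x P -> 3 < D1 ->
  prob_S r N D (fun n => exists q q', [/\ q \in primes n, q' \in primes n, (q < q')%N,
     D1 < INR q & INR q <= exp (ln N / 16) /\ INR q' <= 2 * INR q])
  <= exp 110 * (624 / ln D1 + / ln N).
Proof.
move=> S D13; have [kP P0] := setup_kP S.
have N0 := s_N S; have lN := s_lN S; have PE := s_PE S; have r2 := s_r2 S.
have PW : 0 < exp_term P r.-1 by exact: exp_term_gt0.
pose g p q := ind (dec (D1 < INR p /\ INR q <= 2 * INR p)).
have g0 : forall p q, 0 <= g p q by move=> p q; exact: ind_ge0.
apply: Rle_trans (prob_upper (B := fun T => dec (1 <= pairsum g T)) S _) _.
  move=> n HS [q [q' [Hq Hq' qq qD [qV qq2]]]] Hn.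
  have H1 := ln_half_N N0 Hn.
  have q0 : 0 < INR q by lra.
  have lq : ln (INR q) <= ln N / 16.
    by rewrite -(ln_exp (ln N / 16)); apply: ln_le_mono => //; lra.
  have lq' : ln (INR q') <= ln N / 16 + 1.
    have : ln (INR q') <= ln (2 * INR q).
      by apply: ln_le_mono => //; have := ltn_INR qq; lra.
    by rewrite ln_mult; have := ln2_bounds; lra.
  have W := @weight_without r N D n (fun T => dec (1 <= pairsum g T)) q q' HS Hq Hq'.
  have : ln (INR n) - ln (INR q) - ln (INR q') <=
    \rsum_(p <- primes n) (ind (dec (1 <= pairsum g (rem p (primes n)))) * ln (INR p)).
    apply: W => p Hp pq pq'; apply/decP.
    have -> : 1 = g q q' by rewrite /g; case: decP => //= H; case: H.
    apply: pairsum_mem => //; last by [exact: mem_rem_primes]; last exact: mem_rem_primes.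
    by apply: subseq_sorted (rem_subseq _ _) (sorted_primes _); exact: ltn_trans.
  lra.
apply: Rmult_le_compat_l; first by left; exact: exp_pos.
apply: Rplus_le_compat_r.
apply: (Rmult_le_reg_r (exp_term P r.-1)) => //; rewrite {1}/Rdiv Rmult_assoc Rinv_l ?Rmult_1_r;
  last lra.
have w0 : forall p : nat, p \in primes_in D N -> 0 <= / INR p by move=> p; exact: inv_ge0.
have [j Ej] : exists j, r.-1 = j.+2 by exists r.-1.-2; lia.
rewrite Ej in kP PW *.
apply: (Rle_trans _ (wsum recip (primes_in D N) (fun S => ind (size S == j.+2) * pairsum g S))).
  apply: wsum_le => // T HT; apply: Rmult_le_compat_l; first exact: ind_ge0.
  by case: decP => [//|_] /=; exact: pairsum_ge0.
apply: Rle_trans (wsum_marked2 j w0 (fun p q _ _ => g0 p q)) _.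
have e1 : elem_sym recip (primes_in D N) j <= exp_term P j by rewrite PE; exact: elem_sym_le.
have e0 : 0 <= elem_sym recip (primes_in D N) j by exact: elem_sym_ge0.
have pp := exp_term_pred P0 kP.
have kP' : INR j.+1 <= 2 * P by rewrite S_INR in kP; lra.
have pp' := exp_term_pred P0 kP'.
have I0 p : 0 <= / INR p.
  case: p => [|p]; first by rewrite /= Rinv_0; lra.
  by left; apply: Rinv_0_lt_compat; apply: INR_gt0.
have h0 p q : 0 <= / INR p * (/ INR q * g p q).
  by do 2?apply: Rmult_le_pos.
have sm : pairsum (fun p q => / INR p * (/ INR q * g p q)) (primes_in D N) <= 156 / ln D1.
  apply: Rle_trans (close_pairs_primes_in N (x := D1) ltac:(lra)).
  apply: Rle_trans (pairsum_le (L := primes_in D N) h0 (primes_in_sorted _ _) _) _; first by [].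
  pose b p := if dec (D1 <= INR p) then / INR p * \rsum_(q <- primes_in (INR p) (4 * INR p)) / INR
    q else 0.
  apply: (Rle_trans _ (\rsum_(p <- primes_in D N) b p)).
    apply: rsum_le => p /primes_inP[prp [pD pN]]; rewrite /b; case: decP => H; last first.
      right; rewrite (rsum_eq (g := fun=> 0)) ?rsum0 // => q _; case: ifP => // _.
      by rewrite /g; case: decP => /= [[? _]|_]; [lra | ring].
    rewrite -rsum_mull.
    rewrite (rsum_eq (g := fun q => if (p < q)%N && dec (D1 < INR p /\ INR q <=
      2 * INR p) then / INR p * / INR q else 0)).
      rewrite -rsum_filter; apply: rsum_le_sub; first by rewrite filter_uniq ?primes_in_uniq.
        move=> q; rewrite mem_filter => /andP[/andP[H1 /decP[_ H2]] /primes_inP[prq [H3 H4]]].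
        by apply/primes_inP; split => //; have := ltn_INR H1; lra.
      by move=> q _; apply: Rmult_le_pos; exact: I0.
    move=> q _; case: (p < q)%N => //=; rewrite /g; case: decP => /= _; ring.
  rewrite /b -rsum_filter; apply: rsum_le_sub; first by rewrite filter_uniq ?primes_in_uniq.
    by move=> q; rewrite mem_filter => /andP[/decP H /primes_inP[? ?]]; apply/primes_inP; split =>
      //; lra.
  by move=> q _; apply: Rmult_le_pos; [exact: I0 | apply: rsum_ge0 => i _; exact: I0].
have l1 : 0 < / ln D1 by apply: Rinv_0_lt_compat; have := ln3_gt1 D13; lra.
apply: (Rle_trans _ (156 / ln D1 * (4 * exp_term P j.+2))).
  apply: Rmult_le_compat => //; [|lra].
  exact: pairsum_ge0.
by right; rewrite /Rdiv; ring.
Qed.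

(** Large witnesses may carry nearly all of [ln n], so no deletion argument applies. Multiples of
    the witnesses are counted instead: there are [O(N / ln N)] of them, and dividing by the lower
    bound for [card_S] leaves [O(1 / exp_term P r.-1)], which is [O((ln N) ^ (- 1 / 2))]. *)
Lemma comfort_large N D r x P D1 : setup N D r x P -> 3 < D1 ->
  prob_S r N D (fun n => (exists q, [/\ q \in primes n, D1 < INR q <=
    2 * D1 & exp (ln N / 16) < INR q])
    \/ (exists q q', [/\ q \in primes n, q' \in primes n, (q < q')%N,
     exp (ln N / 16) < INR q & INR q' <= 2 * INR q]))
  <= exp 110 * Rpower (ln N) (- (1 / 2)).
Proof.
move=> S D13; have PW := setup_exp_term S.
have N0 := s_N S; have lN := s_lN S.
set V := exp (ln N / 16); have lV : ln V = ln N / 16 by rewrite /V ln_exp.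
have V3 : 3 <= V by have := exp_ge1 (ln N / 16); rewrite -/V; lra.
have I0 p : 0 <= / INR p.
  case: p => [|p]; first by rewrite /= Rinv_0; lra.
  by left; apply: Rinv_0_lt_compat; apply: INR_gt0.
have C1 : count_S N (fun n => in_S r N D n /\ exists q, [/\ q \in primes n, D1 < INR q <=
  2 * D1 & V < INR q])
  <= N * (96 / ln N).
  pose m := Rmax D1 V.
  apply: Rle_trans (cnt_exists_dvd (s := primes_in m (4 * m)) (d := id) N0 _ _) _.
  - by move=> p /primes_in_prime /prime_gt0.
  - move=> n [[n0 [nN _]] [q [Hq HD HV]]]; split => //.
    have := Hq; rewrite mem_primes => /and3P[pq _ dq]; exists q => //.
    apply/primes_inP; split => //; rewrite /m; split; first by apply: Rmax_lub; lra.
    by have := Rmax_l D1 V; lra.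
  apply: Rmult_le_compat_l; first lra.
  have m3 : V <= m by exact: Rmax_r.
  apply: Rle_trans (@short_primes_in m ltac:(lra)) _.
  have -> : 96 / ln N = 6 / ln V by rewrite lV; field; lra.
  apply: Rmult_le_compat_l; first lra.
  by apply: Rinv_le_contravar; [rewrite lV; lra | apply: ln_le_mono; lra].
have C2 : count_S N (fun n => in_S r N D n /\ exists q q',
  [/\ q \in primes n, q' \in primes n, (q < q')%N,
     V < INR q & INR q' <= 2 * INR q]) <= N * (2496 / ln N).
  pose s := [seq (q, q') | q <- primes_in V N, q' <- primes_in (INR q) (4 * INR q)].
  apply: Rle_trans (cnt_exists_dvd (s := s) (d := fun t => (t.1 * t.2)%N) N0 _ _) _.
  - move=> t /allpairsPdep [q [q' [/primes_in_prime /prime_gt0 a /primes_in_prime /prime_gt0 b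
    ->]]] /=; by rewrite muln_gt0 a b.
  - move=> n [[n0 [nN _]] [q [q' [Hq Hq' qq HV Hle]]]]; split => //.
    have := Hq; rewrite mem_primes => /and3P[pq _ dq].
    have := Hq'; rewrite mem_primes => /and3P[pq' _ dq'].
    exists (q, q') => /=.
      apply/allpairsPdep; exists q, q'; split => //; apply/primes_inP; split => //.
        split; first lra; apply: Rle_lt_trans nN; apply: leq_INR; exact: dvdn_leq.
      by have := ltn_INR qq; lra.
    rewrite Gauss_dvd ?dq //.
    by rewrite prime_coprime // dvdn_prime2 // neq_ltn qq.
  apply: Rmult_le_compat_l; first lra.
  rewrite big_allpairs_dep /=.
  apply: Rle_trans (_ : 156 / ln V <= _); last by right; rewrite lV; field; lra.
  apply: Rle_trans (close_pairs_primes_in N V3); right; apply: rsum_eq => q _.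
  by rewrite -rsum_mull; apply: rsum_eq => q' _; rewrite mulnE_INR Rinv_mult.
have C : count_S N (fun n => in_S r N D n /\
  ((exists q, [/\ q \in primes n, D1 < INR q <= 2 * D1 & V < INR q])
    \/ (exists q q', [/\ q \in primes n, q' \in primes n, (q < q')%N, V < INR q & INR q' <=
      2 * INR q])))
   <= N * (2592 / ln N).
  apply: (Rle_trans _ (N * (96 / ln N) + N * (2496 / ln N))); last by right; field; lra.
  apply: Rle_trans (Rplus_le_compat _ _ _ _ C1 C2); apply: Rle_trans (cnt_or _ _ _).
  by apply: cnt_le => n [HS [H|H]]; [left|right].
apply: Rle_trans (prob_le_cnt S C) _.
have e0 := exp_pos (ln (ln N) / 2).
have -> : N * (2592 / ln N) * ln N / (N * exp_term P r.-1) = 2592 / exp_term P r.-1 by field;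
  repeat split; lra.
have -> : Rpower (ln N) (- (1 / 2)) = / exp (ln (ln N) / 2).
  by rewrite -exp_Ropp /Rpower; congr exp; field.
have -> : exp 110 = exp 100 * exp 10 by rewrite -exp_plus; congr exp; lra.
rewrite Rmult_assoc; apply: Rmult_le_compat_l; first by left; exact: exp_pos.
apply: Rmult_le_compat; [lra | by left; apply: Rinv_0_lt_compat;
  lra | | by apply: Rinv_le_contravar].
have -> : 10 = 5 + 5 by lra.
have -> : exp (5 + 5) = exp 2.5 * exp 2.5 * (exp 2.5 * exp 2.5) by rewrite -!exp_plus; congr exp;
  lra.
have H : 7.3 <= exp 2.5.
  have -> : exp 2.5 = exp (1 / 2) * exp (1 / 2) * (exp (1 / 2) * exp (1 / 2)) * exp (1 / 2).
    by rewrite -!exp_plus; congr exp; lra.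
  have := exp_ge1 (1 / 2); set a := exp _ => H1; have H2 : 2.25 <= a * a by nra.
  have H3 : 5.06 <= a * a * (a * a) by nra.
  nra.
have : 53 <= exp 2.5 * exp 2.5 by nra.
nra.
Qed.

Lemma not_comfortable r N D D1 n : in_S r N D n -> 3 < D1 -> ~ comfortably_spaced r D1 n ->
  (exists q, [/\ q \in primes n & D1 < INR q <= 2 * D1])
  \/ (exists q q', [/\ q \in primes n, q' \in primes n, (q < q')%N, D1 < INR q & INR q' <=
    2 * INR q]).
Proof.
move=> [n0 [_ [_ [sz _]]]] D13 H; apply: NNPP => K; apply: H => i i1 ir Di.
have Hi : pf n i \in primes n by apply: mem_nth; rewrite sz; lia.
have Hi1 : pf n i.+1 \in primes n by apply: mem_nth; rewrite sz; lia.
have lt : (pf n i < pf n i.+1)%N.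
  by apply: (sorted_ltn_nth ltn_trans); rewrite ?sorted_primes // ?inE ?sz; lia.
split; apply: Rnot_le_lt => H; apply: K.
  by left; exists (pf n i); split => //; lra.
by right; exists (pf n i), (pf n i.+1); split.
Qed.

Lemma comfortable_prob : exists C : R, 0 < C /\
     forall (N D : R) (r : nat) (D1 : R), hyps N D r -> D1 > 3 ->
       prob_S r N D (fun n => ~ comfortably_spaced r D1 n)
         <= C * (/ ln D1 + Rpower (ln N) (- (1/2))).
Proof.
have [N0 HN0] := @setup_ex 100 (Rle_refl _).
pose M := Rmax N0 31; have M31 : 31 <= M by exact: Rmax_r.
have lM : 1 < ln M by apply: ln3_gt1; lra.
pose C1 := exp 110 * 640; have e110 := exp_pos 110.
have RM : 0 < Rpower (ln M) (1 / 2) by exact: exp_pos.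
exists (C1 + Rpower (ln M) (1 / 2)); split; first by rewrite /C1; lra.
move=> N D r D1 Hh D13.
have N30 : N > 30 by case: Hh.
have lN : 1 < ln N by apply: ln3_gt1; lra.
have l1 : 0 < / ln D1 by apply: Rinv_0_lt_compat; have := ln3_gt1 D13; lra.
have R0 : 0 < Rpower (ln N) (- (1 / 2)) by exact: exp_pos.
(* For [N < N0] the probability is at most 1, and [N <= M] makes the part [(ln M) ^ (1 / 2)] of the
   constant sufficient. *)
case: (Rle_lt_dec N0 N) => HN; last first.
  apply: Rle_trans (prob_S_le1 _ _ _ _) _.
  have : 1 <= Rpower (ln M) (1 / 2) * Rpower (ln N) (- (1 / 2)).
    rewrite /Rpower -exp_plus -[X in X <= _]exp_0; apply: exp_le.
    have : ln (ln N) <= ln (ln M); last lra.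
    apply: ln_le_mono; first lra; apply: ln_le_mono; first lra.
    by have := Rmax_l N0 31; rewrite -/M; lra.
  have c1 : 0 < C1 by rewrite /C1; lra.
  nra.
have [x [P [x0 S]]] := HN0 N D r Hh HN.
have A1 := comfort_single S D13; have A2 := comfort_pair S D13; have A3 := comfort_large S D13.
have iN : / ln N <= Rpower (ln N) (- (1 / 2)).
  have -> : / ln N = Rpower (ln N) (- 1) by rewrite Rpower_Ropp Rpower_1 //; lra.
  by apply: Rle_Rpower; lra.
set E1 := (fun n => exists q, _) in A1; set E2 := (fun n => exists q q', _) in A2; set E3 :=
  (fun n => _ \/ _) in A3.
have B : prob_S r N D (fun n => ~ comfortably_spaced r D1 n) <=
   prob_S r N D E1 + (prob_S r N D E2 + prob_S r N D E3).
  apply: Rle_trans (Rplus_le_compat_l _ _ _ (prob_S_or (A := fun n => E2 n \/ E3 n) _)); last by [].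
  apply: prob_S_or => n HS /(not_comfortable HS D13) [[q [Hq HD]]|[q [q' [Hq Hq' qq HD Hle]]]].
    case: (Rle_lt_dec (INR q) (exp (ln N / 16))) => Hv; first by left; exists q.
    by right; right; left; exists q.
  case: (Rle_lt_dec (INR q) (exp (ln N / 16))) => Hv; first by right; left; exists q, q'.
  by right; right; right; exists q, q'.
apply: Rle_trans B _.
apply: (Rle_trans _ (C1 * (/ ln D1 + Rpower (ln N) (- (1 / 2))))); last first.
  by apply: Rmult_le_compat_r; lra.
rewrite /C1 Rmult_assoc.
have : exp 110 * (12 / ln D1 + / ln N) + (exp 110 * (624 / ln D1 + / ln N) +
  exp 110 * Rpower (ln N) (- (1 / 2)))
  <= exp 110 * (640 * (/ ln D1 + Rpower (ln N) (- (1 / 2)))); last lra.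
rewrite -!Rmult_plus_distr_l; apply: Rmult_le_compat_l; first lra.
rewrite /Rdiv; lra.
Qed.

(** * Regularity *)

(** With [count_sorted_le] this turns bounds on the prime of a given index into bounds on the number
    of primes in an initial segment. The index is 0-based here, while [pf] is 1-based. *)
Lemma count_sorted_ge (a : pred nat) (s : seq nat) i : sorted ltn s -> (i < size s)%N ->
  (forall p q, p \in s -> q \in s -> (p <= q)%N -> a q -> a p) ->
  a (nth 0%N s i) -> (i < count a s)%N.
Proof.
move=> srt si H ai; rewrite -(cat_take_drop i.+1 s) count_cat.
apply: leq_trans (leq_addr _ _).
have -> : count a (take i.+1 s) = size (take i.+1 s).
  apply/eqP; rewrite -all_count; apply/allP => p Hp.
  have pi : (index p s <= i)%N by rewrite -ltnS; move: Hp; rewrite in_take_leq.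
  have ps : p \in s by exact: mem_take Hp.
  apply: (H _ (nth 0%N s i)) => //; first exact: mem_nth.
  rewrite -(nth_index 0%N ps); apply: (sorted_leq_nth leq_trans leqnn) => //.
  - by apply: sub_sorted srt => u v; exact: ltnW.
  - by rewrite inE index_mem.
by rewrite size_takel.
Qed.

Lemma count_sorted_le (a : pred nat) (s : seq nat) i : sorted ltn s ->
  (forall p q, p \in s -> q \in s -> (p <= q)%N -> a q -> a p) ->
  ~~ a (nth 0%N s i) -> (count a s <= i)%N.
Proof.
move=> srt H ai; rewrite -(cat_take_drop i s) count_cat.
have -> : count a (drop i s) = 0%N.
  apply/eqP; rewrite -leqn0 leqNgt -has_count; apply/hasPn => p Hp.
  apply/negP => ap; case/negP: ai.
  have ps : p \in s by exact: mem_drop Hp.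
  have si : (i < size s)%N by rewrite ltnNge; apply/negP => K; rewrite drop_oversize in Hp.
  have pi : (i <= index p s)%N.
    have us : uniq s := sorted_uniq ltn_trans ltnn srt.
    rewrite leqNgt -in_take // ?(ltnW si) //; apply/negP => Ht.
    move: us; rewrite -(cat_take_drop i s) cat_uniq => /and3P[_ /hasPn K _].
    by case/negP: (K p Hp).
  apply: (H _ p) => //; first exact: mem_nth.
  rewrite -(nth_index 0%N ps); apply: (sorted_leq_nth leq_trans leqnn) => //.
  - by apply: sub_sorted srt => u v; exact: ltnW.
  - by rewrite inE index_mem.
rewrite addn0; apply: leq_trans (count_size _ _) _; rewrite size_take; case: ltnP => //; lia.
Qed.

(** The scale on which, by Mertens' second theorem, the weights [1 / p] have density 1 up to a
    bounded error. *)
Definition level (D : R) (p : nat) : R := ln (ln (INR p)) - ln (ln D).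

Definition level_le D t : pred nat := fun p => dec (level D p <= t).
Definition level_lt D t : pred nat := fun p => dec (level D p < t).

Lemma level_mono D (p q : nat) : 3 < D -> D <= INR p -> (p <= q)%N -> level D p <= level D q.
Proof.
move=> D3 Dp pq; have := leq_INR pq => H; have l3 := ln3_gt1 D3.
have : ln D <= ln (INR p) by apply: ln_le_mono; lra.
move=> H1; have : ln (INR p) <= ln (INR q) by apply: ln_le_mono; lra.
move=> H2; have : ln (ln (INR p)) <= ln (ln (INR q)) by apply: ln_le_mono; lra.
rewrite /level; lra.
Qed.

Lemma level_ge0 D (p : nat) : 3 < D -> D <= INR p -> 0 <= level D p.
Proof.
move=> D3 Dp; have l3 := ln3_gt1 D3.
have : ln D <= ln (INR p) by apply: ln_le_mono; lra.
move=> H1; have : ln (ln D) <= ln (ln (INR p)) by apply: ln_le_mono; lra.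
rewrite /level; lra.
Qed.

(** The real number at level [t], inverse to [level D]. *)
Definition level_inv (D t : R) : R := exp (ln D * exp t).

Lemma lnln_level_inv D t : 3 < D -> ln (ln (level_inv D t)) = ln (ln D) + t.
Proof.
move=> D3; have l3 := ln3_gt1 D3; rewrite /level_inv ln_exp ln_mult ?ln_exp;
  [lra | lra | exact: exp_pos].
Qed.

Lemma level_inv0 D : 3 < D -> level_inv D 0 = D.
Proof. by move=> D3; rewrite /level_inv exp_0 Rmult_1_r exp_ln; lra. Qed.

Lemma level_inv_mono D s t : 3 < D -> s <= t -> level_inv D s <= level_inv D t.
Proof.
move=> D3 st; have l3 := ln3_gt1 D3; apply: exp_le; apply: Rmult_le_compat_l; first lra.
exact: exp_le.
Qed.

Lemma level_inv_ge D t : 3 < D -> 0 <= t -> D <= level_inv D t.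
Proof. by move=> D3 t0; rewrite -{1}(level_inv0 D3); apply: level_inv_mono. Qed.

Lemma lt_level_inv D t (p : nat) : 3 < D -> 1 < INR p -> (INR p < level_inv D t <-> level D p < t).
Proof.
move=> D3 p1; have l3 := ln3_gt1 D3; have lp := ln_gt0 p1.
have lX := lnln_level_inv t D3.
have lX0 : 0 < ln (level_inv D t) by rewrite /level_inv ln_exp; apply: Rmult_lt_0_compat;
  [lra | exact: exp_pos].
split=> H.
  have : ln (INR p) < ln (level_inv D t) by apply: ln_increasing; lra.
  move=> H2; have : ln (ln (INR p)) < ln (ln (level_inv D t)) by apply: ln_increasing.
  rewrite /level; lra.
apply: Rnot_le_lt => K.
have : ln (level_inv D t) <= ln (INR p) by apply: ln_le_mono => //; exact: exp_pos.
move=> H2; have : ln (ln (level_inv D t)) <= ln (ln (INR p)) by apply: ln_le_mono.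
rewrite /level in H; lra.
Qed.

Lemma mass_level_inv D s t : 3 < D -> 0 <= s <= t ->
  t - s - 17 <= \rsum_(p <- primes_in (level_inv D s) (level_inv D t)) / INR p <= t - s + 17.
Proof.
move=> D3 st.
have H1 := @level_inv_ge D s D3 ltac:(lra).
have H2 := @level_inv_mono D s t D3 ltac:(lra).
have := @mertens2 (level_inv D s) (level_inv D t) ltac:(lra) H2.
by rewrite !lnln_level_inv //; lra.
Qed.

Lemma setup_lambda N D r x P : setup N D r x P ->
  0 < P /\ 1 - 2 / x <= INR r.-1 / P <= 1 + 2 / x.
Proof.
move=> S; have K := setup_k S; case: S => N0 D3 DN x1 L ll lN Hr r2 _ HP _.
have x4 : 10000 <= x * x by nra.
have x6 : 100 * (x * x) <= x * x * x by nra.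
have P0 : 0 < P by lra.
split => //.
have E : INR r.-1 / P = 1 + (INR r - 1 - P) / P by rewrite K; field; lra.
have B : -(2 / x) <= (INR r - 1 - P) / P <= 2 / x.
  have e : 2 / x * P = 2 * (P / x) by field; lra.
  have px : x * x - 1 <= P / x.
    apply: (Rmult_le_reg_r x); first lra.
    by have -> : P / x * x = P by [field; lra]; lra.
  split; apply: (Rmult_le_reg_r P) => //.
    have -> : (INR r - 1 - P) / P * P = INR r - 1 - P by field; lra.
    rewrite Ropp_mult_distr_l_reverse e; lra.
  have -> : (INR r - 1 - P) / P * P = INR r - 1 - P by field; lra.
  rewrite e; lra.
rewrite E; lra.
Qed.

(** [k / P] is the logarithmic derivative of [exp_term _ k] at [P]; the bound is [1 + t <= exp t]
    raised to the power [k]. *)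
Lemma exp_term_shift P Y k : 0 < P -> 0 <= P + Y ->
  exp_term (P + Y) k <= exp (Y * (INR k / P)) * exp_term P k.
Proof.
move=> P0 PY; rewrite (exp_term_ratio _ _ P0); apply: Rmult_le_compat_r;
  first by apply: exp_term_ge0; lra.
have -> : Y * (INR k / P) = INR k * (Y / P) by field; lra.
rewrite -pow_exp; apply: pow_incr; split.
  by apply: Rle_mult_inv_pos.
have -> : (P + Y) / P = 1 + Y / P by field; lra.
exact: exp_ge1.
Qed.

Lemma rem_count (a : pred nat) (s : seq nat) p : (count a s <= (count a (rem p s)).+1)%N.
Proof. rewrite count_rem; case: (_ && _) => /=; lia. Qed.
Lemma rem_count_le (a : pred nat) (s : seq nat) p : (count a (rem p s) <= count a s)%N.
Proof. by rewrite count_rem leq_subr. Qed.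

Lemma sum_all_ge N n (B : seq nat -> bool) r D : 0 < N -> 0 < ln N -> in_S r N D n ->
  sqrt N <= INR n ->
  (forall p, p \in primes n -> B (rem p (primes n))) ->
  ln N / 4 <= \rsum_(p <- primes n) (ind (B (rem p (primes n))) * ln (INR p)).
Proof.
move=> N0 lN HS Hn HB.
rewrite (rsum_eq (g := fun p => ln (INR p))); last by move=> p /HB -> /=; lra.
rewrite (ln_in_S HS); have := ln_half_N N0 Hn; lra.
Qed.

(** Deleting a prime may lower the count by one, which costs the factor [z]. In [t + 18], one unit
    closes the half-open interval at [t] and 17 is the error of Mertens' theorem. *)
Lemma tail_many N D r x P t z i : setup N D r x P -> 0 <= t -> 1 <= z ->
  prob_S r N D (fun n => (i <= count (level_le D t) (primes n))%N)
  <= exp 110 * (z * / z ^ i * exp ((z - 1) * ((t + 18) * (INR r.-1 / P))) + / ln N).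
Proof.
move=> S t0 z1; have [P0 [_ lam]] := setup_lambda S.
have N0 := s_N S; have lN := s_lN S; have PE := s_PE S; have D3 := s_D S.
set a := level_le D t.
have PW : 0 < exp_term P r.-1 by exact: exp_term_gt0.
apply: Rle_trans (prob_upper (B := fun T => (i <= (count a T).+1)%N) S _) _.
  move=> n HS Hi Hn; apply: (@sum_all_ge N n (fun T =>
    (i <= (count a T).+1)%N) r D N0 ltac:(lra) HS Hn).
  by move=> p Hp; apply: leq_trans Hi _; exact: rem_count.
apply: Rmult_le_compat_l; first by left; exact: exp_pos.
apply: Rplus_le_compat_r.
apply: (Rmult_le_reg_r (exp_term P r.-1)) => //; rewrite {1}/Rdiv Rmult_assoc Rinv_l ?Rmult_1_r;
  last lra.
have w0 : forall p : nat, p \in primes_in D N -> 0 <= / INR p by move=> p; exact: inv_ge0.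
have zi : 0 < z ^ i by apply: pow_lt; lra.
have c0 : 0 <= z * / z ^ i by apply: Rle_mult_inv_pos; lra.
apply: (Rle_trans _ (z * / z ^ i * wsum recip (primes_in D N) (fun S =>
  ind (size S == r.-1) * z ^ (count a S)))).
  rewrite -wsum_scal; apply: wsum_le => // T HT.
  have zc : 0 <= z ^ count a T by apply: pow_le; lra.
  case: (size T == r.-1) => /=; last by rewrite !Rmult_0_l Rmult_0_r; lra.
  rewrite !Rmult_1_l; case: leqP => /= H; last by apply: Rmult_le_pos.
  apply: (Rmult_le_reg_r (z ^ i)) => //.
  have -> : z * / z ^ i * z ^ count a T * z ^ i = z ^ (count a T).+1 by rewrite /=; field; lra.
  by rewrite Rmult_1_l; apply: Rle_pow => //; lia.
rewrite (Rmult_assoc _ (exp _)); apply: Rmult_le_compat_l => //.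
apply: Rle_trans (@wsum_pow_size recip (primes_in D N) a z r.-1 w0 ltac:(lra)) _.
have mass : 0 <= \rsum_(p <- filter a (primes_in D N)) / INR p <= t + 18.
  split; first by apply: rsum_ge0 => p; rewrite mem_filter => /andP[_]; exact: inv_ge0.
  have [_ M] := @mass_level_inv D 0 (t + 1) D3 ltac:(lra).
  rewrite level_inv0 // in M; apply: (Rle_trans _ (t + 1 - 0 + 17)); last lra.
  apply: Rle_trans M; apply: rsum_le_sub; first by rewrite filter_uniq ?primes_in_uniq.
    move=> p; rewrite mem_filter => /andP[/decP H /primes_inP[pp [Hp1 Hp2]]]; apply/primes_inP;
      split => //; split => //.
    by apply/lt_level_inv; lra.
  by move=> p; exact: inv_ge0.
rewrite -PE; set m := bigop _ _ _ in mass *.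
apply: Rle_trans (exp_term_shift _ P0 _) _; first nra.
apply: Rmult_le_compat_r; first lra.
apply: exp_le; rewrite Rmult_assoc; apply: Rmult_le_compat_l; first lra.
apply: Rmult_le_compat_r; last lra.
by apply: Rle_mult_inv_pos => //; exact: pos_INR.
Qed.

(** Deletion can only lower the count, so no factor is lost here. The bound [t <= x ^ 3] places
    level [t] below [N], so that all the expected primes are available. *)
Lemma tail_few N D r x P t z i : setup N D r x P -> 0 <= t <= x * x * x -> 0 < z <= 1 ->
  prob_S r N D (fun n => (count (level_lt D t) (primes n) <= i)%N)
  <= exp 110 * (/ z ^ i * exp ((z - 1) * ((t - 17) * (INR r.-1 / P))) + / ln N).
Proof.
move=> S t0 z1; have [P0 [_ lam]] := setup_lambda S.
have N0 := s_N S; have lN := s_lN S; have PE := s_PE S; have D3 := s_D S; have L := s_L S.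
set a := level_lt D t.
have PW : 0 < exp_term P r.-1 by exact: exp_term_gt0.
apply: Rle_trans (prob_upper (B := fun T => (count a T <= i)%N) S _) _.
  move=> n HS Hi Hn; apply: (@sum_all_ge N n (fun T => (count a T <= i)%N) r D N0 ltac:(lra) HS Hn).
  by move=> p Hp; apply: leq_trans Hi; exact: rem_count_le.
apply: Rmult_le_compat_l; first by left; exact: exp_pos.
apply: Rplus_le_compat_r.
apply: (Rmult_le_reg_r (exp_term P r.-1)) => //; rewrite {1}/Rdiv Rmult_assoc Rinv_l ?Rmult_1_r;
  last lra.
have w0 : forall p : nat, p \in primes_in D N -> 0 <= / INR p by move=> p; exact: inv_ge0.
have zi : 0 < z ^ i by apply: pow_lt; lra.
have c0 : 0 <= / z ^ i by left; apply: Rinv_0_lt_compat.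
apply: (Rle_trans _ (/ z ^ i * wsum recip (primes_in D N) (fun S =>
  ind (size S == r.-1) * z ^ (count a S)))).
  rewrite -wsum_scal; apply: wsum_le => // T HT.
  have zc : 0 <= z ^ count a T by apply: pow_le; lra.
  case: (size T == r.-1) => /=; last by rewrite !Rmult_0_l Rmult_0_r; lra.
  rewrite !Rmult_1_l; case: leqP => /= H; last by apply: Rmult_le_pos.
  apply: (Rmult_le_reg_r (z ^ i)) => //.
  have -> : / z ^ i * z ^ count a T * z ^ i = z ^ (count a T) by field; lra.
  rewrite Rmult_1_l -(subnKC H) pow_add -[X in _ <= X]Rmult_1_r.
  apply: Rmult_le_compat_l => //.
  rewrite -(pow1 (i - count a T)); apply: pow_incr; lra.
rewrite (Rmult_assoc _ (exp _)); apply: Rmult_le_compat_l => //.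
apply: Rle_trans (@wsum_pow_size recip (primes_in D N) a z r.-1 w0 ltac:(lra)) _.
have XN : level_inv D t <= N.
  have l3 := ln3_gt1 D3.
  rewrite -(exp_ln N) // /level_inv; apply: exp_le.
  rewrite -(exp_ln (ln N)); last lra.
  rewrite -{1}(exp_ln (ln D)); last lra.
  by rewrite -exp_plus; apply: exp_le; lra.
have mass : t - 17 <= \rsum_(p <- filter a (primes_in D N)) / INR p <= P.
  have [M _] := @mass_level_inv D 0 t D3 ltac:(lra).
  rewrite level_inv0 // in M; split.
    apply: (Rle_trans _ (t - 0 - 17)); first lra.
    apply: Rle_trans M _; apply: rsum_le_sub; first by exact: primes_in_uniq.
      move=> p /primes_inP[pp [H1 H2]]; rewrite mem_filter; apply/andP; split.
        by apply/decP/lt_level_inv; lra.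
      by apply/primes_inP; split => //; lra.
    by move=> p; rewrite mem_filter => /andP[_]; exact: inv_ge0.
  rewrite PE; apply: rsum_le_sub; first by rewrite filter_uniq ?primes_in_uniq.
    by move=> p; rewrite mem_filter => /andP[].
  by move=> p; exact: inv_ge0.
rewrite -PE; set m := bigop _ _ _ in mass *.
apply: Rle_trans (exp_term_shift _ P0 _) _; first nra.
apply: Rmult_le_compat_r; first lra.
have l0 : 0 <= INR r.-1 / P by apply: Rle_mult_inv_pos => //; exact: pos_INR.
apply: exp_le; rewrite Rmult_assoc.
have : (t - 17) * (INR r.-1 / P) <= m * (INR r.-1 / P) by apply: Rmult_le_compat_r; lra.
nra.
Qed.

Lemma inv_pow_exp z i : 0 < z -> / z ^ i = exp (- (INR i * ln z)).
Proof. by move=> z0; rewrite -{1}(exp_ln z) // pow_exp exp_Ropp. Qed.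

(* Chernoff bounds; with [y = max(i, C0)^(1/5)] and [c = C0^(1/5)] the allowed deviation in the
   definition of regularity is [c * y ^ 4]. *)
Lemma deviation_low N D r x P c y i : setup N D r x P -> 100 <= c <= y ->
  INR i = y * (y * y * y * y) -> INR i <= x * x * x ->
  prob_S r N D (fun n => (i <= count (level_le D (INR i - c * (y * y * y * y))) (primes n))%N)
  <= exp 110 * (2 * exp (- (c * c * (y * y * y)) / 24) + / ln N).
Proof.
move=> S cy iy ix; have [P0 [_ lam]] := setup_lambda S; have x1 := s_x S.
have y2 : 10000 <= y * y by nra.
have y4 : 10000 * (y * y) <= y * y * y * y by nra.
set q := y * y * y * y in iy y4 *.
(* The errors 18 and [2 / x] use up half of the deviation [c * q]; the remaining half is [e * i],
   and [z = 1 + e] is tuned to it. *)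
set e := c / (2 * y).
have e0 : 0 < e <= 1 / 2.
  split; first by apply: Rdiv_lt_0_compat; lra.
  apply: (Rmult_le_reg_r (2 * y)); first lra.
  by rewrite /e /Rdiv Rmult_assoc Rinv_l; lra.
have t0 : 0 <= INR i - c * q by rewrite iy; nra.
apply: Rle_trans (tail_many (z := 1 + e) i S t0 ltac:(lra)) _.
apply: Rmult_le_compat_l; first by left; exact: exp_pos.
apply: Rplus_le_compat_r.
rewrite inv_pow_exp; last lra.
rewrite Rmult_assoc -exp_plus; apply: Rmult_le_compat; [lra | by left; exact: exp_pos | lra |].
apply: exp_le.
have yx : y <= x.
  apply: Rnot_lt_le => H; have : x * x * x < y * y * y.
    by have : x * x < y * y by [nra]; nra.
  have : y * y * y <= y * q by nra.
  lra.
have mu : (INR i - c * q + 18) * (INR r.-1 / P) <= INR i - c * q / 2.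
  apply: (Rle_trans _ ((INR i - c * q + 18) * (1 + 2 / x))); first by apply: Rmult_le_compat_l; lra.
  have i0 : 0 < / x by apply: Rinv_0_lt_compat; lra.
  have i1 : / x <= / 100 by apply: Rinv_le_contravar; lra.
  have yx1 : y * / x <= 1.
    by rewrite -(Rinv_r x); [apply: Rmult_le_compat_r; lra | lra].
  have B : (INR i - c * q + 18) * (2 / x) <= 2 * q + 1.
    apply: (Rle_trans _ ((y * q + 18) * (2 / x))).
      apply: Rmult_le_compat_r; first by rewrite /Rdiv; lra.
      by rewrite iy; nra.
    have -> : (y * q + 18) * (2 / x) = 2 * q * (y * / x) + 36 * / x by rewrite /Rdiv; ring.
    nra.
  have : 6 * q <= c * q by nra.
  nra.
have lnz : e - e * e / 2 <= ln (1 + e).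
  apply: Rle_trans (@ln_ge_pade (1 + e) ltac:(lra)).
  apply: (Rmult_le_reg_r (2 + e)); first lra.
  have -> : (2 - 4 / (1 + e + 1)) * (2 + e) = 2 * e by field; lra.
  nra.
have i0 : 0 <= INR i by exact: pos_INR.
have M1 : INR i * (e - e * e / 2) <= INR i * ln (1 + e) by apply: Rmult_le_compat_l.
have -> : 1 + e - 1 = e by ring.
have M2 : e * ((INR i - c * q + 18) * (INR r.-1 / P)) <= e * (INR i - c * q / 2).
  by apply: Rmult_le_compat_l; lra.
have ee : e * q = c * (y * y * y) / 2 by rewrite /e /q; field; lra.
have e2 : INR i * (e * e) = c * c * (y * y * y) / 4 by rewrite iy /e /q; field; lra.
have e3 : e * (c * q) = c * c * (y * y * y) / 2 by rewrite /e /q; field; lra.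
have : 0 <= c * c * (y * y * y) by apply: Rmult_le_pos; nra.
lra.
Qed.

Lemma deviation_high N D r x P c y i : setup N D r x P -> 100 <= c <= y ->
  INR i <= y * (y * y * y * y) -> INR i + c * (y * y * y * y) <= x * x * x ->
  prob_S r N D (fun n => (count (level_lt D (INR i + c * (y * y * y * y))) (primes n) <= i)%N)
  <= exp 110 * (2 * exp (- (c * c * (y * y * y)) / 24) + / ln N).
Proof.
move=> S cy iy ix; have [P0 [lam _]] := setup_lambda S; have x1 := s_x S.
have y2 : 10000 <= y * y by nra.
have y4 : 10000 * (y * y) <= y * y * y * y by nra.
set q := y * y * y * y in iy y4 ix *.
(* Only [i <= y * q] is known. With this [e] the gain [e * c * q / 2 = c ^ 2 * y ^ 3 / 8] exceeds
   the second-order loss [4 / 3 * i * e ^ 2 <= c ^ 2 * y ^ 3 / 12] by [c ^ 2 * y ^ 3 / 24]. *)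
set e := c / (4 * y).
have e0 : 0 < e <= 1 / 4.
  split; first by apply: Rdiv_lt_0_compat; lra.
  apply: (Rmult_le_reg_r (4 * y)); first lra.
  by rewrite /e /Rdiv Rmult_assoc Rinv_l; lra.
have i0 : 0 <= INR i by exact: pos_INR.
have t0 : 0 <= INR i + c * q by nra.
apply: Rle_trans (tail_few (z := 1 - e) i S (conj t0 ix) ltac:(lra)) _.
apply: Rmult_le_compat_l; first by left; exact: exp_pos.
apply: Rplus_le_compat_r.
rewrite inv_pow_exp; last lra.
rewrite -exp_plus; apply: (Rle_trans _ (1 * exp (- (c * c * (y * y * y)) / 24))); last first.
  by apply: Rmult_le_compat_r; [left; exact: exp_pos | lra].
rewrite Rmult_1_l; apply: exp_le.
have mu : INR i + c * q / 2 <= (INR i + c * q - 17) * (INR r.-1 / P).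
  apply: (Rle_trans _ ((INR i + c * q - 17) * (1 - 2 / x))); last first.
    by apply: Rmult_le_compat_l; nra.
  have ix0 : 0 < / x by apply: Rinv_0_lt_compat; lra.
  have i1 : / x <= / 100 by apply: Rinv_le_contravar; lra.
  have B : (INR i + c * q) * (2 / x) <= 4 * q.
    case: (Rle_lt_dec y x) => yx.
      have yx1 : y * / x <= 1.
        by rewrite -(Rinv_r x); [apply: Rmult_le_compat_r; lra | lra].
      apply: (Rle_trans _ ((2 * (y * q)) * (2 / x))).
        apply: Rmult_le_compat_r; first by rewrite /Rdiv; lra.
        nra.
      have -> : 2 * (y * q) * (2 / x) = 4 * q * (y * / x) by rewrite /Rdiv; ring.
      nra.
    apply: (Rle_trans _ (x * x * x * (2 / x))).
      by apply: Rmult_le_compat_r; [rewrite /Rdiv; lra | lra].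
    have -> : x * x * x * (2 / x) = 2 * (x * x) by field; lra.
    have : x * x <= y * y by nra.
    lra.
  have : 10 * q <= c * q by nra.
  have -> : (INR i + c * q - 17) * (1 - 2 / x) = INR i + c * q - 17 - (INR i + c * q) * (2 / x) +
    34 * / x by rewrite /Rdiv; ring.
  lra.
have lnz : - (e + 4 / 3 * (e * e)) <= ln (1 - e).
  apply: Rle_trans (@ln_gt1sub (1 - e) ltac:(lra)).
  apply: (Rmult_le_reg_r (1 - e)); first lra.
  have -> : (1 - / (1 - e)) * (1 - e) = - e by field; lra.
  nra.
have M1 : INR i * - (e + 4 / 3 * (e * e)) <= INR i * ln (1 - e) by apply: Rmult_le_compat_l.
have -> : 1 - e - 1 = - e by ring.
have M2 : e * (INR i + c * q / 2) <= e * ((INR i + c * q - 17) * (INR r.-1 / P)).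
  by apply: Rmult_le_compat_l; lra.
have e2 : INR i * (e * e) <= c * c * (y * y * y) / 16.
  have -> : c * c * (y * y * y) / 16 = y * q * (e * e) by rewrite /e /q; field; lra.
  by apply: Rmult_le_compat_r => //; nra.
have e3 : e * (c * q) = c * c * (y * y * y) / 4 by rewrite /e /q; field; lra.
have : 0 <= c * c * (y * y * y) by apply: Rmult_le_pos; nra.
lra.
Qed.

Lemma prob_exists r N D (s : seq nat) (A : nat -> nat -> Prop) f :
  (forall i, i \in s -> prob_S r N D (A i) <= f i) ->
  prob_S r N D (fun n => exists2 i, i \in s & A i n) <= \rsum_(i <- s) f i.
Proof.
elim: s => [|a s IH] H.
  rewrite rsum_nil prob_cnt.
  have -> : count_S N (fun n => in_S r N D n /\ exists2 i, i \in [::] & A i n) = 0.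
    rewrite /count_S; have -> : [seq n <- cands N | dec (in_S r N D n /\ exists2 i,
      i \in [::] & A i n)] = [::].
      apply/eqP; rewrite -(negbK (_ == _)) -has_filter; apply/negP => /hasP[n _ /decP[_ [i]]].
      by rewrite in_nil.
    by [].
  by rewrite /Rdiv; lra.
rewrite rsum_cons.
apply: Rle_trans (prob_S_or (B := A a) (A' := fun n => exists2 i, i \in s & A i n) _) _.
  move=> n HS [i]; rewrite in_cons => /orP[/eqP -> ?|Hi HA]; [by left | by right; exists i].
apply: Rplus_le_compat; first by apply: H; rewrite mem_head.
by apply: IH => i Hi; apply: H; rewrite in_cons Hi orbT.
Qed.

Definition fifth a := Rpower a (1 / 5).
Lemma fifth_pow a : 0 < a -> let y := fifth a in
  [/\ 0 < y, a = y * (y * y * y * y) & Rpower a (4 / 5) = y * y * y * y].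
Proof.
move=> a0 y; split; first exact: exp_pos.
  rewrite /y /fifth -!Rpower_plus.
  have -> : 1 / 5 + (1 / 5 + 1 / 5 + 1 / 5 + 1 / 5) = 1 by lra.
  by rewrite Rpower_1.
by rewrite /y /fifth -!Rpower_plus; congr Rpower; lra.
Qed.

Lemma pf_props r N D n i : in_S r N D n -> 3 < D -> (1 <= i)%N -> (i <= r)%N ->
  [/\ pf n i \in primes n, D <= INR (pf n i) & INR (pf n i) < N].
Proof.
move=> [n0 [nN [sf [sz HD]]]] D3 i1 ir.
have Hi : pf n i \in primes n by apply: mem_nth; rewrite sz; lia.
split => //; first exact: HD.
move: Hi; rewrite mem_primes => /and3P[_ _ di].
by apply: Rle_lt_trans nN; apply: leq_INR; exact: dvdn_leq.
Qed.

Lemma down_level r N D n (t : R) : in_S r N D n -> 3 < D ->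
  (forall p q, p \in primes n -> q \in primes n -> (p <= q)%N -> level_le D t q ->
    level_le D t p) /\
  (forall p q, p \in primes n -> q \in primes n -> (p <= q)%N -> level_lt D t q -> level_lt D t p).
Proof.
move=> [n0 [nN [sf [sz HD]]]] D3; split=> p q Hp Hq pq /decP H; apply/decP;
  have := level_mono D3 (HD p Hp) pq; lra.
Qed.

Lemma not_regular r N D C0 n x P : setup N D r x P -> in_S r N D n -> 10000000000 <= C0 ->
  ~ regular r D C0 n ->
  exists2 i, i \in iota 1 r & INR i <= x * x * x /\
   let c := fifth C0 in let y := fifth (Rmax (INR i) C0) in
   (c <= y /\ INR i = y * (y * y * y * y) /\ (i <=
     count (level_le D (INR i - c * (y * y * y * y))) (primes n))%N)
   \/ (INR i + c * (y * y * y * y) <= x * x * x /\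
     (count (level_lt D (INR i + c * (y * y * y * y))) (primes n) <= i)%N).
Proof.
move=> S HS C0b H; have D3 := s_D S; have Hr := s_r S; have x1 := s_x S; have L := s_L S;
  have lN := s_lN S.
apply: NNPP => K; apply: H => i i1 ir.
have i0 : 1 <= INR i by apply: ge1_INR.
have x6 : 100 * (x * x) <= x * x * x by nra.
have r0 : INR i <= INR r by lra.
have Ir : (i <= r)%N := INR_leq r0.
have [Hp HD HN] := pf_props HS D3 i1 Ir.
have u0 := level_ge0 D3 HD.
have sz : size (primes n) = r by case: HS => _ [_ [_ []]].
have [dn1 dn2] := down_level (INR i) HS D3.
have [c0 cE _] := @fifth_pow C0 ltac:(lra).
have M0 : 0 < Rmax (INR i) C0 by apply: Rlt_le_trans (Rmax_r _ _); lra.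
have [y0 yE ->] := fifth_pow M0.
rewrite -/(fifth C0).
set c := fifth C0 in c0 cE K *; set y := fifth (Rmax (INR i) C0) in y0 yE K *.
set q := y * y * y * y in yE K *.
have q0 : 0 < q by rewrite /q; do 3?apply: Rmult_lt_0_compat.
have E : ln (ln (INR (pf n i))) - ln (ln D) - INR i = level D (pf n i) - INR i by rewrite /level;
  lra.
rewrite E; apply: Rabs_def1; apply: Rnot_le_lt => H; apply: K; exists i.
- by rewrite mem_iota; lia.
- split; first lra.
  cbv zeta; rewrite -/y -/c -/q; right; split.
    have lp : 0 < ln (INR (pf n i)) by apply: ln_gt0; lra.
    have : ln (INR (pf n i)) <= ln N by apply: ln_le_mono; lra.
    move=> /(ln_le_mono lp); rewrite /level in H; lra.
  have [_ dn] := down_level (INR i + c * q) HS D3.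
  apply: leq_trans (leq_subr 1 i); apply: count_sorted_le => //; first exact: sorted_primes.
  by apply/negP => /decP; rewrite -/(pf n i); lra.
- by rewrite mem_iota; lia.
split; first lra.
cbv zeta; rewrite -/y -/c -/q; left.
(* For [i < C0] the allowed deviation is [C0] itself, and the level, being nonnegative, cannot fall
   that far below [i]. *)
have ci : C0 <= INR i.
  apply: Rnot_lt_le => lt; have MC : Rmax (INR i) C0 = C0 by apply: Rmax_right; lra.
  have yc : y = c by rewrite /y MC.
  have : c * q = C0 by rewrite -yc -yE MC.
  lra.
have MI : Rmax (INR i) C0 = INR i by apply: Rmax_left.
split; first by rewrite /c /y /fifth MI; apply: Rle_Rpower_l; lra.
split; first by rewrite -yE MI.
have [dn _] := down_level (INR i - c * q) HS D3.
have := @count_sorted_ge (level_le D (INR i - c * q)) (primes n) (i - 1) (sorted_primes n)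
  ltac:(rewrite sz; lia) dn.
rewrite -/(pf n i) => X; have : (i - 1 < count (level_le D (INR i - c * q)) (primes n))%N;
  last by lia.
by apply: X; apply/decP; lra.
Qed.

Lemma inv_sq_sum r : \rsum_(i <- iota 1 r) (/ INR i * / INR i) <= 2.
Proof.
suff : \rsum_(i <- iota 1 r.+1) (/ INR i * / INR i) <= 2 - / INR r.+1.
  rewrite rsum_iotaS add1n; have := Rinv_0_lt_compat _ (@INR_gt0 r.+1 isT).
  set a := / _ => a0; have : 0 <= a * a by nra.
  lra.
elim: r => [|r IH]; first by rewrite rsum_cons rsum_nil /=; lra.
rewrite rsum_iotaS add1n.
have E := S_INR r.+1; have a0 := @INR_gt0 r.+1 isT; set a := INR r.+1 in IH E a0 *; set b :=
  INR r.+2 in E *.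
have : / b * / b <= / a - / b.
  have -> : / b * / b = (/ a - / b) - / a * / b * / b by rewrite E; field; lra.
  have : 0 < / a * / b * / b by do 2?apply: Rmult_lt_0_compat; apply: Rinv_0_lt_compat; lra.
  lra.
lra.
Qed.

(** As [i <= y ^ 5], this converts the Chernoff decay into a multiple of [i ^ (-2)], which can be
    summed over the indices. The proof uses [s ^ 4 <= exp (4 * s)] with [s = y ^ 3 / 192]. *)
Lemma exp_cube_decay y : 1 <= y -> exp (- (y * y * y) / 48) <=
  1400000000 * / (y * (y * y * y * y)) * / (y * (y * y * y * y)).
Proof.
move=> y1; set s := y * y * y / 192.
have s0 : 0 <= s by rewrite /s; nra.
have H : s * s * (s * s) <= exp (y * y * y / 48).
  have -> : exp (y * y * y / 48) = exp s * exp s * (exp s * exp s) by rewrite -!exp_plus;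
    congr exp; rewrite /s; lra.
  have e := exp_ge1 s; have : s * s <= exp s * exp s by nra.
  by move=> H; apply: Rmult_le_compat => //; nra.
have -> : exp (- (y * y * y) / 48) = / exp (y * y * y / 48) by rewrite -exp_Ropp; congr exp; lra.
set w := y * (y * y * y * y).
have w0 : 0 < w by rewrite /w; do 4?apply: Rmult_lt_0_compat; lra.
have K : w * w <= 1400000000 * (s * s * (s * s)).
  have -> : s * s * (s * s) = w * w * (y * y) / 1358954496 by rewrite /s /w; field.
  have : w * w <= w * w * (y * y) by have : 1 <= y * y by [nra]; have : 0 <= w * w by [nra]; nra.
  have : 0 <= w * w * (y * y) by apply: Rmult_le_pos; nra.
  lra.
have e0 := exp_pos (y * y * y / 48).
apply: (Rmult_le_reg_r (exp (y * y * y / 48))) => //.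
rewrite Rinv_l; last lra.
apply: (Rmult_le_reg_r (w * w)); first nra.
have -> : 1400000000 * / w * / w * exp (y * y * y / 48) * (w * w) =
  1400000000 * exp (y * y * y / 48) by field; lra.
lra.
Qed.

Lemma prob_cond r N D (Q : Prop) (A : nat -> Prop) b : 0 <= b ->
  (Q -> prob_S r N D A <= b) -> prob_S r N D (fun n => Q /\ A n) <= b.
Proof.
move=> b0 H; case: (classic Q) => HQ.
  apply: Rle_trans (H HQ); rewrite !prob_cnt; apply: Rmult_le_compat_r; last first.
    by apply: cnt_le => n [HS [_ HA]].
  have := pos_INR (card_S r N D); case=> [c|<-]; first by left; apply: Rinv_0_lt_compat.
  by rewrite Rinv_0; lra.
rewrite prob_cnt /count_S; have -> : [seq n <- cands N | dec (in_S r N D n /\ Q /\ A n)] = [::].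
  apply/eqP; rewrite -(negbK (_ == _)) -has_filter; apply/negP => /hasP[n _ /decP[_ [K _]]].
  exact: HQ.
by rewrite /= /Rdiv Rmult_0_l.
Qed.

(** The error [/ ln N] of [prob_upper] is incurred for each of the [r] indices; the total is still
    small. *)
Lemma setup_r_le N D r x P : setup N D r x P -> INR r * / ln N <= 4 * exp (- (x * x * x) / 2).
Proof.
move=> S; have Hr := s_r S; have x1 := s_x S; have ll := s_ll S; have lN := s_lN S.
have x6 : 100 * (x * x) <= x * x * x by nra.
have i1 : / ln N <= exp (- (x * x * x)).
  rewrite -(exp_ln (ln N)); last lra.
  by rewrite -exp_Ropp; apply: exp_le; lra.
have r4 : INR r <= 4 * exp (x * x * x / 2) by have := exp_ge1 (x * x * x / 2); lra.
have -> : - (x * x * x) / 2 = x * x * x / 2 + - (x * x * x) by field.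
rewrite exp_plus -Rmult_assoc; apply: Rmult_le_compat => //; first exact: pos_INR.
by left; apply: Rinv_0_lt_compat; lra.
Qed.

Lemma cuberoot_le N D r x P : setup N D r x P -> Rpower (ln (ln N)) (1 / 3) <= 2 * x.
Proof.
move=> S; have x1 := s_x S; have ll := s_ll S.
have x6 : 0 < x * x * x by do 2?apply: Rmult_lt_0_compat; lra.
have -> : 2 * x = Rpower (2 * x * (2 * x) * (2 * x)) (1 / 3).
  rewrite /Rpower !ln_mult; try lra; last nra.
  have -> : 1 / 3 * (ln 2 + ln x + (ln 2 + ln x) + (ln 2 + ln x)) = ln 2 + ln x by field.
  by rewrite exp_plus !exp_ln; lra.
by apply: Rle_Rpower_l; nra.
Qed.

Lemma regular_prob : exists c C : R, 0 < c /\ 0 < C /\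
     forall (N D : R) (r : nat) (C0 : R), hyps N D r -> C0 > 0 ->
       prob_S r N D (fun n => ~ regular r D C0 n)
         <= C * (exp (- c * C0) + exp (- c * Rpower (ln (ln N)) (1/3))).
Proof.
have [N0 HN0] := @setup_ex 100 (Rle_refl _).
pose M := Rmax N0 31; have M31 : 31 <= M by exact: Rmax_r.
have lM : 1 < ln M by apply: ln3_gt1; lra.
pose C1 := exp (10000000000 / 48); pose C2 := exp (/ 48 * Rpower (ln (ln M)) (1 / 3)).
pose C3 := exp 110 * 11200000000.
have C10 : 0 < C1 by exact: exp_pos.
have C20 : 0 < C2 by exact: exp_pos.
have e110 := exp_pos 110.
have C30 : 0 < C3 by rewrite /C3; lra.
exists (/ 48), (C1 + C2 + C3); split; first lra; split; first lra.
move=> N D r C0 Hh C00.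
have N30 : N > 30 by case: Hh.
have lN1 : 1 < ln N by apply: ln3_gt1; lra.
have llN : 0 < ln (ln N) by exact: ln_gt0.
set F1 := exp (- / 48 * C0); set F2 := exp (- / 48 * _).
have F10 : 0 < F1 by exact: exp_pos.
have F20 : 0 < F2 by exact: exp_pos.
(* The threshold is [100 ^ 5], which ensures [c >= 100] for the Chernoff bounds; below it the
   constant [C1] suffices. *)
case: (Rlt_le_dec C0 10000000000) => HC0.
  apply: Rle_trans (prob_S_le1 _ _ _ _) _.
  have : 1 <= C1 * F1 by rewrite /C1 /F1 -exp_plus -[X in X <= _]exp_0; apply: exp_le; lra.
  nra.
case: (Rle_lt_dec N0 N) => HN; last first.
  apply: Rle_trans (prob_S_le1 _ _ _ _) _.
  have : 1 <= C2 * F2.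
    rewrite /C2 /F2 -exp_plus -[X in X <= _]exp_0; apply: exp_le.
    have : Rpower (ln (ln N)) (1 / 3) <= Rpower (ln (ln M)) (1 / 3); last lra.
    apply: Rle_Rpower_l; first lra; split => //.
    apply: ln_le_mono; first lra; apply: ln_le_mono; first lra.
    by have := Rmax_l N0 31; rewrite -/M; lra.
  nra.
have [x [P [x0 S]]] := HN0 N D r Hh HN.
have lN := s_lN S.
have l0 : 0 < / ln N by apply: Rinv_0_lt_compat; lra.
pose f i := exp 110 * (5600000000 * F1 * (/ INR i * / INR i) + 2 * / ln N).
pose A i n := INR i <= x * x * x /\
   let c := fifth C0 in let y := fifth (Rmax (INR i) C0) in
   (c <= y /\ INR i = y * (y * y * y * y) /\ (i <=
     count (level_le D (INR i - c * (y * y * y * y))) (primes n))%N)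
   \/ (INR i + c * (y * y * y * y) <= x * x * x /\
     (count (level_lt D (INR i + c * (y * y * y * y))) (primes n) <= i)%N).
have HA i : i \in iota 1 r -> prob_S r N D (A i) <= f i.
  rewrite mem_iota => /andP[i1 _]; have i0 := INR_gt0 i1.
  have [c0 cE _] := fifth_pow C00.
  have M0 : 0 < Rmax (INR i) C0 by have := Rmax_r (INR i) C0; lra.
  have [y0 yE _] := fifth_pow M0.
  have cy : fifth C0 <= fifth (Rmax (INR i) C0) by apply: Rle_Rpower_l;
    [lra | split; [lra | exact: Rmax_r]].
  set c := fifth C0 in c0 cE cy; set y := fifth (Rmax (INR i) C0) in y0 yE cy.
  have c100 : 100 <= c.
    apply: Rnot_lt_le => H; have c2 : c * c < 10000 by nra.
    have c4 : c * c * (c * c) < 100000000 by nra.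
    have : c * (c * c * (c * c)) < 10000000000 by nra.
    lra.
  have iy : INR i <= y * (y * y * y * y) by rewrite -yE; exact: Rmax_l.
  pose G := exp (- (c * c * (y * y * y)) / 24).
  have G0 : 0 < G by exact: exp_pos.
  pose b := exp 110 * (2 * G + / ln N).
  have b0 : 0 <= b by apply: Rmult_le_pos; lra.
  (* Half of the exponent gives [exp (- C0 / 48)], since [C0 = c ^ 5 <= c ^ 2 * y ^ 3]; the other
     half gives the summable factor in [i]. *)
  have GF : G <= F1 * (1400000000 * (/ INR i * / INR i)).
    apply: (Rle_trans _ (F1 * exp (- (y * y * y) / 48))).
      rewrite /G /F1 -exp_plus; apply: exp_le.
      have y3 : c * c * c <= y * y * y.
        by have : c * c <= y * y by [nra]; nra.
      have h1 : C0 <= c * c * (y * y * y).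
        have -> : C0 = c * c * (c * c * c) by rewrite cE; ring.
        by apply: Rmult_le_compat_l => //; nra.
      have h2 : y * y * y <= c * c * (y * y * y).
        rewrite -[X in X <= _]Rmult_1_l; apply: Rmult_le_compat_r; [nra | nra].
      lra.
    apply: Rmult_le_compat_l; first lra.
    apply: Rle_trans (exp_cube_decay (y := y) ltac:(lra)) _.
    rewrite Rmult_assoc; apply: Rmult_le_compat_l; first lra.
    have I1 : / (y * (y * y * y * y)) <= / INR i by apply: Rinv_le_contravar.
    have I2 : 0 < / (y * (y * y * y * y)) by apply: Rinv_0_lt_compat; lra.
    by apply: Rmult_le_compat; lra.
  apply: (Rle_trans _ (b + b)); last first.
    have -> : b + b = exp 110 * (4 * G + 2 * / ln N) by rewrite /b; ring.
    by apply: Rmult_le_compat_l; lra.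
  apply: prob_cond; first lra.
  move=> ix.
  apply: Rle_trans (prob_S_or (B := fun n =>
    (c <= y /\ INR i = y * (y * y * y * y)) /\ (i <=
      count (level_le D (INR i - c * (y * y * y * y))) (primes n))%N)
    (A' := fun n => INR i + c * (y * y * y * y) <=
      x * x * x /\ (count (level_lt D (INR i + c * (y * y * y * y))) (primes n) <= i)%N) _) _.
    by move=> n HS [[? [? ?]]|?]; [left|right].
  apply: Rplus_le_compat; apply: prob_cond => //.
    by move=> [_ iE]; apply: (deviation_low S).
  by move=> ?; apply: (deviation_high S).
apply: (Rle_trans _ (\rsum_(i <- iota 1 r) f i)).
  apply: Rle_trans (prob_exists HA); rewrite -[X in _ <= X]Rplus_0_r.
  (* The impossible second event turns the union bound into monotonicity of [prob_S]. *)
  apply: Rle_trans (prob_S_or (B := fun n => exists2 i, i \in iota 1 r & A i n) (A' := fun n =>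
    False /\ False) _) _.
    by move=> n HS HR; left; exact: (not_regular S HS HC0 HR).
  by apply: Rplus_le_compat_l; apply: prob_cond => //; lra.
rewrite /f rsum_mull rsum_add rsum_mull rsum_const size_iota.
have Q := inv_sq_sum r.
have rl := setup_r_le S.
have F2b : exp (- (x * x * x) / 2) <= F2.
  apply: exp_le; have := cuberoot_le S; have x1 := s_x S.
  have : x <= x * x * x by have : 100 * x <= x * x by [nra]; nra.
  lra.
have : exp 110 * (5600000000 * F1 * (\rsum_(i <- iota 1 r) (/ INR i * / INR i)) +
  INR r * (2 * / ln N))
   <= C3 * (F1 + F2).
  rewrite /C3 (Rmult_assoc _ 11200000000); apply: Rmult_le_compat_l; first lra.
  have : 5600000000 * F1 * (\rsum_(i <- iota 1 r) (/ INR i * / INR i)) <= 5600000000 * F1 * 2.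
    by apply: Rmult_le_compat_l => //; lra.
  lra.
nra.
Qed.

(** * Extravagant spacing *)

Lemma wt_const c (T : seq nat) : wt (fun=> c) T = c ^ size T.
Proof. by elim: T => [//|p T IH] /=; rewrite IH. Qed.

(* Conditioning on the total number [k] of primes is harmless for events that only depend on the
   part [l1]: after tilting the weights by [k / P] it costs a constant factor. *)
Lemma wsum_transfer (v : nat -> R) (l1 l2 : seq nat) (k : nat) (f : seq nat -> R) :
  (forall p : nat, p \in l1 -> 0 <= v p) -> (forall p : nat, p \in l2 -> 0 <= v p) ->
  (forall S : seq nat, subseq S l1 -> 0 <= f S) ->
  (forall S1 S2 : seq nat, subseq S1 l1 -> subseq S2 l2 -> f (S1 ++ S2) = f S1) ->
  let P1 := \rsum_(p <- l1) v p in let Q := \rsum_(p <- l2) v p in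
  let P := P1 + Q in let lam := INR k / P in
  (0 < k)%N -> 0 < P -> P <= 4 * Q -> 2 <= lam * Q ->
  wsum v (l1 ++ l2) (fun S => ind (size S == k) * f S)
  <= 12 * exp (- (lam * P1)) * wsum (fun p => v p * lam) l1 f * exp_term P k.
Proof.
move=> v1 v2 f0 fc P1 Q P lam k0 P0 PQ lQ.
have K := INR_gt0 k0.
have lam0 : 0 < lam by apply: Rdiv_lt_0_compat.
have Q0 : 0 < Q by lra.
have sQ : 0 < sqrt (lam * Q) by apply: sqrt_lt_R0; lra.
have sk : 0 < sqrt (INR k) by apply: sqrt_lt_R0.
(* Once [S1] is fixed, [j = k - size S1] primes remain for [l2], of total weight at most [Q ^ j / j!
   = (/ lam) ^ j * ((lam * Q) ^ j / j!)]. The second factor is bounded uniformly in [j], and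
   [(/ lam) ^ j] leaves the tilt [lam ^ size S1]. *)
pose c := (/ lam) ^ k * (2 * exp (lam * Q) / sqrt (lam * Q)).
have c0 : 0 <= c.
  apply: Rmult_le_pos; first by apply: pow_le; left; apply: Rinv_0_lt_compat.
  by apply: Rle_mult_inv_pos => //; have := exp_pos (lam * Q); lra.
have X0 : 0 <= wsum (fun p => v p * lam) l1 f by apply: wsum_ge0 => // p /v1 ?; nra.
apply: (Rle_trans _ (c * wsum (fun p => v p * lam) l1 f)).
  rewrite -(wsum_weight v (fun=> lam)) -wsum_scal wsum_cat; apply: wsum_le => // S1 H1.
  rewrite wt_const.
  have f1 := f0 S1 H1.
  apply: (Rle_trans _ (f S1 * wsum v l2 (fun S2 => ind (size (S1 ++ S2) == k)))).
    by right; rewrite -wsum_scal; apply: wsum_eq => S2 H2; rewrite fc //; ring.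
  have -> : c * (lam ^ size S1 * f S1) = f S1 * (c * lam ^ size S1) by ring.
  apply: Rmult_le_compat_l => //.
  case: (leqP (size S1) k) => sz; last first.
    have -> : wsum v l2 (fun S2 => ind (size (S1 ++ S2) == k)) = 0.
      rewrite -[RHS](wsum_0 v l2); apply: wsum_eq => S2 _; rewrite size_cat.
      by case: eqP => //; lia.
    by apply: Rmult_le_pos => //; apply: pow_le; lra.
  set j := (k - size S1)%N.
  have -> : wsum v l2 (fun S2 => ind (size (S1 ++ S2) == k)) = elem_sym v l2 j.
    apply: wsum_eq => S2 _; rewrite size_cat; congr (ind _); rewrite /j.
    by apply/eqP/eqP; lia.
  apply: Rle_trans (elem_sym_le j v2) _; rewrite -/Q.
  have H : exp_term Q j = (/ lam) ^ j * exp_term (lam * Q) j.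
    rewrite (@exp_term_ratio Q (lam * Q)); last lra.
    by congr (_ ^ _ * _); field; lra.
  rewrite H /c.
  have -> : (/ lam) ^ k * (2 * exp (lam * Q) / sqrt (lam * Q)) * lam ^ size S1 =
     (/ lam) ^ j * (2 * exp (lam * Q) / sqrt (lam * Q)).
    have -> : k = (j + size S1)%N by rewrite /j subnK.
    rewrite pow_add.
    have -> : (/ lam) ^ j * (/ lam) ^ size S1 * (2 * exp (lam * Q) / sqrt (lam * Q)) * lam ^ size
      S1 =
      (/ lam) ^ j * (2 * exp (lam * Q) / sqrt (lam * Q)) * ((/ lam) ^ size S1 * lam ^ size S1) by
        ring.
    by rewrite -Rpow_mult_distr Rinv_l ?pow1; [ring | lra].
  apply: Rmult_le_compat_l; first by apply: pow_le; left; apply: Rinv_0_lt_compat.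
  apply: (Rmult_le_reg_r (sqrt (lam * Q))) => //.
  have -> : 2 * exp (lam * Q) / sqrt (lam * Q) * sqrt (lam * Q) = 2 * exp (lam * Q) by field; lra.
  exact: exp_term_le_exp.
have PK : lam * P = INR k by rewrite /lam; field; lra.
(* The tilt moves the peak of the exponential series to index [k], where Stirling's lower bound is
   sharp. *)
have low : (/ lam) ^ k * (exp (INR k - 1) / sqrt (INR k)) <= exp_term P k.
  rewrite (@exp_term_ratio P (INR k)) //.
  have -> : P / INR k = / lam by rewrite /lam; field; lra.
  apply: Rmult_le_compat_l; first by apply: pow_le; left; apply: Rinv_0_lt_compat.
  apply: (Rmult_le_reg_r (sqrt (INR k))) => //.
  have -> : exp (INR k - 1) / sqrt (INR k) * sqrt (INR k) = exp (INR k - 1) by field; lra.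
  exact: exp_term_diag_ge.
(* The 12 consists of 2 from [exp_term_le_exp], 2 from [sqrt k <= 2 * sqrt (lam * Q)], and 3 from
   [exp (-1) >= 1 / 3]. *)
have ratio : c <= 12 * exp (- (lam * P1)) * ((/ lam) ^ k * (exp (INR k - 1) / sqrt (INR k))).
  have il : 0 < (/ lam) ^ k by apply: pow_lt; apply: Rinv_0_lt_compat.
  have -> : 12 * exp (- (lam * P1)) * ((/ lam) ^ k * (exp (INR k - 1) / sqrt (INR k))) =
    (/ lam) ^ k * (12 * (exp (- (lam * P1)) * exp (INR k - 1)) / sqrt (INR k)) by rewrite /Rdiv;
      ring.
  apply: Rmult_le_compat_l; first lra.
  rewrite -exp_plus.
  have -> : - (lam * P1) + (INR k - 1) = lam * Q + - (1) by rewrite -PK /P; ring.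
  rewrite exp_plus.
  have e1 : 1 / 3 <= exp (- (1)).
    rewrite exp_Ropp; have -> : 1 / 3 = / 3 by lra.
    by apply: Rinv_le_contravar; [exact: exp_pos | have := exp_le_3; lra].
  have s2 : sqrt (INR k) <= 2 * sqrt (lam * Q).
    have -> : 2 = sqrt (2 * 2) by rewrite sqrt_square; lra.
    rewrite -sqrt_mult; [|lra|lra]; apply: sqrt_le_1; [lra|lra|].
    rewrite -PK; nra.
  apply: (Rmult_le_reg_r (sqrt (lam * Q) * sqrt (INR k))); first exact: Rmult_lt_0_compat.
  have e0 := exp_pos (lam * Q).
  have -> : 2 * exp (lam * Q) / sqrt (lam * Q) * (sqrt (lam * Q) * sqrt (INR k)) =
    2 * exp (lam * Q) * sqrt (INR k).
    by field; lra.
  have -> : 12 * (exp (lam * Q) * exp (- (1))) / sqrt (INR k) * (sqrt (lam * Q) * sqrt (INR k)) =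
     12 * (exp (lam * Q) * exp (- (1))) * sqrt (lam * Q) by field; lra.
  have h1 : 2 * exp (lam * Q) * sqrt (INR k) <= 2 * exp (lam * Q) * (2 * sqrt (lam * Q)).
    by apply: Rmult_le_compat_l; lra.
  have h2 : 12 * (exp (lam * Q) * (1 / 3)) * sqrt (lam * Q) <=
    12 * (exp (lam * Q) * exp (- (1))) * sqrt (lam * Q).
    apply: Rmult_le_compat_r; first lra.
    by apply: Rmult_le_compat_l; first lra; apply: Rmult_le_compat_l; lra.
  lra.
have -> : 12 * exp (- (lam * P1)) * wsum (fun p => v p * lam) l1 f * exp_term P k =
  12 * exp (- (lam * P1)) * exp_term P k * wsum (fun p => v p * lam) l1 f by ring.
apply: Rmult_le_compat_r => //; apply: Rle_trans ratio _.
by apply: Rmult_le_compat_l => //; have := exp_pos (- (lam * P1)); lra.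
Qed.

(** * Gaps in a dyadic block of levels *)

Lemma wsum_sum_le (w : nat -> R) (l : seq nat) (g : nat -> R) :
  (forall p : nat, p \in l -> 0 <= w p) -> (forall p : nat, p \in l -> 0 <= g p) ->
  wsum w l (fun S => \rsum_(p <- S) g p) <= (\rsum_(p <- l) (w p * g p)) * wmass w l.
Proof.
elim: l => [|p l IH] w0 g0; first by rewrite /= !rsum_nil; lra.
have [wp wl] := cons_w0 w0; have [gp gl] := cons_w0 g0.
rewrite wsum_cons rsum_cons wmass_cons.
have -> : wsum w l (fun S => \rsum_(q <- p :: S) g q) = g p * wmass w l + wsum w l (fun S =>
  \rsum_(q <- S) g q).
  by rewrite /wmass -wsum_scal -wsum_add; apply: wsum_eq => S _; rewrite rsum_cons; ring.
have {}IH := IH wl gl.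
have Z1 := wmass_ge1 wl.
have T0 : 0 <= \rsum_(q <- l) (w q * g q).
  by apply: rsum_ge0 => q Hq; apply: Rmult_le_pos; auto.
have IH2 := Rmult_le_compat_l _ _ _ wp IH.
have : 0 <= w p * (w p * g p) * wmass w l by apply: Rmult_le_pos; [nra | lra].
nra.
Qed.

Lemma wsum_cat_ge (w : nat -> R) (l1 l2 : seq nat) (f : seq nat -> R) :
  (forall p : nat, p \in l1 -> 0 <= w p) -> (forall p : nat, p \in l2 -> 0 <= w p) ->
  (forall S, 0 <= f S) -> wsum w l2 f <= wsum w (l1 ++ l2) f.
Proof.
move=> w1 w2 f0; rewrite wsum_cat.
apply: (wsum_split1 (f := fun S1 => wsum w l2 (fun S2 => f (S1 ++ S2)))) => // S _.
exact: wsum_ge0.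
Qed.

Lemma wsum_cat_le (w : nat -> R) (l1 l2 : seq nat) (f : seq nat -> R) :
  (forall p : nat, p \in l1 -> 0 <= w p) -> (forall p : nat, p \in l2 -> 0 <= w p) ->
  (forall S, f S <= 1) ->
  (forall S1 S2 : seq nat, subseq S1 l1 -> S1 <> [::] -> f (S1 ++ S2) = 0) ->
  wsum w (l1 ++ l2) f <= wmass w l2.
Proof.
move=> w1 w2 f1 f0; rewrite wsum_cat.
have Z1 := wmass_ge1 w2.
have E0 : wsum w l1 (fun S => ind (S == [::])) = 1.
  elim: l1 {w1 f0} => [//|p l IH]; rewrite wsum_cons IH (@wsum_eq _ _ _ (fun=> 0)) ?wsum_0 //; ring.
apply: (Rle_trans _ (wsum w l1 (fun S => ind (S == [::]) * wmass w l2)));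
  last by rewrite wsum_scalr E0; lra.
apply: wsum_le => // S1 H1; case: eqP => [->|ne].
  rewrite /ind Rmult_1_l; apply: wsum_le => // S2 _; exact: f1.
rewrite (@wsum_eq _ _ _ (fun=> 0)) ?wsum_0; first by rewrite /=; lra.
by move=> S2 _; exact: f0.
Qed.

(** The margin [U / 4] below makes all primes of lower blocks negligible against [p]; the margin
    [U / 2 >= ln G] above lets the gap end inside the block [[U, 2 * U)]. *)
Definition window D U (p : nat) : bool := dec (1.25 * U <= level D p /\ level D p < 1.5 * U).
Definition gap G (p : nat) (S : seq nat) : bool :=
  all (fun q => dec (G * ln (INR p) <= ln (INR q))) S.
(** The 8 is twice a bound 4 for the mean of the sum in units of [ln p], so that Markov's inequality
    gives probability at least [1 / 2]. *)
Definition good (S : seq nat) (p : nat) : bool := dec (\rsum_(q <- S) ln (INR q) <= 8 * ln (INR p)).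
Definition gap_start D U G (S : seq nat) : bool :=
  has (fun t => window D U t.1.2 && gap G t.1.2 t.2) (splits S).
Definition block_success D U G (S : seq nat) : bool :=
  has (fun t => good t.1.1 t.1.2 && (window D U t.1.2 && gap G t.1.2 t.2)) (splits S).

(* Counting successes at the last start of a gap only, at most one is counted. *)
Lemma last_start_le (h : nat -> seq nat -> bool) (S : seq nat) (g : seq nat -> nat -> bool) :
  \rsum_(t <- splits S) ind (g t.1.1 t.1.2 && h t.1.2 t.2 && ~~ has (fun t' =>
    h t'.1.2 t'.2) (splits t.2))
  <= ind (has (fun t => g t.1.1 t.1.2 && h t.1.2 t.2) (splits S)).
Proof.
elim: S g => [|p S IH] g; first by rewrite rsum_nil /=; lra.
rewrite [splits _]/= rsum_cons rsum_map [has _ (_ :: _)]/= has_map.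
have {}IH := IH (fun S1 => g (p :: S1)).
case Hs : (has (fun t' => h t'.1.2 t'.2) (splits S)).
  rewrite /= andbF [ind false]/=.
  apply: Rle_trans (_ : \rsum_(t <- splits S) ind (g (p :: t.1.1) t.1.2 && h t.1.2 t.2 && ~~ has
    (fun t' => h t'.1.2 t'.2) (splits t.2)) <= _).
    by rewrite Rplus_0_l; apply: Rle_refl.
  by apply: Rle_trans IH _; apply: ind_imp => H; rewrite orbC; apply/orP; left.
rewrite (rsum_eq (g := fun=> 0)) ?rsum0; last first.
  move=> t Ht /=; have -> : h t.1.2 t.2 = false; last by rewrite andbF.
  by apply: negbTE; move/negbT: Hs => /hasPn /(_ t Ht).
rewrite /= andbT Rplus_0_r; apply: ind_imp => ->; by [].
Qed.

Lemma splits_primes_in a b t : t \in splits (primes_in a b) ->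
  [/\ t.1.2 \in primes_in a b, t.1.1 = primes_in a (INR t.1.2) & t.2 = primes_in (INR t.1.2 + 1) b].
Proof.
move=> Ht; have E := splits_cat Ht.
have Hp : t.1.2 \in primes_in a b by rewrite E mem_cat mem_head orbT.
have /primes_inP[pp [ap pb]] := Hp.
have E2 : primes_in a b = primes_in a (INR t.1.2) ++ t.1.2 :: primes_in (INR t.1.2 + 1) b.
  by rewrite -primes_in_cons //; apply: primes_in_cat; lra.
have u1 : uniq (t.1.1 ++ t.1.2 :: t.2) by rewrite -E primes_in_uniq.
have u2 : uniq (primes_in a (INR t.1.2) ++ t.1.2 :: primes_in (INR t.1.2 + 1) b) by rewrite -E2
  primes_in_uniq.
have idx s1 s2 : uniq (s1 ++ t.1.2 :: s2) -> index t.1.2 (s1 ++ t.1.2 :: s2) = size s1.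
  rewrite cat_uniq => /and3P[_ /hasPn H _]; rewrite index_cat.
  have -> : (t.1.2 \in s1) = false by apply: negbTE; apply: H; rewrite mem_head.
  by rewrite /= eqxx addn0.
have sz : size t.1.1 = size (primes_in a (INR t.1.2)).
  by rewrite -(idx _ _ u1) -(idx _ _ u2) -E -E2.
have : t.1.1 ++ t.1.2 :: t.2 == primes_in a (INR t.1.2) ++ t.1.2 ::
  primes_in (INR t.1.2 + 1) b by rewrite -E -E2.
rewrite eqseq_cat // => /andP[/eqP H1 /eqP [H2]].
by split.
Qed.

Lemma rsum_splits (l : seq nat) (f : nat -> R) : \rsum_(t <- splits l) f t.1.2 = \rsum_(p <- l) f p.
Proof. by rewrite -[in RHS](splits_mid l) rsum_map. Qed.

Lemma ln_level_inv D t : ln (level_inv D t) = ln D * exp t.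
Proof. by rewrite /level_inv ln_exp. Qed.

Lemma level_inv_level D (p : nat) : 3 < D -> D <= INR p -> level_inv D (level D p) = INR p.
Proof.
move=> D3 Dp; have l3 := ln3_gt1 D3.
have lp : ln D <= ln (INR p) by apply: ln_le_mono; lra.
rewrite /level_inv /level; have -> : exp (ln (ln (INR p)) - ln (ln D)) = ln (INR p) / ln D.
  by rewrite /Rminus exp_plus exp_Ropp !exp_ln; lra.
have -> : ln D * (ln (INR p) / ln D) = ln (INR p) by field; lra.
by rewrite exp_ln; lra.
Qed.

Lemma level_inv_level_gap D G (p : nat) : 3 < D -> D <= INR p -> 0 < G ->
  level_inv D (level D p + ln G) = exp (G * ln (INR p)).
Proof.
move=> D3 Dp G0; rewrite -(level_inv_level D3 Dp) ln_level_inv /level_inv exp_plus exp_ln //;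
  congr exp; ring.
Qed.

Notation tilted lam := (fun p : nat => / INR p * lam).

Lemma tilted_ge0 lam x y (p : nat) : 0 <= lam -> p \in primes_in x y -> 0 <= / INR p * lam.
Proof. by move=> l0 /inv_ge0 H; apply: Rmult_le_pos. Qed.

Lemma rsum_tilted lam (l : seq nat) : \rsum_(p <- l) (/ INR p * lam) = lam * \rsum_(p <- l) / INR p.
Proof. by rewrite -rsum_mull; apply: rsum_eq => p _; rewrite Rmult_comm. Qed.

(** The inverse of this mass is the probability that no prime is chosen in the gap after [p], so
    that probability is [1 / G] up to constants. The condition on [(lam - 1) * ln G] makes the tilt
    harmless. *)
Lemma gap_wmass D G lam (p : nat) : 3 < D -> p \in primes_in D (INR p + 1) -> 2 <= G ->
  0.98 <= lam <= 1.02 -> - 1 <= (lam - 1) * ln G <= 1 ->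
  G * exp (-21) <= wmass (tilted lam) (primes_in (INR p + 1) (level_inv D (level D p + ln G))) <=
    G * exp 19.
Proof.
move=> D3 Hp G2 lam1 lamG.
have /primes_inP[pp [Dp _]] := Hp.
have u0 := level_ge0 D3 Dp.
have lG : 0 <= ln G by apply: ln_ge0; lra.
set Y := level_inv D (level D p + ln G).
have l3 := ln3_gt1 D3.
have lp : 1 < ln (INR p) by have := @ln_le_mono D (INR p) ltac:(lra) Dp; lra.
have pY : INR p < Y.
  rewrite -(level_inv_level D3 Dp) /Y /level_inv; apply: exp_increasing; apply: Rmult_lt_compat_l;
    first lra.
  by apply: exp_increasing; have : 0 < ln G by [apply: ln_gt0; lra]; lra.
have [M1 M2] := @mass_level_inv D (level D p) (level D p + ln G) D3 ltac:(lra).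
rewrite level_inv_level // -/Y primes_in_cons // rsum_cons in M1 M2.
have ip : 0 < / INR p <= 1.
  split; first by apply: Rinv_0_lt_compat; lra.
  by rewrite -Rinv_1; apply: Rinv_le_contravar; lra.
set g := primes_in (INR p + 1) Y in M1 M2 *.
have w0 : forall q : nat, q \in g -> 0 <= / INR q * lam by move=> q; apply: tilted_ge0; lra.
have G0 : G = exp (ln G) by rewrite exp_ln; lra.
split.
  apply: Rle_trans (wmass_ge w0).
  rewrite rsum_tilted {1}G0 -exp_plus; apply: exp_le.
  have sq : \rsum_(q <- g) (/ INR q * lam * (/ INR q * lam)) <= 1.
    rewrite (rsum_eq (g := fun q => lam * lam * (/ INR q * / INR q))); last by move=> q _; ring.
    rewrite rsum_mull; have H := @inv_sq_primes_in (INR p + 1) Y ltac:(lra).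
    have H0 : 0 <= \rsum_(q <- g) (/ INR q * / INR q).
      by apply: rsum_ge0 => q /inv_ge0 ?; nra.
    have L2 : lam * lam <= 1.05 by nra.
    apply: (Rle_trans _ (1.05 * (1 / 3))); last lra.
    by apply: Rmult_le_compat => //; nra.
  have H : lam * (ln G - 18) <= lam * \rsum_(q <- g) / INR q by apply: Rmult_le_compat_l; lra.
  apply: (Rle_trans _ (lam * (ln G - 18) - 1)); first lra.
  exact: Rplus_le_compat H (Ropp_le_contravar _ _ sq).
apply: Rle_trans (wmass_le w0) _.
rewrite rsum_tilted {1}G0 -exp_plus; apply: exp_le.
have H : lam * (\rsum_(q <- g) / INR q) <= lam * (ln G + 17) by apply: Rmult_le_compat_l; lra.
apply: Rle_trans H _; lra.
Qed.

Lemma gap_nil_head G (p : nat) (S1 S2 : seq nat) y : 1 < INR p -> 0 < G ->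
  subseq S1 (primes_in y (exp (G * ln (INR p)))) -> 2 <= y -> S1 <> [::] ->
    gap G p (S1 ++ S2) = false.
Proof.
move=> p1 G0; case: S1 => [//|q S1] HS y2 _.
have : q \in primes_in y (exp (G * ln (INR p))) by apply: (mem_subseq HS); rewrite mem_head.
move=> /primes_inP[_ [yq H]]; rewrite /gap /=; apply/andP => -[/decP K _].
have : ln (INR q) < G * ln (INR p); last lra.
by rewrite -(ln_exp (G * _)); apply: ln_increasing; lra.
Qed.

Lemma gap_primes_in G (p : nat) (S : seq nat) b : 1 < INR p ->
  subseq S (primes_in (exp (G * ln (INR p))) b) -> gap G p S.
Proof.
move=> p1 HS; apply/allP => q /(mem_subseq HS) /primes_inP[_ [H _]]; apply/decP.
exact: exp_le_ln.
Qed.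

(** A sum over the last gap start [p]. The primes below [p], in the gap and beyond it are
    independent: [good] has probability at least [1 / 2], an empty gap at least [1 / (G * exp 19)],
    and the absence of later gap starts at least [1 / 2]. Another [1 / 2] accounts for the factor
    [1 + lam / p] of the mass. The weights [lam / p] over the window sum to at least [U / 5], which
    gives the 40. *)
Lemma block_lower D U G lam : 3 < D -> 1000 <= U -> exp 21 * U <= G -> ln G <= U / 2 ->
  0.98 <= lam <= 1.02 -> - 1 <= (lam - 1) * ln G <= 1 ->
  let l := primes_in (level_inv D U) (level_inv D (2 * U)) in
  U / (40 * exp 19 * G) * wmass (tilted lam) l <= wsum (tilted lam) l (fun S =>
    ind (block_success D U G S)).
Proof.
move=> D3 U1 GU lG lam1 lamG l.
have e21 : 22 <= exp 21 by have := exp_ge1 21; lra.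
have G2 : 2 <= G by nra.
set b := level_inv D (2 * U).
have wPL x y (p : nat) : p \in primes_in x y -> 0 <= / INR p * lam by apply: tilted_ge0; lra.
have DU : D <= level_inv D U by apply: level_inv_ge; lra.
have facts y (p : nat) : D <= y -> p \in primes_in y b ->
  [/\ prime p, D <= INR p, 1 < INR p & p \in primes_in D (INR p + 1)].
  by move=> Dy /primes_inP[pp H]; split => //; try lra; apply/primes_inP; split => //; lra.
have gapsplit y (p : nat) : D <= y -> p \in primes_in y b -> window D U p ->
  primes_in (INR p + 1) b = primes_in (INR p + 1) (exp (G * ln (INR p))) ++ primes_in
    (exp (G * ln (INR p))) b.
  move=> Dy Hp /decP Hw; have [pp Dp p1 _] := facts y p Dy Hp.
  rewrite -(@level_inv_level_gap D G p D3 Dp ltac:(lra)).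
  apply: primes_in_cat; last by apply: level_inv_mono => //; lra.
  rewrite (@level_inv_level_gap D G p D3 Dp ltac:(lra)).
  have l3 := ln3_gt1 D3; have lp := @ln_le_mono D (INR p) ltac:(lra) Dp.
  rewrite Rmult_comm -/(Rpower _ _).
  apply: (Rle_trans _ (exp (ln (INR p) + ln (INR p)))).
    by rewrite exp_plus exp_ln; nra.
  by apply: exp_le; nra.
(* The expected number of gap starts is at most [1.02 * 0.3 * U * exp 21 / G], below one half. The
   lower end [y] is free, since the bound is applied to the primes beyond a gap. *)
have nog y : D <= y -> wmass (tilted lam) (primes_in y b) / 2 <=
   wsum (tilted lam) (primes_in y b) (fun S => ind (~~ gap_start D U G S)).
  move=> Dy; set l3 := primes_in y b.
  have w3 : forall p : nat, p \in l3 -> 0 <= / INR p * lam by move=> p; exact: wPL.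
  have Z1 := wmass_ge1 w3.
  have U0 : wsum (tilted lam) l3 (fun S => ind (gap_start D U G S)) <= wmass (tilted lam) l3 / 2.
    apply: (Rle_trans _ (wsum (tilted lam) l3 (fun S =>
      \rsum_(t <- splits S) ind (window D U t.1.2 && gap G t.1.2 t.2)))).
      apply: wsum_le => // S _; rewrite /gap_start; case: hasP => [[t Ht H]|_] /=.
        apply: Rle_trans (rsum_mem_le (g := fun t =>
          ind (window D U t.1.2 && gap G t.1.2 t.2)) Ht _); first by rewrite H /=; lra.
        by move=> ? _; exact: ind_ge0.
      by apply: rsum_ge0 => ? _; exact: ind_ge0.
    rewrite (wsum_splits _ _ (fun S1 p S2 => ind (window D U p && gap G p S2))).
    apply: (Rle_trans _ (\rsum_(t <- splits l3)
      (wmass (tilted lam) l3 * exp 21 / G * (if window D U t.1.2 then / INR t.1.2 * lam else 0)))).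
      apply: rsum_le => t Ht; have [Hp E1 E2] := splits_primes_in Ht.
      have [pp Dp p1 Hp'] := facts y _ Dy Hp.
      have wp := w3 _ Hp.
      case Hw : (window D U t.1.2) => /=; last first.
        by rewrite !wsum_0; lra.
      have Zd : wmass (tilted lam) l3 = wmass (tilted lam) t.1.1 *
        ((1 + / INR t.1.2 * lam) * wmass (tilted lam) t.2).
        by rewrite [l3 in LHS](splits_cat Ht) wmass_cat wmass_cons.
      have [gl gu] := gap_wmass D3 Hp' G2 lam1 lamG.
      rewrite (@level_inv_level_gap D G _ D3 Dp ltac:(lra)) in gl gu.
      have E3 := gapsplit y _ Dy Hp Hw.
      set g := primes_in _ (exp _) in E3 gl gu; set l33 := primes_in (exp _) b in E3.
      rewrite {}E2 {}E3 wmass_cat in Zd *.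
      have Ig : wsum (tilted lam) (g ++ l33) (fun S2 => ind (gap G t.1.2 S2)) <=
        wmass (tilted lam) l33.
        apply: wsum_cat_le; [by move=> p; exact: wPL | by move=> p; exact: wPL | by move=> S;
          exact: ind_le1 |].
        move=> S1 S2 HS1 ne; rewrite (gap_nil_head _ p1 _ HS1) //; lra.
      have Z11 : 1 <= wmass (tilted lam) t.1.1 by rewrite E1; apply: wmass_ge1 => p; exact: wPL.
      have Z33 : 1 <= wmass (tilted lam) l33 by apply: wmass_ge1 => p; exact: wPL.
      rewrite (@wsum_eq _ t.1.1 _ (fun S1 => wsum (tilted lam) (g ++ l33) (fun S2 =>
        ind (gap G t.1.2 S2)) * 1)); last by move=> S _; rewrite Rmult_1_r.
      rewrite wsum_scal -/(wmass _ t.1.1).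
      rewrite (Rmult_comm _ (/ INR t.1.2 * lam)); apply: Rmult_le_compat_l => //.
      apply: (Rle_trans _ (wmass (tilted lam) l33 * wmass (tilted lam) t.1.1)).
        by apply: Rmult_le_compat_r; lra.
      rewrite Zd; set Z1' := wmass _ t.1.1 in Z11 *; set Z3' := wmass _ l33 in Z33 *; set Zg :=
        wmass _ g in gl gu *.
      set wp' := / INR t.1.2 * lam in wp *.
      have e0 : exp (-21) = / exp 21 by rewrite -exp_Ropp; congr exp; lra.
      have k1 : 1 <= Zg * exp 21 / G.
        apply: (Rmult_le_reg_r G); first lra.
        have -> : Zg * exp 21 / G * G = Zg * exp 21 by field; lra.
        have : G * exp (-21) * exp 21 <= Zg * exp 21 by apply: Rmult_le_compat_r; lra.
        by rewrite e0 Rmult_assoc Rinv_l; lra.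
      have -> : Z1' * ((1 + wp') * (Zg * Z3')) * exp 21 / G =
        Z3' * Z1' * ((1 + wp') * (Zg * exp 21 / G)) by field; lra.
      rewrite -[X in X <= _]Rmult_1_r; apply: Rmult_le_compat_l; [nra|nra].
    rewrite rsum_mull (rsum_splits _ (fun p => if window D U p then / INR p * lam else 0))
      -rsum_filter rsum_tilted.
    have mass : 0 <= \rsum_(p <- [seq p <- l3 | window D U p]) / INR p <= 0.3 * U.
      split; first by apply: rsum_ge0 => p; rewrite mem_filter => /andP[_]; exact: inv_ge0.
      have [_ M] := @mass_level_inv D (1.25 * U) (1.5 * U) D3 ltac:(lra).
      apply: (Rle_trans _ (1.5 * U - 1.25 * U + 17)); last lra.
      apply: Rle_trans M; apply: rsum_le_sub; first by rewrite filter_uniq ?primes_in_uniq.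
        move=> p; rewrite mem_filter => /andP[/decP H Hp]; have [pp Dp p1 _] := facts y p Dy Hp.
        apply/primes_inP; split => //; split; last by apply/lt_level_inv; lra.
        by apply: Rnot_lt_le => /(lt_level_inv _ D3 p1); lra.
      by move=> p; exact: inv_ge0.
    have -> : wmass (tilted lam) l3 / 2 = wmass (tilted lam) l3 * exp 21 / G * (G / (2 * exp 21))
      by field; lra.
    apply: Rmult_le_compat_l; first by apply: Rle_mult_inv_pos; [apply: Rmult_le_pos; lra | lra].
    have : U / 2 <= G / (2 * exp 21).
      apply: (Rmult_le_reg_r (2 * exp 21)); first lra.
      have -> : G / (2 * exp 21) * (2 * exp 21) = G by field; lra.
      lra.
    move=> HU; apply: (Rle_trans _ (1.02 * (0.3 * U))); last lra.
    by case: mass => m0 m1; apply: Rmult_le_compat => //; lra.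
  have : wsum (tilted lam) l3 (fun S => ind (~~ gap_start D U G S)) +
    wsum (tilted lam) l3 (fun S => ind (gap_start D U G S)) = wmass (tilted lam) l3.
    by rewrite -wsum_add; apply: wsum_eq => S _; case: (gap_start D U G S) => /=; lra.
  lra.
have wl : forall p : nat, p \in l -> 0 <= / INR p * lam by move=> p; exact: wPL.
have Zl := wmass_ge1 wl.
apply: (Rle_trans _ (wsum (tilted lam) l (fun S => \rsum_(t <- splits S)
   ind (good t.1.1 t.1.2 && (window D U t.1.2 && gap G t.1.2 t.2) && ~~ gap_start D U G t.2))));
     last first.
  by apply: wsum_le => // S _; exact: (last_start_le (fun p S2 => window D U p && gap G p S2)).
rewrite (wsum_splits _ _ (fun S1 p S2 => ind (good S1 p && (window D U p && gap G p S2) && ~~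
  gap_start D U G S2))).
apply: (Rle_trans _ (\rsum_(t <- splits l) (wmass (tilted lam) l / (8 * exp 19 * G) *
  (if window D U t.1.2 then / INR t.1.2 * lam else 0)))).
  rewrite rsum_mull (rsum_splits _ (fun p => if window D U p then / INR p * lam else 0))
    -rsum_filter rsum_tilted.
  have mass : 0.21 * U <= \rsum_(p <- [seq p <- l | window D U p]) / INR p.
    have [M _] := @mass_level_inv D (1.25 * U) (1.5 * U) D3 ltac:(lra).
    apply: (Rle_trans _ (1.5 * U - 1.25 * U - 17)); first lra.
    apply: Rle_trans M _; apply: rsum_le_sub; first by exact: primes_in_uniq.
      move=> p /primes_inP[pp [H1 H2]].
      have B1 := @level_inv_mono D U (1.25 * U) D3 ltac:(lra).
      have B2 := @level_inv_mono D (1.5 * U) (2 * U) D3 ltac:(lra).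
      rewrite mem_filter; apply/andP; split; last by apply/primes_inP; split => //; lra.
      apply/decP; split; last by apply/lt_level_inv; lra.
      by apply: Rnot_lt_le => K; apply/(Rle_not_lt _ _ H1)/lt_level_inv; lra.
    by move=> p; rewrite mem_filter => /andP[_]; exact: inv_ge0.
  have e19 := exp_pos 19.
  have -> : U / (40 * exp 19 * G) * wmass (tilted lam) l =
    wmass (tilted lam) l / (8 * exp 19 * G) * (U / 5) by field; lra.
  apply: Rmult_le_compat_l; first by apply: Rle_mult_inv_pos; [lra | nra].
  apply: (Rle_trans _ (0.98 * (0.21 * U))); first lra.
  by apply: Rmult_le_compat => //; lra.
apply: rsum_le => -[[l1 p] l2] Ht; have /= [Hp E1 E2] := splits_primes_in Ht.
have [pp Dp p1 Hp'] := facts _ _ DU Hp.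
have wp := wl _ Hp.
case Hw : (window D U p) => /=; last first.
  rewrite Rmult_0_r; apply: Rmult_le_pos => //; apply: wsum_ge0 => [q|S _]; first by rewrite E1;
    exact: wPL.
  by apply: wsum_ge0 => [q|S' _]; [rewrite E2; exact: wPL | exact: ind_ge0].
have Zd : wmass (tilted lam) l = wmass (tilted lam) l1 * ((1 + / INR p * lam) * wmass (tilted lam)
  l2).
  by rewrite [l in LHS](splits_cat Ht) wmass_cat wmass_cons.
have [gl gu] := gap_wmass D3 Hp' G2 lam1 lamG.
rewrite (@level_inv_level_gap D G _ D3 Dp ltac:(lra)) in gl gu.
have E3 := gapsplit _ _ DU Hp Hw.
set g := primes_in _ (exp _) in E3 gl gu; set l3 := primes_in (exp _) b in E3.
have lp : 1 < ln (INR p).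
  by have := @ln_le_mono D (INR p) ltac:(lra) Dp; have := ln3_gt1 D3; lra.
have pY : D <= exp (G * ln (INR p)).
  rewrite -(@level_inv_level_gap D G _ D3 Dp ltac:(lra)).
  by apply: level_inv_ge => //; have := level_ge0 D3 Dp; have : 0 <= ln G by [apply: ln_ge0; lra];
    lra.
have Hn := nog _ pY.
have w1 : forall p : nat, p \in l1 -> 0 <= / INR p * lam by rewrite E1 => q; exact: wPL.
have Z11 := wmass_ge1 w1.
(* Markov's inequality; by Mertens' first theorem the mean is at most
   [lam * (ln p + 2) <= 4 * ln p]. *)
have Hg : wmass (tilted lam) l1 / 2 <= wsum (tilted lam) l1 (fun S1 => ind (good S1 p)).
  have B := @wsum_sum_le (tilted lam) l1 (fun p => ln (INR p)) w1 ltac:(rewrite E1 =>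
    q /primes_in_ge1; exact: ln_ge0).
  have sm : \rsum_(p <- l1) (/ INR p * lam * ln (INR p)) <= 4 * ln (INR p).
    rewrite (rsum_eq (g := fun p => lam * (ln (INR p) / INR p))); last by move=> q _;
      rewrite /Rdiv; ring.
    rewrite rsum_mull E1; have M := mertens1_le (level_inv D U) p1.
    apply: (Rle_trans _ (lam * (ln (INR p) + 2))); last nra.
    by apply: Rmult_le_compat_l => //; lra.
  have C : wsum (tilted lam) l1 (fun S => ind (~~ good S p)) <= wmass (tilted lam) l1 / 2.
    apply: (Rle_trans _ (wsum (tilted lam) l1 (fun S =>
      / (8 * ln (INR p)) * \rsum_(p <- S) ln (INR p)))).
      apply: wsum_le => // S HS; rewrite /good; case: decP => /= H.
        apply: Rmult_le_pos; first by left; apply: Rinv_0_lt_compat; lra.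
        by apply: rsum_ge0 => q /(mem_subseq HS); rewrite E1 => /primes_in_ge1; exact: ln_ge0.
      apply: (Rmult_le_reg_l (8 * ln (INR p))); first lra.
      rewrite -Rmult_assoc Rinv_r; lra.
    rewrite wsum_scal.
    have -> : wmass (tilted lam) l1 / 2 = / (8 * ln (INR p)) *
      (4 * ln (INR p) * wmass (tilted lam) l1) by field; lra.
    apply: Rmult_le_compat_l; first by left; apply: Rinv_0_lt_compat; lra.
    by apply: Rle_trans B _; apply: Rmult_le_compat_r; [lra | exact: sm].
  have : wsum (tilted lam) l1 (fun S => ind (good S p)) + wsum (tilted lam) l1 (fun S =>
    ind (~~ good S p)) = wmass (tilted lam) l1.
    by rewrite -wsum_add; apply: wsum_eq => S _; case: (good S p) => /=; lra.
  lra.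
have Z3 : 1 <= wmass (tilted lam) l3 by apply: wmass_ge1 => q; exact: wPL.
(* Only subsequences without a prime in the gap are kept; for these [gap] holds automatically. *)
have H2 : wmass (tilted lam) l3 / 2 <= wsum (tilted lam) l2 (fun S2 =>
  ind (gap G p S2 && ~~ gap_start D U G S2)).
  rewrite E2 E3; apply: Rle_trans (wsum_cat_ge _ _ _); last by move=> S; exact: ind_ge0.
  - apply: Rle_trans Hn _; apply: wsum_le; first by move=> q; exact: wPL.
    by move=> S HS; rewrite (gap_primes_in p1 HS) /=; apply: Rle_refl.
  - by move=> q; exact: wPL.
  - by move=> q; exact: wPL.
rewrite (@wsum_eq _ l1 _ (fun S1 => ind (good S1 p) * wsum (tilted lam) l2 (fun S2 =>
  ind (gap G p S2 && ~~ gap_start D U G S2)))); last first.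
  move=> S1 _; rewrite -wsum_scal; apply: wsum_eq => S2 _; rewrite -ind_and.
  by case: (good S1 _); case: (gap G _ _); case: (gap_start _ _ _ _).
rewrite wsum_scalr (Rmult_comm _ (/ INR p * lam)); apply: Rmult_le_compat_l => //.
apply: (Rle_trans _ (wmass (tilted lam) l1 / 2 * (wmass (tilted lam) l3 / 2)));
  last by apply: Rmult_le_compat; lra.
rewrite {}E2 {}E3 wmass_cat in Zd.
rewrite Zd; set Z1' := wmass _ l1 in Z11 *; set Z3' := wmass _ l3 in Z3 *; set Zg :=
  wmass _ g in gl gu *.
have wp1 : / INR p * lam <= 1.
  have : / INR p <= / 3 by apply: Rinv_le_contravar; lra.
  have : 0 < / INR p by apply: Rinv_0_lt_compat; lra.
  nra.
set wp' := / INR p * lam in wp wp1 *.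
have e19 := exp_pos 19.
apply: (Rmult_le_reg_r (8 * exp 19 * G)); first nra.
have -> : Z1' * ((1 + wp') * (Zg * Z3')) / (8 * exp 19 * G) * (8 * exp 19 * G) =
  Z1' * Z3' * ((1 + wp') * Zg) by field; lra.
have -> : Z1' / 2 * (Z3' / 2) * (8 * exp 19 * G) = Z1' * Z3' * (2 * (G * exp 19)) by field.
apply: Rmult_le_compat_l; first nra.
apply: Rmult_le_compat; try lra.
by have : 0 < exp (-21) by [exact: exp_pos]; nra.
Qed.

(** * From a successful block to an extravagant prime *)

Definition block D U : pred nat := fun p => dec (U <= level D p /\ level D p < 2 * U).

Lemma sum_logs_take n i : (i <= size (primes n))%N ->
  sum_logs n i.+1 = \rsum_(p <- take i (primes n)) ln (INR p).
Proof.
move=> Hi; rewrite /sum_logs foldrE big_map subn1 /=.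
rewrite -(map_nth_iota0 0%N Hi) rsum_map -[1%N]addn0 iotaDl rsum_map.
by apply: rsum_eq => j _; rewrite /pf addKn.
Qed.

Lemma rsum_filterC (a : pred nat) (s : seq nat) (f : nat -> R) :
  \rsum_(p <- s) f p = \rsum_(p <- filter a s) f p + \rsum_(p <- filter (predC a) s) f p.
Proof.
rewrite !rsum_filter -rsum_add; apply: rsum_eq => p _ /=.
by case: (a p); rewrite /= ?Rplus_0_r ?Rplus_0_l.
Qed.

Lemma sorted_mid (S1 S2 : seq nat) (p : nat) : sorted ltn (S1 ++ p :: S2) ->
  (forall q, q \in S1 -> (q < p)%N) /\ (forall q, q \in S2 -> (p < q)%N).
Proof.
rewrite sorted_pairwise; last exact: ltn_trans.
rewrite pairwise_cat /= => /and3P[/allrelP H _ /andP[/allP H2 _]].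
by split=> q Hq; [apply: H; rewrite ?mem_head | exact: H2].
Qed.

Lemma ln_level D (p : nat) : 3 < D -> D <= INR p -> ln (INR p) = ln D * exp (level D p).
Proof. by move=> D3 Dp; rewrite -ln_level_inv level_inv_level. Qed.

(** The witness [p_m] is the successor [q] of the gap start [p]. Write [ln q = v * G * ln p] with
    [v >= 1]. The logarithms below [q] sum to at most [10 * ln p], and
    [ln (ln q / ln D) <= 2 * U * v], so the right-hand side is at most
    [2 * U * v * W * 10 * ln p = ln q]. The two counts place [m] between [0.5 * sqrt r] and
    [0.5 * r]. *)
Lemma success_extravagant N D r x P n U T : setup N D r x P -> 1000 <= x -> in_S r N D n ->
  let W := sqrt (ln (ln (ln N))) in let G := 20 * U * W in
  1 <= W -> ln G <= U / 2 -> x * x <= U -> 2 * U <= T ->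
  x * x / 10 <= INR (count (level_lt D (x * x)) (primes n)) ->
  INR (count (level_lt D T) (primes n)) <= 0.45 * (x * x * x) ->
  block_success D U G (filter (block D U) (primes n)) ->
  extravagantly_spaced r N D n.
Proof.
move=> S x1 HS W G W1 lG xU UT cl ch /hasP[[[S1 p] S2] Ht /=
  /andP[/decP Hgood /andP[/decP Hwin /allP Hgap]]].
have D3 := s_D S; have Hr := s_r S; have l3 := ln3_gt1 D3.
have [n0 [nN [sf [sz HD]]]] := HS.
have x2 : 1000000 <= x * x by nra.
have x3 : 1000 * (x * x) <= x * x * x by nra.
set s := primes n in cl ch Ht sz HD.
have srt : sorted ltn s := sorted_primes n.
have us : uniq s := primes_uniq n.
have E := splits_cat Ht; rewrite /= in E.
have [ltS1 gtS2] : (forall q, q \in S1 -> (q < p)%N) /\ (forall q, q \in S2 -> (p < q)%N).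
  by apply: sorted_mid; rewrite -E; apply: (sorted_filter ltn_trans).
have pF : p \in filter (block D U) s by rewrite E mem_cat mem_head orbT.
have ps : p \in s by move: pF; rewrite mem_filter => /andP[].
have Dp := HD p ps; have p1 : 1 < INR p by lra.
have G0 : 0 < G by rewrite /G; apply: Rmult_lt_0_compat; lra.
have lp : 1 < ln (INR p) by have := @ln_le_mono D (INR p) ltac:(lra) Dp; lra.
have dn (t : R) : forall a b, a \in s -> b \in s -> (a <= b)%N -> level_lt D t b ->
  level_lt D t a := proj2 (down_level t HS D3).
set i0 := index p s.
have i0s : (i0 < size s)%N by rewrite index_mem.
have np : nth 0%N s i0 = p by exact: nth_index.
have c1 : (i0 < count (level_lt D T) s)%N.
  apply: count_sorted_ge => //; first exact: dn.
  by rewrite np; apply/decP; lra.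
have c2 : (count (level_lt D (x * x)) s <= i0)%N.
  apply: count_sorted_le => //; first exact: dn.
  by rewrite np; apply/negP => /decP; lra.
have i1r : INR i0.+1 <= 0.45 * (x * x * x) by apply: Rle_trans ch; exact: leq_INR.
have i1s : (i0.+1 < size s)%N by rewrite sz; apply: INR_ltn; lra.
set q := nth 0%N s i0.+1.
have qs : q \in s by exact: mem_nth.
have pq : (p < q)%N by rewrite -np; apply: (sorted_ltn_nth ltn_trans) => //; rewrite inE.
have Dq := HD q qs.
have uq := level_mono D3 Dp (ltnW pq).
(* If [q] lies in the block, this is the gap condition; otherwise [q] is beyond level [2 * U], and
   the gap ends before that. *)
have lq : G * ln (INR p) <= ln (INR q).
  case: (Rlt_le_dec (level D q) (2 * U)) => Hq.
    have : q \in filter (block D U) s by rewrite mem_filter qs andbT; apply/decP; lra.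
    rewrite E mem_cat in_cons => /or3P[/ltS1|/eqP qp|qS2]; first by move: pq; lia.
      by rewrite qp ltnn in pq.
    exact/decP/Hgap.
  rewrite -(ln_exp (G * _)); apply: ln_le_mono; first exact: exp_pos.
  rewrite -(level_inv_level_gap D3 Dp G0) -(level_inv_level D3 Dq); apply: level_inv_mono => //;
    lra.
have sumb : sum_logs n i0.+2 <= 10 * ln (INR p).
  rewrite sum_logs_take -/s; last exact: ltnW.
  rewrite (rsum_filterC (level_lt D U)).
  (* At most [r <= exp (U / 4)] primes lie below the block, each with logarithm at most
     [ln D * exp U], whereas [ln p >= ln D * exp (1.25 * U)]. *)
  have B1 : \rsum_(y <- filter (level_lt D U) (take i0.+1 s)) ln (INR y) <= ln (INR p).
    apply: (Rle_trans _ (\rsum_(y <- filter (level_lt D U) (take i0.+1 s)) (ln D * exp U))).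
      apply: rsum_le => y; rewrite mem_filter => /andP[/decP Hy /mem_take ys].
      rewrite (ln_level D3 (HD y ys)); apply: Rmult_le_compat_l; first lra.
      by apply: exp_le; lra.
    rewrite rsum_const.
    have szr : INR (size (filter (level_lt D U) (take i0.+1 s))) <= INR r.
      apply: leq_INR; rewrite -sz size_filter; apply: leq_trans (count_size _ _) _.
      by rewrite size_takel // ltnW.
    have e4 : INR r <= exp (U / 4).
      apply: (Rle_trans _ (exp (x * x / 8) * exp (x * x / 8))); last by rewrite -exp_plus;
        apply: exp_le; lra.
      have := exp_ge1 (x * x / 8); set a := exp _ => Ha.
      have H1 : x * x / 8 * (x * x / 8) <= a * a by nra.
      have : 2 * (x * x * x) <= x * x / 8 * (x * x / 8) by nra.
      lra.
    rewrite (ln_level D3 Dp).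
    apply: (Rle_trans _ (exp (U / 4) * (ln D * exp U))).
      apply: Rmult_le_compat_r; last lra.
      by apply: Rmult_le_pos; [lra | left; exact: exp_pos].
    have -> : exp (U / 4) * (ln D * exp U) = ln D * exp (U / 4 + U) by rewrite exp_plus; ring.
    by apply: Rmult_le_compat_l; [lra | apply: exp_le; lra].
  have B2 : \rsum_(y <- filter (predC (level_lt D U)) (take i0.+1 s)) ln (INR y) <= ln (INR p) +
    \rsum_(y <- S1) ln (INR y).
    rewrite -(rsum_cons p S1 (fun y => ln (INR y))); apply: rsum_le_sub.
    - by rewrite filter_uniq // take_uniq.
    - move=> y; rewrite mem_filter => /andP[/= Hy Hyt].
      have ys : y \in s := mem_take Hyt.
      have yp : (y <= p)%N.
        have Hi : (index y s <= i0)%N by rewrite -ltnS; move: Hyt; rewrite in_take_leq.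
        rewrite -np -(nth_index 0%N ys); apply: (sorted_leq_nth leq_trans leqnn) => //.
        - by apply: sub_sorted srt => u v; exact: ltnW.
        - by rewrite inE index_mem.
      have uy := level_mono D3 (HD y ys) yp.
      have : y \in filter (block D U) s.
        rewrite mem_filter ys andbT; apply/decP; split; last lra.
        by apply: Rnot_lt_le => K; case/negP: Hy; apply/decP.
      rewrite E mem_cat !in_cons => /or3P[->|->|/gtS2]; rewrite ?orbT //.
      by move: yp; lia.
    - move=> y Hy; apply: ln_ge0; apply: ge1_INR; apply: (@primes_gt0 n).
      move: Hy; rewrite in_cons => /orP[/eqP -> //|H].
      have : y \in filter (block D U) s by rewrite E mem_cat H.
      by rewrite mem_filter => /andP[].
  apply: Rle_trans (Rplus_le_compat _ _ _ _ B1 B2) _.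
  apply: (Rle_trans _ (ln (INR p) + (ln (INR p) + 8 * ln (INR p)))); last lra.
  by apply: Rplus_le_compat_l; apply: Rplus_le_compat_l.
have Epf : pf n i0.+2 = q by rewrite /pf subn1.
(* [p] has 0-based index [i0], so its successor is [p_m] with [m = i0 + 2] in the 1-based
   numbering. *)
exists i0.+2; rewrite Epf; split; last split.
- have : 0.5 * sqrt (INR r) <= x * x / 10.
    have : sqrt (INR r) <= x * x / 5.
      rewrite -[X in _ <= X]sqrt_square; last lra.
      apply: sqrt_le_1; [exact: pos_INR | nra | nra].
    lra.
  have : INR (count (level_lt D (x * x)) s) < INR i0.+2 by apply: ltn_INR; lia.
  lra.
- by rewrite S_INR; lra.
apply: Rle_ge.
have v0 : 0 < G * ln (INR p) by apply: Rmult_lt_0_compat; lra.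
set v := ln (INR q) / (G * ln (INR p)).
have qv : ln (INR q) = v * (G * ln (INR p)) by rewrite /v; field; split; lra.
have v1 : 1 <= v.
  by apply: (Rmult_le_reg_r (G * ln (INR p))) => //; rewrite -qv; lra.
have uqE : ln (ln (INR q) / ln D) = ln v + ln G + level D p.
  rewrite ln_div; [|lra|lra]; rewrite qv ln_mult; [|lra|lra].
  by rewrite ln_mult /level; lra.
have lv := @ln_sub1 v ltac:(lra).
(* The logarithm is [ln v + ln G + level D p], at most [(v - 1) + U / 2 + 1.5 * U]. *)
have uqb : 0 <= ln (ln (INR q) / ln D) <= 2 * U * v.
  rewrite uqE; have := level_ge0 D3 Dp; have := ln_ge0 v1.
  have : 0 <= ln G by apply: ln_ge0; rewrite /G; nra.
  by split; nra.
have sl0 : 0 <= sum_logs n i0.+2.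
  rewrite sum_logs_take -/s; last exact: ltnW.
  apply: rsum_ge0 => y /mem_take ys; apply: ln_ge0; have := HD y ys; lra.
apply: (Rle_trans _ (2 * U * v * W * (10 * ln (INR p)))).
  rewrite -/W; apply: Rmult_le_compat => //; first by apply: Rmult_le_pos; lra.
  by apply: Rmult_le_compat_r; lra.
by rewrite qv /G; right; ring.
Qed.

(** * Independent blocks and the exceptional events *)

Definition blocks_fail D U W (J : nat) (S : seq nat) : bool :=
  all (fun j => ~~ block_success D (U * 2 ^ j) (20 * (U * 2 ^ j) * W)
    (filter (block D (U * 2 ^ j)) S)) (iota 0 J).

Lemma filter_nil (a : pred nat) (s : seq nat) : (forall p, p \in s -> a p = false) ->
  filter a s = [::].
Proof. by move=> H; apply/eqP; rewrite -(negbK (_ == _)) -has_filter; apply/hasPn => p /H ->. Qed.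

Lemma filter_id (a : pred nat) (s : seq nat) : (forall p, p \in s -> a p) -> filter a s = s.
Proof. by move=> H; apply/all_filterP/allP. Qed.

Lemma primes_in_level_inv_level D s t (p : nat) : 3 < D -> 0 <= s ->
  p \in primes_in (level_inv D s) (level_inv D t) -> s <= level D p < t.
Proof.
move=> D3 s0 /primes_inP[pp [H1 H2]]; have B := level_inv_ge D3 s0.
have p1 : 1 < INR p by lra.
split; last by apply/lt_level_inv.
by apply: Rnot_lt_le => /(lt_level_inv _ D3 p1); lra.
Qed.

Lemma pow2_ge1 j : 1 <= 2 ^ j.
Proof. by apply: pow_R1_Rle; lra. Qed.

Lemma block_cat D U (l1 l2 : seq nat) :
  (forall p, p \in l1 -> level D p < U) -> (forall p, p \in l2 -> U <= level D p < 2 * U) ->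
  filter (block D U) (l1 ++ l2) = l2.
Proof.
move=> H1 H2; rewrite filter_cat filter_nil ?filter_id //.
  by move=> p /H2 ?; apply/decP.
by move=> p /H1 ?; apply/negbTE/negP => /decP; lra.
Qed.

Lemma block_out D U T (l1 l2 : seq nat) : 2 * U <= T -> (forall p, p \in l2 -> T <= level D p) ->
  filter (block D U) (l1 ++ l2) = filter (block D U) l1.
Proof.
move=> UT H2; rewrite filter_cat (filter_nil (s := l2)) ?cats0 //.
by move=> p /H2 ?; apply/negbTE/negP => /decP; lra.
Qed.

(** The blocks are consecutive intervals of primes, so each new block multiplies the mass of failure
    by at most [1 - d]. With [G = 20 * V * W] the success probability [V / (40 * exp 19 * G)] no
    longer depends on the block. *)
Lemma blocks_fail_le D U W lam J : 3 < D -> 1000 <= U -> exp 21 <= W -> 0.98 <= lam <= 1.02 ->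
  (forall j, (j < J)%N -> let G := 20 * (U * 2 ^ j) * W in
     ln G <= U * 2 ^ j / 2 /\ - 1 <= (lam - 1) * ln G <= 1) ->
  let l := primes_in D (level_inv D (U * 2 ^ J)) in
  wsum (tilted lam) l (fun S => ind (blocks_fail D U W J S))
  <= (1 - / (800 * exp 19 * W)) ^ J * wmass (tilted lam) l.
Proof.
move=> D3 U1 W1 lam1; elim: J => [|J IH] HG l.
  rewrite Rmult_1_l; apply: wsum_le => [p|S _]; first by apply: tilted_ge0; lra.
  exact: ind_le1.
have {}IH := IH (fun j Hj => HG j (ltnW Hj)).
have [lG lamG] := HG J (ltnSn J).
have P1 := pow2_ge1 J.
set V := U * 2 ^ J in IH lG lamG *.
have V1 : 1000 <= V by rewrite /V; nra.
have E2 : U * 2 ^ J.+1 = 2 * V by rewrite /V /=; ring.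
have e21 : 22 <= exp 21 by have := exp_ge1 21; lra.
have EL : l = primes_in D (level_inv D V) ++ primes_in (level_inv D V) (level_inv D (2 * V)).
  by rewrite /l E2; apply: primes_in_cat; [apply: level_inv_ge; lra | apply: level_inv_mono; lra].
set l1 := primes_in D (level_inv D V) in EL IH; set l2 := primes_in (level_inv D V) _ in EL.
have w1 : forall p : nat, p \in l1 -> 0 <= / INR p * lam by move=> p; apply: tilted_ge0; lra.
have w2 : forall p : nat, p \in l2 -> 0 <= / INR p * lam by move=> p; apply: tilted_ge0; lra.
have e19 := exp_pos 19.
have BL := @block_lower D V (20 * V * W) lam D3 V1 ltac:(nra) lG lam1 lamG.
rewrite -/l2 in BL.
have dE : V / (40 * exp 19 * (20 * V * W)) = / (800 * exp 19 * W) by field; lra.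
rewrite {}dE in BL; set d := / _ in BL IH *.
have Z2 := wmass_ge1 w2; have Z1 := wmass_ge1 w1.
pose sc S := block_success D V (20 * V * W) S.
have {}BL : d * wmass (tilted lam) l2 <= wsum (tilted lam) l2 (fun S => ind (sc S)) := BL.
have F2 : wsum (tilted lam) l2 (fun S => ind (~~ sc S)) <= (1 - d) * wmass (tilted lam) l2.
  have : wsum (tilted lam) l2 (fun S => ind (~~ sc S)) + wsum (tilted lam) l2 (fun S =>
    ind (sc S)) = wmass (tilted lam) l2.
    by rewrite -wsum_add; apply: wsum_eq => S _; case: (sc S) => /=; lra.
  lra.
have E0 : 0 <= wsum (tilted lam) l1 (fun S => ind (blocks_fail D U W J S)).
  by apply: wsum_ge0 => // S _; exact: ind_ge0.
rewrite EL wmass_cat wsum_cat.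
apply: (Rle_trans _ (wsum (tilted lam) l1 (fun S =>
  ind (blocks_fail D U W J S)) * wsum (tilted lam) l2 (fun S => ind (~~ sc S)))).
  right; rewrite -wsum_scalr; apply: wsum_eq => S1 H1; rewrite -wsum_scal; apply: wsum_eq => S2 H2.
  have u1 p : p \in S1 -> level D p < V.
    move=> /(mem_subseq H1) /primes_inP[_ [Dp H]]; apply/lt_level_inv; lra.
  have u2 p : p \in S2 -> V <= level D p < 2 * V.
    by move=> /(mem_subseq H2); apply: primes_in_level_inv_level; lra.
  rewrite -ind_and; congr (ind _).
  rewrite /blocks_fail -[X in iota 0 X]addn1 iotaD all_cat add0n /= andbT -/V (block_cat u1 u2);
    congr (_ && _).
  apply: eq_in_all => j; rewrite mem_iota add0n => /andP[_ jJ].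
  rewrite (block_out (T := V)) //; last by move=> p /u2; lra.
  have -> : 2 * (U * 2 ^ j) = U * 2 ^ j.+1 by rewrite /=; ring.
  by apply: Rmult_le_compat_l; [lra | apply: Rle_pow; [lra | lia]].
have -> : (1 - d) ^ J.+1 * (wmass (tilted lam) l1 * wmass (tilted lam) l2) =
  (1 - d) ^ J * wmass (tilted lam) l1 * ((1 - d) * wmass (tilted lam) l2) by rewrite /=; ring.
apply: Rmult_le_compat => //.
by apply: wsum_ge0 => // S _; exact: ind_ge0.
Qed.

(** A Chernoff bound with [z = 1 / 2]. It is stated relative to [exp (lam * P1)], an upper bound for
    the mass, because [wsum_transfer] cancels exactly this factor. *)
Lemma low_count_le D t T lam : 3 < D -> 1000 <= t <= T -> 0.98 <= lam <= 1.02 ->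
  let l := primes_in D (level_inv D T) in
  wsum (tilted lam) l (fun S => ind (dec (INR (count (level_lt D t) S) < t / 10)))
  <= exp (lam * \rsum_(p <- l) / INR p) * exp (- 0.3 * t).
Proof.
move=> D3 tT lam1 l.
have w0 : forall p : nat, p \in l -> 0 <= / INR p * lam by move=> p; apply: tilted_ge0; lra.
have l2 := ln2_bounds.
apply: (Rle_trans _ (exp (ln 2 * (t / 10)) * wsum (tilted lam) l (fun S =>
  (/ 2) ^ count (level_lt D t) S))).
  rewrite -wsum_scal; apply: wsum_le => // S _.
  rewrite -Rinv_pow ?inv_pow_exp; try lra; rewrite -exp_plus.
  case: decP => /= H; last by left; exact: exp_pos.
  rewrite -[X in X <= _]exp_0; apply: exp_le; nra.
apply: (Rle_trans _ (exp (ln 2 * (t / 10)) * exp (lam * \rsum_(p <- l) / INR p - 0.49 * (t - 17)))).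
  apply: Rmult_le_compat_l; first by left; exact: exp_pos.
  apply: Rle_trans (wsum_pow (level_lt D t) w0 (z := / 2) ltac:(lra)) _.
  rewrite !rsum_tilted; apply: exp_le.
  have M : t - 17 <= \rsum_(p <- filter (level_lt D t) l) / INR p.
    have [M _] := @mass_level_inv D 0 t D3 ltac:(lra).
    rewrite level_inv0 // in M; apply: (Rle_trans _ (t - 0 - 17)); first lra.
    apply: Rle_trans M _; apply: rsum_le_sub; first exact: primes_in_uniq.
      move=> p /primes_inP[pp [H1 H2]]; have X := @level_inv_mono D t T D3 ltac:(lra).
      rewrite mem_filter; apply/andP; split; last by apply/primes_inP; split => //; lra.
      by apply/decP/lt_level_inv; lra.
    by move=> p; rewrite mem_filter => /andP[_]; exact: inv_ge0.
  set m := bigop _ _ _ in M *; set m' := bigop _ _ _.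
  nra.
by rewrite -!exp_plus; apply: exp_le; nra.
Qed.

(** A Chernoff bound with [z = 2]; 2.25 is chosen so that [2.25 * ln 2] exceeds the bound 1.02 for
    the tilt. *)
Lemma high_count_le D T lam : 3 < D -> 1000 <= T -> 0.98 <= lam <= 1.02 ->
  let l := primes_in D (level_inv D T) in
  wsum (tilted lam) l (fun S => ind (dec (2.25 * T < INR (count (level_lt D T) S))))
  <= exp (lam * \rsum_(p <- l) / INR p) * exp (- 0.05 * T).
Proof.
move=> D3 tT lam1 l.
have w0 : forall p : nat, p \in l -> 0 <= / INR p * lam by move=> p; apply: tilted_ge0; lra.
have l2 := ln2_bounds.
apply: (Rle_trans _ (exp (- (ln 2 * (2.25 * T))) * wsum (tilted lam) l (fun S =>
  2 ^ count (level_lt D T) S))).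
  rewrite -wsum_scal; apply: wsum_le => // S _.
  have -> : 2 ^ count (level_lt D T) S = exp (INR (count (level_lt D T) S) * ln 2) by rewrite
    -pow_exp exp_ln //; lra.
  rewrite -exp_plus.
  case: decP => /= H; last by left; exact: exp_pos.
  rewrite -[X in X <= _]exp_0; apply: exp_le; nra.
apply: (Rle_trans _ (exp (- (ln 2 * (2.25 * T))) * exp (lam * \rsum_(p <- l) / INR p +
  1.02 * (T + 17)))).
  apply: Rmult_le_compat_l; first by left; exact: exp_pos.
  apply: Rle_trans (wsum_pow (level_lt D T) w0 (z := 2) ltac:(lra)) _.
  rewrite !rsum_tilted; apply: exp_le.
  have M : 0 <= \rsum_(p <- filter (level_lt D T) l) / INR p <= T + 17.
    split; first by apply: rsum_ge0 => p; rewrite mem_filter => /andP[_]; exact: inv_ge0.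
    have [_ M] := @mass_level_inv D 0 T D3 ltac:(lra).
    rewrite level_inv0 // in M; apply: (Rle_trans _ (T - 0 + 17)); last lra.
    apply: Rle_trans M; apply: rsum_le_sub; first by rewrite filter_uniq ?primes_in_uniq.
      by move=> p; rewrite mem_filter => /andP[].
    by move=> p; exact: inv_ge0.
  set m := bigop _ _ _ in M *; set m' := bigop _ _ _.
  nra.
by rewrite -!exp_plus; apply: exp_le; nra.
Qed.

Lemma pow2_floor y : 1 <= y -> exists J : nat, 2 ^ J <= y < 2 ^ J.+1.
Proof.
move=> y1.
have ex : exists n, dec (y < 2 ^ n).
  have [n [H1 H2]] := @ceil_nat y ltac:(lra); exists n.+1; apply/decP.
  apply: Rle_lt_trans H2 _; elim: n {H1} => [|n IH]; first by rewrite /=; lra.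
  by rewrite S_INR -[2 ^ n.+2]/(2 * 2 ^ n.+1); have := pos_INR n; lra.
case: (ex_minnP ex) => -[|n] /decP H Hm; first by move: H => /=; lra.
exists n; split => //; apply: Rnot_lt_le => K.
by have := Hm n; rewrite ltnn => X; have := X (introT (decP _) K).
Qed.

(** As [ln (ln N)] lies between [x ^ 3] and [4 / 3 * x ^ 3], [W ^ 2] equals [3 * ln x] up to an
    error 1. The threshold [exp (exp 42)] yields [W >= exp 21], which [blocks_fail_le] requires. *)
Lemma setup_W N D r x P : setup N D r x P -> 10000000 <= x -> exp (exp 42) <= x ->
  let W := sqrt (ln (ln (ln N))) in exp 21 <= W /\ W <= x / 100 /\ W * W <= 1 + 3 * ln x.
Proof.
move=> S x6 xe W; have ll := s_ll S; have x1 := s_x S.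
have x3 : 0 < x * x * x by do 2?apply: Rmult_lt_0_compat; lra.
have lx : exp 42 <= ln x by apply: exp_le_ln.
have e42 := exp_ge1 42.
have L1 : 3 * ln x <= ln (ln (ln N)).
  have : ln (x * x * x) <= ln (ln (ln N)) by apply: ln_le_mono; lra.
  by rewrite !ln_mult; try lra; nra.
have L2 : ln (ln (ln N)) <= 1 + 3 * ln x.
  have : ln (ln (ln N)) <= ln (4 / 3 * (x * x * x)) by apply: ln_le_mono; lra.
  rewrite (ln_mult (4 / 3)) // ?(ln_mult (x * x)) ?(ln_mult x x); try lra; last nra.
  have := @ln_sub1 (4 / 3) ltac:(lra); lra.
have WW : W * W = ln (ln (ln N)) by rewrite /W sqrt_sqrt; lra.
have e21 : exp 42 = exp 21 * exp 21 by rewrite -exp_plus; congr exp; lra.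
have e0 := exp_ge1 21.
have W21 : exp 21 <= W.
  rewrite /W -(sqrt_square (exp 21)); last lra.
  by apply: sqrt_le_1; nra.
split => //; split; last lra.
have sx : 1000 <= sqrt x.
  by have -> : 1000 = sqrt (1000 * 1000) by [rewrite sqrt_square; lra]; apply: sqrt_le_1; lra.
have sx2 : sqrt x * sqrt x = x by rewrite sqrt_sqrt; lra.
have lx2 : ln x <= 2 * sqrt x.
  have := @ln_sub1 (sqrt x) ltac:(lra); rewrite ln_sqrt; lra.
nra.
Qed.

(** The bound [x / 2] matches [|lam - 1| <= 2 / x], so that tilting changes the mass of a gap by a
    constant factor only. *)
Lemma ln_gap_le U W x : 10000000 <= x -> x * x <= U -> U <= x * x * x -> 1 <= W <= x ->
  0 <= ln (20 * U * W) <= x / 2 /\ ln (20 * U * W) <= U / 2.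
Proof.
move=> x6 xU Ux Wx.
have x2 : 1000000 * x <= x * x by nra.
have UW : 1 <= 20 * U * W by nra.
have B : ln (20 * U * W) <= x / 2.
  rewrite -(ln_exp (x / 2)); apply: ln_le_mono; first lra.
  have -> : exp (x / 2) = exp (x / 10) * exp (x / 10) * (exp (x / 10) * exp (x / 10)) * exp
    (x / 10).
    by rewrite -!exp_plus; congr exp; field.
  have := exp_ge1 (x / 10); set a := exp _ => Ha; set y := x / 10 in Ha *.
  have xy : x = 10 * y by rewrite /y; field.
  have y1 : 1000000 <= y by lra.
  have a2 : y * y <= a * a by nra.
  have a4 : y * y * (y * y) <= a * a * (a * a) by apply: Rmult_le_compat => //; nra.
  have y4 : 0 <= y * y * (y * y) by apply: Rmult_le_pos; nra.
  have a5 : y * y * (y * y) * 1000000 <= a * a * (a * a) * a.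
    by apply: Rmult_le_compat => //; lra.
  have : 20 * U * W <= 20 * (x * x * x) * x by apply: Rmult_le_compat; nra.
  rewrite xy; nra.
split; last nra.
by split=> //; exact: ln_ge0.
Qed.

Lemma blocks_number x W : 10000000 <= x -> exp 21 <= W -> W * W <= 1 + 3 * ln x ->
  forall J : nat, 0.2 * x < 2 ^ J.+1 -> W * W / 4 <= INR J.
Proof.
move=> x6 W21 WW J HJ.
have e0 := exp_ge1 21; have l2 := ln2_bounds.
have H : ln (0.2 * x) < ln (2 ^ J.+1) by apply: ln_increasing; lra.
rewrite ln_pow in H; last lra.
rewrite ln_mult in H; try lra.
have l5 : - 4 <= ln 0.2 by have := @ln_gt1sub 0.2 ltac:(lra); lra.
rewrite S_INR in H; have := pos_INR J; nra.
Qed.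

(** The event only concerns primes of level below [T] when the blocks end at [T]. It is then
    unaffected by deleting a larger prime, and it depends only on the part [l1] in
    [wsum_transfer]. *)
Definition ext_bad D U T W J : pred (seq nat) := fun S =>
  [|| dec (INR (count (level_lt D U) S) < U / 10), dec (2.25 * T < INR (count (level_lt D T) S)) |
      blocks_fail D U W J S].

Lemma filter_rem (a : pred nat) (s : seq nat) (p : nat) : uniq s -> ~~ a p ->
  filter a (rem p s) = filter a s.
Proof.
move=> us ap; rewrite rem_filter // -filter_predI; apply: eq_in_filter => q _ /=.
by case: eqP => [->|_]; rewrite ?andbT // (negbTE ap).
Qed.

(** Since [ln N = ln D * exp (x ^ 3)], the at most [r] primes of level below [T <= x ^ 3 / 5]
    contribute at most [r * ln D * exp T <= ln N / 4] to [ln n]. *)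
Lemma rem_mass_T N D r x P n T : setup N D r x P -> 1000 <= x -> in_S r N D n -> sqrt N <= INR n ->
  0 <= T <= 0.2 * (x * x * x) ->
  ln N / 4 <= \rsum_(p <- primes n) (if level_lt D T p then 0 else ln (INR p)).
Proof.
move=> S x1 HS Hn HT.
have N0 := s_N S; have lN := s_lN S; have D3 := s_D S; have Hr := s_r S; have l3 := ln3_gt1 D3;
  have L := s_L S.
have [n0 [nN [sf [sz HD]]]] := HS.
have H1 := ln_half_N N0 Hn.
have x3 : 0 < x * x * x by do 2?apply: Rmult_lt_0_compat; lra.
have x6 : 1000 * (x * x) <= x * x * x by nra.
have B : \rsum_(p <- primes n) (if level_lt D T p then ln (INR p) else 0) <= ln N / 4.
  apply: (Rle_trans _ (\rsum_(p <- primes n) (ln D * exp T))).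
    apply: rsum_le => p Hp; rewrite /level_lt; case: decP => [H|_].
      rewrite (ln_level D3 (HD p Hp)); apply: Rmult_le_compat_l; first lra.
      by apply: exp_le; lra.
    by apply: Rmult_le_pos; [lra | left; exact: exp_pos].
  rewrite rsum_const sz.
  have lNE : ln N = ln D * exp (x * x * x).
    have -> : x * x * x = ln (ln N) - ln (ln D) by lra.
    by rewrite /Rminus exp_plus exp_Ropp !exp_ln; [field | |]; lra.
  rewrite lNE.
  have e1 : INR r * exp T <= exp (x * x * x) / 4.
    apply: (Rle_trans _ (2 * (x * x * x) * exp (0.2 * (x * x * x)))).
      by apply: Rmult_le_compat; [exact: pos_INR | left; exact: exp_pos | lra | apply: exp_le; lra].
    have -> : exp (x * x * x) = exp (0.8 * (x * x * x)) * exp (0.2 * (x * x * x)) by rewrite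
      -exp_plus; congr exp; lra.
    have e8 : 8 * (x * x * x) <= exp (0.8 * (x * x * x)).
      have -> : exp (0.8 * (x * x * x)) = exp (0.4 * (x * x * x)) * exp (0.4 * (x * x * x)) by
        rewrite -exp_plus; congr exp; lra.
      have := exp_ge1 (0.4 * (x * x * x)); set a := exp _ => Ha.
      have xx : 1000 <= x * x * x by nra.
      nra.
    have := exp_pos (0.2 * (x * x * x)); set b := exp _ => b0; nra.
  nra.
have E : \rsum_(p <- primes n) (if level_lt D T p then ln (INR p) else 0) +
  \rsum_(p <- primes n) (if level_lt D T p then 0 else ln (INR p)) = ln (INR n).
  rewrite -(ln_in_S HS) -rsum_add; apply: rsum_eq => p _; case: (level_lt D T p); lra.
lra.
Qed.

Lemma extravagant_setup N D r x P : setup N D r x P -> 10000000 <= x -> exp (exp 42) <= x ->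
  prob_S r N D (fun n => ~ extravagantly_spaced r N D n)
  <= exp 110 * 40 * exp (- / (3200 * exp 19) * sqrt (ln (ln (ln N)))).
Proof.
move=> S x7 xe; have [W21 [Wx WW]] := setup_W S x7 xe.
set W := sqrt _ in W21 Wx WW *.
have [P0 lam2] := setup_lambda S; set k := r.-1 in lam2; set lam := INR k / P in lam2.
have N0 := s_N S; have lN := s_lN S; have D3 := s_D S; have Hr := s_r S; have PE := s_PE S;
  have HP := s_P S.
have r2 := s_r2 S; have L := s_L S; have ll := s_ll S; have l3 := ln3_gt1 D3.
have x2 : 10000000 * x <= x * x by nra.
have x3 : 10000000 * (x * x) <= x * x * x by nra.
have e21 := exp_ge1 21.
(* The blocks run from level [x ^ 2] to [T <= 0.2 * x ^ 3]: outside rare events at most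
   [2.25 * T <= 0.45 * x ^ 3] primes lie below [T], which keeps [m < 0.5 * r]. *)
have [J [J1 J2]] := @pow2_floor (0.2 * x) ltac:(lra).
have JW := blocks_number x7 W21 WW J2.
set U := x * x in x2 x3 HP Hr L ll *.
set T := U * 2 ^ J.
have p2 := pow2_ge1 J.
have TU : U <= T by rewrite /T; nra.
have T3 : T <= 0.2 * (U * x) by rewrite /T; nra.
have ix : 0 < / x by apply: Rinv_0_lt_compat; lra.
have ix1 : / x <= / 100 by apply: Rinv_le_contravar; lra.
have lamb : 0.98 <= lam <= 1.02 by rewrite /Rdiv in lam2; lra.
have HG j : (j < J)%N -> 2 * (U * 2 ^ j) <= T /\ let G := 20 * (U * 2 ^ j) * W in
     ln G <= U * 2 ^ j / 2 /\ - 1 <= (lam - 1) * ln G <= 1.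
  move=> jJ.
  have h1 : 2 * (U * 2 ^ j) <= T.
    have -> : 2 * (U * 2 ^ j) = U * 2 ^ j.+1 by rewrite /=; ring.
    by apply: Rmult_le_compat_l; [lra | apply: Rle_pow; [lra | lia]].
  split=> // G; have j1 := pow2_ge1 j.
  have [[g0 g1] g2] := @ln_gap_le (U * 2 ^ j) W x x7 ltac:(rewrite -/U; nra) ltac:(rewrite -/U;
    lra) ltac:(lra).
  split => //; rewrite -/G in g0 g1.
  have i2 : 2 / x * (x / 2) = 1 by field; lra.
  have i3 : 2 / x * ln G <= 1 by rewrite -i2; apply: Rmult_le_compat_l => //; rewrite /Rdiv; lra.
  nra.
pose B := ext_bad D U T W J.
have HB n : in_S r N D n -> ~ extravagantly_spaced r N D n -> B (primes n).
  move=> HS Hne; apply/negPn/negP => /norP[/negP c1 /norP[/negP c2 /allPn [j]]].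
  rewrite mem_iota => /andP[_ jJ] /negPn suc; apply: Hne.
  have [h1 [h2 h3]] := HG j jJ.
  have j1 := pow2_ge1 j.
  apply: (success_extravagant (T := T) S _ HS _ h2 _ h1 _ _ suc); rewrite -/U -?/W; try lra.
  - by rewrite -{1}(Rmult_1_r U); apply: Rmult_le_compat_l; lra.
  - by apply: Rnot_lt_le => K; apply: c1; apply/decP.
  - apply: (Rle_trans _ (2.25 * T)); last lra.
    by apply: Rnot_lt_le => K; apply: c2; apply/decP.
have HBrem n p : p \in primes n -> ~~ level_lt D T p -> B (rem p (primes n)) = B (primes n).
  move=> Hp nT; have us := primes_uniq n.
  have uT : T <= level D p by apply: Rnot_lt_le => K; case/negP: nT; apply/decP.
  have nU : ~~ level_lt D U p by apply/negP => /decP; lra.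
  rewrite /B /ext_bad -!size_filter !filter_rem //; congr [|| _, _ | _].
  apply: eq_in_all => j; rewrite mem_iota => /andP[_ jJ].
  rewrite filter_rem //; have [h1 _] := HG j jJ.
  by apply/negP => /decP; lra.
apply: Rle_trans (prob_upper (B := B) S _) _.
  move=> n HS Hne Hn.
  apply: Rle_trans (@rem_mass_T N D r x P n T S ltac:(lra) HS Hn ltac:(split; rewrite -/U; lra)) _.
  apply: rsum_le => p Hp; have l0 := ln_primes_ge0 Hp.
  case HT : (level_lt D T p); first by apply: Rmult_le_pos => //; exact: ind_ge0.
  by rewrite HBrem ?HT // HB //=; lra.
rewrite Rmult_assoc; apply: Rmult_le_compat_l; first by left; exact: exp_pos.
set l1 := primes_in D (level_inv D T); set l2 := primes_in (level_inv D T) N.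
have XN : level_inv D T <= N.
  rewrite -(exp_ln N) // /level_inv; apply: exp_le.
  rewrite -(exp_ln (ln N)); last lra.
  rewrite -{1}(exp_ln (ln D)); last lra.
  by rewrite -exp_plus; apply: exp_le; lra.
have EL : primes_in D N = l1 ++ l2 by apply: primes_in_cat => //; apply: level_inv_ge; lra.
have v1 : forall p : nat, p \in l1 -> 0 <= / INR p by move=> p; exact: inv_ge0.
have v2 : forall p : nat, p \in l2 -> 0 <= / INR p by move=> p; exact: inv_ge0.
set P1 := \rsum_(p <- l1) / INR p; set Q := \rsum_(p <- l2) / INR p.
have PQ : P = P1 + Q by rewrite PE EL rsum_cat.
have P1b : P1 <= T + 17.
  have [_ M] := @mass_level_inv D 0 T D3 ltac:(lra).
  by rewrite level_inv0 // in M; apply: Rle_trans M _; lra.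
have k0 : (0 < k)%N by rewrite /k; lia.
have tr := @wsum_transfer recip l1 l2 k (fun S => ind (B S)) v1 v2 (fun S _ => ind_ge0 _).
have {}tr : wsum recip (primes_in D N) (fun S => ind (size S == k) * ind (B S)) <=
  12 * exp (- (lam * P1)) * wsum (tilted lam) l1 (fun S => ind (B S)) * exp_term P k.
  rewrite EL /lam PQ; apply: tr => //; rewrite -/P1 -/Q -?PQ -/lam; try lra; last first.
    by apply: (Rle_trans _ (0.98 * 3)); [lra | apply: Rmult_le_compat; lra].
  move=> S1 S2 H1 H2; congr (ind _).
  have u2 p : p \in S2 -> T <= level D p.
    move=> /(mem_subseq H2) /primes_inP[_ [H _]]; have Dp := @level_inv_ge D T D3 ltac:(lra).
    by apply: Rnot_lt_le => K; apply/(Rle_not_lt _ _ H)/lt_level_inv; lra.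
  have nu t p : t <= T -> p \in S2 -> level_lt D t p = false.
    by move=> tT /u2 ?; apply/negbTE/negP => /decP; lra.
  rewrite /B /ext_bad -!size_filter !filter_cat (filter_nil (s :=
    S2) (nu U ^~ TU)) (filter_nil (s := S2) (nu T ^~ (Rle_refl T))) !cats0.
  congr [|| _, _ | _]; apply: eq_in_all => j; rewrite mem_iota => /andP[_ jJ].
  by have [h1 _] := HG j jJ; rewrite (block_out _ h1 u2).
have PW : 0 < exp_term P k by exact: exp_term_gt0.
have w1 : forall p : nat, p \in l1 -> 0 <= / INR p * lam by move=> p; apply: tilted_ge0; lra.
set c := / (3200 * exp 19).
have e19 := exp_ge1 19.
have c1 : 0 < c <= / 3200.
  split; first by apply: Rinv_0_lt_compat; lra.
  by apply: Rinv_le_contravar; lra.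
have cW : 0 < c * W <= x.
  split; first by apply: Rmult_lt_0_compat; lra.
  apply: (Rle_trans _ (/ 3200 * (x / 100))); last lra.
  by apply: Rmult_le_compat; lra.
have three : wsum (tilted lam) l1 (fun S => ind (B S)) <= exp (lam * P1) * (3 * exp (- c * W)).
  apply: (Rle_trans _ (exp (lam * P1) * exp (- 0.3 * U) +
    (exp (lam * P1) * exp (- 0.05 * T) + exp (lam * P1) * exp (- c * W)))).
    apply: (Rle_trans _ (wsum (tilted lam) l1 (fun S =>
      ind (dec (INR (count (level_lt D U) S) < U / 10)))
       + (wsum (tilted lam) l1 (fun S => ind (dec (2.25 * T < INR (count (level_lt D T) S))))
        + wsum (tilted lam) l1 (fun S => ind (blocks_fail D U W J S))))).
      rewrite -!wsum_add; apply: wsum_le => // S' _; rewrite /B /ext_bad.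
      case: (dec _); case: (dec _); case: (blocks_fail _ _ _ _ _) => /=; lra.
    apply: Rplus_le_compat; first by apply: low_count_le => //; lra.
    apply: Rplus_le_compat; first by apply: high_count_le => //; lra.
    apply: Rle_trans (@blocks_fail_le D U W lam J D3 ltac:(lra) W21 lamb (fun j Hj =>
      proj2 (HG j Hj))) _.
    have Zl := wmass_le w1; rewrite rsum_tilted -/P1 in Zl.
    have Z1 := wmass_ge1 w1.
    set d := / (800 * exp 19 * W).
    have d1 : 0 < d <= 1.
      have e1 : 1 <= 800 * exp 19 * W by rewrite -(Rmult_1_l 1); apply: Rmult_le_compat; lra.
      split; first by apply: Rinv_0_lt_compat; lra.
      by rewrite -Rinv_1; apply: Rinv_le_contravar; lra.
    rewrite [exp (lam * P1) * _]Rmult_comm; apply: Rmult_le_compat => //;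
      [by apply: pow_le; lra | |].
      by apply: Rle_trans Z1; lra.
    apply: (Rle_trans _ (exp (- d) ^ J)).
      apply: pow_incr; split; first lra.
      by have := exp_ge1 (- d); lra.
    rewrite pow_exp; apply: exp_le.
    (* At least [W ^ 2 / 4] blocks, each succeeding with probability at least
       [d = / (800 * exp 19 * W)], give the exponent [c * W]. *)
    have : c * W = W * W / 4 * d by rewrite /c /d; field; lra.
    have : W * W / 4 * d <= INR J * d by apply: Rmult_le_compat_r; lra.
    lra.
  rewrite -!Rmult_plus_distr_l; apply: Rmult_le_compat_l; first by left; exact: exp_pos.
  have : exp (- 0.3 * U) <= exp (- c * W) by apply: exp_le; lra.
  have : exp (- 0.05 * T) <= exp (- c * W) by apply: exp_le; lra.
  lra.
have iN : / ln N <= exp (- c * W).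
  rewrite -(exp_ln (ln N)); last lra.
  by rewrite -exp_Ropp; apply: exp_le; lra.
have main : wsum recip (primes_in D N) (fun S => ind (size S == k) * ind (B S)) / exp_term P k <=
  36 * exp (- c * W).
  apply: (Rmult_le_reg_r (exp_term P k)) => //; rewrite {1}/Rdiv Rmult_assoc Rinv_l ?Rmult_1_r;
    last lra.
  apply: Rle_trans tr _; apply: Rmult_le_compat_r; first lra.
  apply: (Rle_trans _ (12 * exp (- (lam * P1)) * (exp (lam * P1) * (3 * exp (- c * W))))).
    by apply: Rmult_le_compat_l => //; have := exp_pos (- (lam * P1)); lra.
  have E : exp (- (lam * P1)) * exp (lam * P1) = 1 by rewrite -exp_plus Rplus_opp_l exp_0.
  have -> : 12 * exp (- (lam * P1)) * (exp (lam * P1) * (3 * exp (- c * W))) =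
    36 * (exp (- (lam * P1)) * exp (lam * P1)) * exp (- c * W) by ring.
  rewrite E; lra.
by rewrite -/k; have := exp_pos (- c * W); lra.
Qed.

Lemma extravagant_prob : exists c C : R, 0 < c /\ 0 < C /\
     forall (N D : R) (r : nat), hyps N D r ->
       prob_S r N D (fun n => ~ extravagantly_spaced r N D n)
         <= C * exp (- c * sqrt (ln (ln (ln N)))).
Proof.
pose x0 := Rmax 10000000 (exp (exp 42)).
have x7 : 10000000 <= x0 by exact: Rmax_l.
have xe : exp (exp 42) <= x0 by exact: Rmax_r.
have [N0 HN0] := @setup_ex x0 ltac:(lra).
pose M := Rmax N0 31; have M31 : 31 <= M by exact: Rmax_r.
pose c := / (3200 * exp 19).
have c0 : 0 < c by apply: Rinv_0_lt_compat; have := exp_pos 19; lra.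
pose C2 := exp (c * sqrt (ln (ln (ln M)))).
have C20 : 0 < C2 by exact: exp_pos.
have e110 := exp_pos 110.
exists c, (exp 110 * 40 + C2); split => //; split; first lra.
move=> N D r Hh.
have N30 : N > 30 by case: Hh.
have lN1 : 1 < ln N by apply: ln3_gt1; lra.
have llN : 0 < ln (ln N) by exact: ln_gt0.
set F := exp (- c * _); have F0 : 0 < F by exact: exp_pos.
(* For [N < N0] the trivial bound 1 is at most [C2 * F], by monotonicity of the iterated logarithm
   and [N <= M]. *)
case: (Rle_lt_dec N0 N) => HN; last first.
  apply: Rle_trans (prob_S_le1 _ _ _ _) _.
  have : 1 <= C2 * F; last nra.
  rewrite /C2 /F -exp_plus -[X in X <= _]exp_0; apply: exp_le.
  have : sqrt (ln (ln (ln N))) <= sqrt (ln (ln (ln M))); last nra.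
  apply: sqrt_le_1_alt; apply: ln_le_mono => //; apply: ln_le_mono; first lra; apply: ln_le_mono;
    first lra.
  by have := Rmax_l N0 31; rewrite -/M; lra.
have [x [P [xx0 S]]] := HN0 N D r Hh HN.
have H := @extravagant_setup N D r x P S ltac:(lra) ltac:(lra).
apply: Rle_trans H _; rewrite -/c -/F; nra.
Qed.

Theorem theorem5p4 :
  (exists C : R, 0 < C /\
     forall (N D : R) (r : nat) (D1 : R), hyps N D r -> D1 > 3 ->
       prob_S r N D (fun n => ~ comfortably_spaced r D1 n)
         <= C * (/ ln D1 + Rpower (ln N) (- (1/2))))
  /\
  (exists c C : R, 0 < c /\ 0 < C /\
     forall (N D : R) (r : nat) (C0 : R), hyps N D r -> C0 > 0 ->
       prob_S r N D (fun n => ~ regular r D C0 n)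
         <= C * (exp (- c * C0) + exp (- c * Rpower (ln (ln N)) (1/3))))
  /\
  (exists c C : R, 0 < c /\ 0 < C /\
     forall (N D : R) (r : nat), hyps N D r ->
       prob_S r N D (fun n => ~ extravagantly_spaced r N D n)
         <= C * exp (- c * sqrt (ln (ln (ln N))))).
Proof.
exact: (conj comfortable_prob (conj regular_prob extravagant_prob)).
Qed.
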